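(* Let $p\ge1$, let $n,d,k$ be positive integers with $k\le d$ and $\varepsilon\in(0,1)$. Suppose $\mathcal D$ is a probability distribution over matrices $S\in\mathbb{R}^{m\times n}$ (not depending on the input) and $E_p$ is an estimator (a function of $SA$, $Sb$, $x$) such that for every $A\in\mathbb{R}^{n\times d}$, $b\in\mathbb{R}^n$, with constant probability over $S\sim\mathcal D$, every minimizer $\tilde x\in\operatorname{argmin}_{x\in\Psi_k}E_p(SA,Sb,x)$ satisfies $\|A\tilde x-b\|_p\le(1+\varepsilon)\min_{x\in\Psi_k}\|Ax-b\|_p$. Then $m=\Omega(k\log(d/k)/\varepsilon^2)$.
   Context: $\Psi_k=\{x\in\mathbb{R}^d:\|x\|_0\le k\}$ is the set of $k$-sparse vectors; $\|y\|_p=(\sum_i|y_i|^p)^{1/p}$.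
   Formalization: The success probability is a fixed q > 1/2; n ≥ C k log(d/k)/ε² is assumed (C depending on p, q), since S = identity refutes the claim for small n; a minimizer must exist; and the success event must contain a set jointly measurable in (S, A, b) whose probability over S is at least q. *)

(* Defs.v *)
From HB Require Import structures.
From mathcomp Require Import all_boot all_order all_algebra.
From mathcomp Require Import all_classical all_reals all_analysis.

Set Implicit Arguments.
Unset Strict Implicit.
Unset Printing Implicit Defensive.

Import Order.TTheory GRing.Theory Num.Theory.
Import numFieldNormedType.Exports.

Local Open Scope classical_set_scope.
Local Open Scope ring_scope.

(* MathComp-Analysis. *)

(* The matrices with the Borel sigma-algebra of their usual topology. *)
Notation borel_mx R m n := (g_sigma_algebraType (@open 'M[R]_(m, n))).

Definition lp_norm (R : realType) (p : R) (n : nat) (y : 'cV[R]_n) : R :=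
  (\sum_(i < n) `|y i ord0| `^ p) `^ p^-1.

Definition l0_norm (R : realType) (d : nat) (x : 'cV[R]_d) : nat :=
  #|[pred i | x i ord0 != 0]|.

Definition sparse (R : realType) (d k : nat) : set 'cV[R]_d :=
  [set x | (l0_norm x <= k)%N].
Arguments sparse R d k : clear implicits.

Definition argmin (R : realType) (T : Type) (D : set T) (f : T -> R) : set T :=
  [set x | D x /\ forall y, D y -> f x <= f y].

(* The infimum is attained: A maps the k-sparse vectors onto a finite union of
   linear subspaces. *)
Definition sparse_opt (R : realType) (p : R) (n d k : nat)
    (A : 'M[R]_(n, d)) (b : 'cV[R]_n) : R :=
  inf [set lp_norm p (A *m x - b) | x in sparse R d k].

(* The estimator sees the input only through S *m A and S *m b.  An outcome
   where it has no minimizer is a failure, not a vacuous success. *)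
Definition sketch_succeeds (R : realType) (p : R) (n d k m : nat) (eps : R)
    (E : 'M[R]_(m, d) -> 'cV[R]_m -> 'cV[R]_d -> R)
    (S : 'M[R]_(m, n)) (A : 'M[R]_(n, d)) (b : 'cV[R]_n) : Prop :=
  argmin (sparse R d k) (E (S *m A) (S *m b)) !=set0 /\
  forall x, argmin (sparse R d k) (E (S *m A) (S *m b)) x ->
    lp_norm p (A *m x - b) <= (1 + eps) * sparse_opt p k A b.

(* For every input (A, b), the sketch succeeds with probability at least q over
   S ~ P.  No regularity is imposed on E, so the success event need not be
   measurable: it is only required to contain an event G of probability at
   least q, and G is jointly measurable in the sketch and the input (so that
   Tonelli's theorem applies to random inputs). *)
Definition oblivious_sketch (R : realType) (p : R) (n d k m : nat) (eps q : R)
    (P : probability (borel_mx R m n) R)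
    (E : 'M[R]_(m, d) -> 'cV[R]_m -> 'cV[R]_d -> R) : Prop :=
  exists G : set (borel_mx R m n * (borel_mx R n d * borel_mx R n 1)),
    [/\ measurable G,
        forall S A b, G (S, (A, b)) -> sketch_succeeds p k eps E S A b &
        forall A b, (q%:E <= P [set S | G (S, (A, b))])%E].

(* Main.v *)
Require Import Defs.
From HB Require Import structures.
From mathcomp Require Import all_boot all_order all_algebra.
From mathcomp Require Import all_classical all_reals all_analysis.
From mathcomp Require Import measurable_realfun ring lra zify.
Import Order.TTheory GRing.Theory Num.Theory.
Import numFieldNormedType.Exports.
Local Open Scope classical_set_scope.
Local Open Scope ring_scope.

Set Implicit Arguments.
Unset Strict Implicit.
Unset Printing Implicit Defensive.

(** Yao's principle against a planted code.  Fix the sketch [S] and draw the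
    input: the columns of [A] form [l] blocks of [s] Gaussian columns, a word
    [I] picks one column [a_I j] per block, and
    [b = tau g + h l^(-1/2) sum_j a_I j] with [g] Gaussian noise.  Extra rows with
    a huge constant [M] force every good solution to be close to the indicator of
    a word.  The residual of the word [J] is Gaussian noise whose standard
    deviation decreases with the number of positions where [J] agrees with [I];
    with [h] of order [eps], a [(1 + eps)]-approximate solution must agree with [I]
    on 3/4 of the positions as soon as [n] is so large that p-norms of Gaussian
    vectors concentrate up to a factor [1 + eps / 20].

    The decoder sees [b] only through [S], so the signal can be replaced by its
    projection on the [m]-dimensional row space of [S], of square norm [O(eps^2 m)]
    relative to the noise.  Translating a Gaussian by such a vector changes the
    probability of an event little unless [eps^2 m] is of order [ln (s^l)], whereas
    each decoded value is correct for few of the [s^l] words.  Hence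
    [m >= c l ln s / eps^2].  Inputs with [n] or [k] below [k ln (d/k) / eps^2] are
    covered by [m >= min(n, k)], which already follows from exact recovery. *)

(** * Gaussian measures on Borel matrix spaces *)

(** The estimator being arbitrary, all that is retained of it is a count: once [S] and [A] are
    fixed, the value of [S b] fixes the set of minimizers, hence a decoded word, so it can be right
    for at most [L] words, [L] being the size of a Hamming ball of relative radius 1/4. No
    measurability of the decoder enters. The translated Gaussians are compared with the untranslated
    one through the chi-square divergence [exp |w|^2 - 1]. With [N = s^l], the average success
    probability is, up to rare events, at most [L / N] plus the square root of
    [(L / N) (exp |w|^2 - 1)]. Two bounds on [L] serve: [L <= N / 2] contradicts a success
    probability above 1/2 even for the smallest codes, and [L <= N^(7/8)] lets [|w|^2] grow up to a
    small multiple of [ln N], the source of the logarithm. The order of choices matters: a bound [K]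
    on the Gaussian matrix determines [M], which determines the input law, which determines a good
    sketch [S], which determines the projection. The concentration estimates therefore hold for
    every [S]. *)

Lemma measurable_mx_entry (R : realType) m n (i : 'I_m) (j : 'I_n) :
  measurable_fun setT (fun A : borel_mx R m n => (A : 'M[R]_(m, n)) i j).
Proof.
apply: (measurability _ (RGenOpens.measurableE R)).
move=> _ [_ [a [b ->]] <-]; rewrite setTI; apply: sub_sigma_algebra.
have := @coord_continuous R m n i j => /continuousP; apply.
exact: interval_open.
Qed.

(** Boxes with rational centre and radius [1 / (N + 1)] form a countable base: an open [U] is the
    union of those it contains, and the preimage of a box is a finite intersection of conditions on
    entries. *)
Lemma measurable_mx (R : realType) d (T : measurableType d) m n
    (f : T -> borel_mx R m n) :
  (forall i j, measurable_fun setT (fun x => (f x : 'M[R]_(m, n)) i j)) ->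
  measurable_fun setT f.
Proof.
move=> mf; apply: (@measurability _ _ _ (borel_mx R m n) setT f (@open 'M[R]_(m, n)) erefl).
move=> _ [U oU <-]; rewrite setTI.
pose box (c : 'M[rat]_(m, n) * nat) : set 'M[R]_(m, n) :=
  [set A | forall i j, `|ratr (c.1 i j) - A i j| < c.2.+1%:R^-1].
have mbox c : measurable (f @^-1` box c).
  rewrite (_ : _ @^-1` _ =
      \bigcap_(ij in [set: 'I_m * 'I_n])
        [set x | `|ratr (c.1 ij.1 ij.2) - (f x : 'M[R]_(m, n)) ij.1 ij.2| < c.2.+1%:R^-1]).
    apply: fin_bigcap_measurable; first exact: finite_finset.
    move=> ij _; rewrite -[X in measurable X]setTI.
    apply: (@measurable_fun_ltr _ _ _ _
      (fun x => `|ratr (c.1 ij.1 ij.2) - (f x : 'M[R]_(m, n)) ij.1 ij.2|) (cst _)) => //.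
    apply: measurableT_comp => //.
    by apply: measurable_funB.
  apply/seteqP; split => x /= h; first by move=> [i j] _ /=; exact: h.
  by move=> i j; exact: (h (i, j) I).
have -> : f @^-1` U = \bigcup_c if `[< box c `<=` U >] then f @^-1` box c else set0.
  apply/seteqP; split => x /=; last first.
    by move=> [c _]; case: ifPn => // /asboolP cU /= xc; exact: cU.
  move=> Ux.
  have /nbhs_ballP[e /= e0 exU] : nbhs (f x : 'M[R]_(m, n)) U by exact: open_nbhs_nbhs.
  have [N Ne] : exists N, N.+1%:R^-1 < e / 2.
    have [N] := @ltr_add_invr R 0 (e / 2) (divr_gt0 e0 (ltr0n _ 2)).
    by rewrite add0r; exists N.
  have N0 : 0 < N.+1%:R^-1 :> R by rewrite invr_gt0.
  have H (ij : 'I_m * 'I_n) : exists q : rat,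
      `|ratr q - (f x : 'M[R]_(m, n)) ij.1 ij.2| < N.+1%:R^-1.
    have /rat_in_itvoo[q] : (f x : 'M[R]_(m, n)) ij.1 ij.2 <
      (f x : 'M[R]_(m, n)) ij.1 ij.2 + N.+1%:R^-1 by rewrite ltrDl.
    rewrite in_itv/= => /andP[q1 q2]; exists q.
    by rewrite ger0_norm ?subr_ge0 1?ltW// ltrBlDl.
  pose M : 'M[rat]_(m, n) := \matrix_(i, j) xchoose (H (i, j)).
  have fM : box (M, N) (f x).
    by move=> i j /=; rewrite mxE; exact: (xchooseP (H (i, j))).
  exists (M, N) => //; rewrite ifT//; apply/asboolP => A MA; apply: exU.
  split => // i j /=; rewrite /ball /=.
  have := fM i j; have := MA i j; move: Ne => /=; set a := (f x : 'M[R]_(m, n)) i j.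
  move=> Ne /= h1 h2; rewrite (_ : a - A i j = (ratr (M i j) - A i j) - (ratr (M i j) - a)); last by ring.
  apply: (le_lt_trans (ler_normB _ _)).
  by rewrite (splitr e); apply: ltrD; apply: lt_trans Ne.
apply: countable_bigcupT_measurable; first exact: countableP.
by move=> c; case: ifP.
Qed.

(** * Densities and affine changes of variable *)

Section density.
Local Open Scope ereal_scope.
Context d (T : measurableType d) (R : realType).
Variables (mu nu : {measure set T -> \bar R}) (h : T -> R).
Hypotheses (mh : measurable_fun setT h) (h0 : forall x, (0 <= h x)%R).
Hypothesis nuE : forall A, measurable A -> nu A = \int[mu]_(x in A) (h x)%:E.

Import HBNNSimple.

(** The hypothesis [nuE] is the case of indicators; simple functions and monotone convergence give
    the rest. *)
Lemma ge0_integral_density (f : T -> \bar R) :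
  measurable_fun setT f -> (forall x, 0 <= f x) ->
  \int[nu]_x f x = \int[mu]_x (f x * (h x)%:E).
Proof.
move=> mf f0; pose g := nnsfun_approx measurableT mf.
transitivity (limn (fun n => \int[nu]_x (EFin \o g n) x)).
  rewrite -monotone_convergence//.
  - by apply: eq_integral => x _; apply/esym/cvg_lim => //; exact: cvg_nnsfun_approx.
  - by move=> n; exact/measurable_EFinP/measurable_funP.
  - by move=> n x _ /=; rewrite lee_fin.
  - by move=> x _ a b ab; rewrite lee_fin; exact/lefP/nd_nnsfun_approx.
transitivity (limn (fun n => \int[mu]_x ((EFin \o g n) x * (h x)%:E))); last first.
  rewrite -monotone_convergence//.
  - apply: eq_integral => x _; apply/cvg_lim => //; apply: cvgeZr => //.
    exact: cvg_nnsfun_approx.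
  - move=> n; apply: emeasurable_funM; apply/measurable_EFinP => //.
  - by move=> n x _ /=; rewrite mule_ge0 ?lee_fin.
  - move=> x _ a b ab /=; rewrite lee_wpmul2r ?lee_fin//.
    exact/lefP/nd_nnsfun_approx.
congr (limn _); apply/funext => n.
transitivity (\int[nu]_x
   (\sum_(y \in range (g n)) (y * \1_(g n @^-1` [set y]) x)%:E)).
  by apply: eq_integral => t tE; rewrite /= fimfunE -fsumEFin.
have indich r : measurable_fun setT (fun x => (r * \1_(g n @^-1` [set r]) x)%:E).
  by apply/measurable_EFinP; exact: measurable_funM.
rewrite ge0_integral_fsum//; last by move=> y x _; exact: nnfun_muleindic_ge0.
transitivity (\int[mu]_x (\sum_(y \in range (g n))
    (y * \1_(g n @^-1` [set y]) x)%:E * (h x)%:E)); last first.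
  apply: eq_integral => x _.
  rewrite -ge0_mule_fsuml => [|y]; last exact: nnfun_muleindic_ge0.
  by rewrite fsumEFin // -(fimfunE _ x).
rewrite ge0_integral_fsum//; last 2 first.
  - by move=> y; apply: emeasurable_funM => //; exact/measurable_EFinP.
  - by move=> y x _; rewrite mule_ge0 ?lee_fin// -lee_fin EFinM nnfun_muleindic_ge0.
apply: eq_fsbigr => r /[!inE] -[x _ rx].
have r0 : (0 <= r)%R by rewrite -rx.
under eq_integral do rewrite EFinM.
under [RHS]eq_integral do rewrite EFinM -muleA.
rewrite ge0_integralZl//; last by apply/measurable_EFinP.
rewrite ge0_integralZl//; last 2 first.
  - by apply: emeasurable_funM; apply/measurable_EFinP.
  - by move=> y _; rewrite mule_ge0 ?lee_fin.
congr (_ * _); rewrite integral_indic// setIT nuE// integral_mkcond.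
apply: eq_integral => y _; rewrite patchE indicE.
by case: ifPn => _; rewrite ?mul1e ?mul0e.
Qed.

End density.

Section affine.
Context (R : realType).
Local Notation mu := (@lebesgue_measure R).

Lemma measurable_affine (a b : R) : measurable_fun setT (fun x : R => a * x + b).
Proof. by apply: measurable_funD => //; apply: measurable_funM. Qed.

Let measurable_affineR (a b : R) :
  @measurable_fun _ _ (measurableTypeR R) (measurableTypeR R) setT
    (fun x : R => a * x + b).
Proof. exact: measurable_affine. Qed.

(** Uniqueness of Lebesgue measure: [|a|] times the image measure gives half-open intervals their
    length. A negative [a] exchanges the open and the closed end, which leaves the length
    unchanged. *)
Lemma lebesgue_measure_affine (a b : R) (A : set R) : a != 0 -> measurable A ->
  (`|a|%:E * mu ((fun x => a * x + b)%R @^-1` A))%E = mu A.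
Proof.
move=> a0 mA.
pose phi (x : measurableTypeR R) : measurableTypeR R := (a * x + b)%R.
pose nu : {measure set (measurableTypeR R) -> \bar R} :=
  mscale (NngNum (normr_ge0 a)) (pushforward mu phi).
rewrite [RHS](@lebesgue_measure_unique R (nu (measurable_affineR a b)))// => _ [[x y] _ <-] /=.
rewrite /nu /= /mscale /= /pushforward.
have [a_gt0|a_lt0|a_eq0] := ltrgtP 0 a; last by rewrite a_eq0 eqxx in a0.
  rewrite (_ : _ @^-1` _ = `](x - b) / a, (y - b) / a]%classic); last first.
    apply/seteqP; split => z /=; rewrite !in_itv/= ltr_pdivrMr// ler_pdivlMr//.
      by rewrite ltrBlDr lerBrDr (mulrC z).
    by rewrite ltrBlDr lerBrDr (mulrC z).
  rewrite !lebesgue_measure_itv/= !lte_fin ltr_pM2r ?invr_gt0// ltrD2r.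
  case: ifP => _; last by rewrite mule0.
  rewrite -!EFinB -EFinM gtr0_norm//; congr EFin; field.
  by rewrite gt_eqF.
rewrite (_ : _ @^-1` _ = `[(y - b) / a, (x - b) / a[%classic); last first.
  apply/seteqP; split => z /=; rewrite !in_itv/= ltr_ndivlMr// ler_ndivrMr//.
    by rewrite ltrBlDr lerBrDr (mulrC z) andbC.
  by rewrite ltrBlDr lerBrDr (mulrC z) andbC.
rewrite !lebesgue_measure_itv/= !lte_fin ltr_nM2r ?invr_lt0// ltrD2r.
case: ifP => _; last by rewrite mule0.
rewrite -!EFinB -EFinM ltr0_norm//; congr EFin; field.
by rewrite lt_eqF.
Qed.

Lemma ge0_integral_affine (a b : R) (f : R -> \bar R) : a != 0 ->
  measurable_fun setT f -> (forall x, 0 <= f x)%E ->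
  (\int[mu]_x f x = `|a|%:E * \int[mu]_x f (a * x + b)%R)%E.
Proof.
move=> a0 mf f0.
pose phi (x : measurableTypeR R) : measurableTypeR R := (a * x + b)%R.
pose nu : {measure set (measurableTypeR R) -> \bar R} :=
  mscale (NngNum (normr_ge0 a)) (pushforward mu phi).
transitivity (\int[nu (measurable_affineR a b)]_x f x)%E.
  apply: eq_measure_integral => A mA _.
  by rewrite /nu/= /mscale/= /pushforward -(lebesgue_measure_affine b a0).
rewrite ge0_integral_mscale//=; congr (_ * _)%E.
by rewrite ge0_integral_pushforward//=; exact: measurable_affine.
Qed.

End affine.

(** * The one-dimensional Gaussian law *)

(** With [z = a x + b y], the substitution [y = (a / c) t + b z / c^2] standardizes [y] given [z];
    the exponent [x^2 + y^2] of the joint density then splits into one term in [z] and one in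
    [t]. *)
Lemma complete_square (R : realType) (a b c z t : R) : a != 0 -> c != 0 ->
  c ^+ 2 = a ^+ 2 + b ^+ 2 ->
  ((z - b * (a / c * t + b * z / c ^+ 2)) / a) ^+ 2
    + (a / c * t + b * z / c ^+ 2) ^+ 2 = (z / c) ^+ 2 + t ^+ 2.
Proof.
move=> a0 c0 c2.
have -> : z - b * (a / c * t + b * z / c ^+ 2) = a * (a * z / c ^+ 2 - b * t / c).
  apply: (@mulfI _ (c ^+ 2)); first by rewrite expf_neq0.
  transitivity ((c ^+ 2 - b ^+ 2) * z - a * b * c * t); first by field.
  by rewrite {1}c2 addrK; field.
rewrite mulrC mulKf//.
transitivity ((a ^+ 2 + b ^+ 2) / c ^+ 2 * ((z / c) ^+ 2 + t ^+ 2)); first by field.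
by rewrite -c2 divff ?mul1r// expf_neq0.
Qed.

Section gauss1.
Local Open Scope ereal_scope.
Context (R : realType).
Local Notation mu := (@lebesgue_measure R).
Local Notation N := (@normal_prob R 0%R 1%R).
Local Notation phi := (@normal_pdf R 0%R 1%R).

Let mphi : measurable_fun setT phi.
Proof. exact: measurable_normal_pdf. Qed.

Let phi_ge0 x : (0 <= phi x)%R.
Proof. exact: normal_pdf_ge0. Qed.

Let phiE x : phi x = (normal_peak 1 * expR (- (x ^+ 2 / 2)))%R.
Proof.
by rewrite normal_pdfE ?oner_eq0// /normal_fun subr0 expr1n mulNr.
Qed.

Lemma ge0_integral_normal (f : R -> \bar R) :
  measurable_fun setT f -> (forall x, 0 <= f x) ->
  \int[N]_x f x = \int[mu]_x (f x * (phi x)%:E).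
Proof.
move=> mf f0.
exact: (@ge0_integral_density _ (measurableTypeR R) R mu N phi mphi phi_ge0).
Qed.

Lemma normal_shift (u : R) (f : R -> \bar R) :
  measurable_fun setT f -> (forall x, 0 <= f x) ->
  \int[N]_x f (x + u)%R = \int[N]_x (f x * (expR (u * x - u ^+ 2 / 2))%:E).
Proof.
move=> mf f0; rewrite !ge0_integral_normal//; last 3 first.
- by apply: emeasurable_funM => //; apply/measurable_EFinP; apply: measurableT_comp => //;
    exact: measurable_affine.
- by move=> x; rewrite mule_ge0 ?lee_fin ?expR_ge0.
- by apply: measurableT_comp => //; apply: measurable_funD.
rewrite [RHS](@ge0_integral_affine R 1%R u) ?oner_eq0//; last 2 first.
- apply: emeasurable_funM => //; last exact/measurable_EFinP.
  by apply: emeasurable_funM => //; apply/measurable_EFinP; apply: measurableT_comp => //;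
    exact: measurable_affine.
- by move=> x; rewrite !mule_ge0 ?lee_fin ?expR_ge0.
rewrite normr1 mul1e; apply: eq_integral => x _.
rewrite mul1r -muleA -EFinM; congr (_ * _%:E).
rewrite !phiE mulrCA -expRD; congr (_ * expR _)%R; by field.
Qed.

Lemma normal_opp (f : R -> \bar R) :
  measurable_fun setT f -> (forall x, 0 <= f x) ->
  \int[N]_x f (- x)%R = \int[N]_x f x.
Proof.
move=> mf f0; rewrite !ge0_integral_normal//; last exact: measurableT_comp.
rewrite [RHS](@ge0_integral_affine R (-1)%R 0%R) ?oppr_eq0 ?oner_eq0//; last 2 first.
- by apply: emeasurable_funM => //; exact/measurable_EFinP.
- by move=> x; rewrite !mule_ge0 ?lee_fin ?expR_ge0.
rewrite normrN1 mul1e; apply: eq_integral => x _.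
by rewrite addr0 mulN1r !phiE sqrrN.
Qed.

(** The variable [x] is traded for [z = a x + b y], the two integrals are exchanged, and [y] is
    integrated out by [complete_square]; what remains is the density of [c x]. *)
Lemma normal_stable (a b : R) (f : R -> \bar R) :
  measurable_fun setT f -> (forall x, 0 <= f x) ->
  \int[N]_x \int[N]_y f (a * x + b * y)%R =
  \int[N]_x f (Num.sqrt (a ^+ 2 + b ^+ 2) * x)%R.
Proof.
move=> mf f0.
(* For [a = 0] the variable [x] cannot be traded for [z]. The scale is then [|b|], and a negative
   [b] is handled by the symmetry of the law. *)
have [->|a0] := eqVneq a 0%R.
  under eq_integral => x _ do under eq_integral => y _ do rewrite mul0r add0r.
  rewrite integral_cst// [X in _ * X](@probability_setT _ _ _ N) mule1.
  rewrite expr0n add0r sqrtr_sqr.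
  have [b0|b0] := ger0P b; first by [].
  rewrite -[LHS](@normal_opp (fun x => f (b * x)%R))//; last first.
    by apply: measurableT_comp => //; apply: measurable_funM.
  by apply: eq_integral => x _; rewrite mulrN mulNr.
set c := Num.sqrt _.
have c0 : (0 < c)%R.
  by rewrite sqrtr_gt0 ltr_pwDl ?sqr_ge0// exprn_even_gt0.
have c2 : (c ^+ 2 = a ^+ 2 + b ^+ 2)%R.
  by rewrite sqr_sqrtr// addr_ge0 ?sqr_ge0.
have mlin (x y : R) : measurable_fun setT (fun p : R * R => (x * p.1 + y * p.2)%R).
  by apply: measurable_funD; apply: measurable_funM.
have mf2 : measurable_fun setT (fun p : R * R => f (a * p.1 + b * p.2)%R).
  by apply: measurableT_comp.
rewrite (@fubini_tonelli _ _ _ _ _ N N (fun p : R * R => f (a * p.1 + b * p.2)%R))//=.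
(* [|a|] times the joint density of [y] and [z = a x + b y]. *)
pose H (y z : R) := (phi ((z - b * y) / a) * phi y)%R.
have mH : measurable_fun setT (fun p : R * R => H p.1 p.2).
  apply: measurable_funM; last by apply: measurableT_comp.
  apply: measurableT_comp => //; apply: measurable_funM => //.
  by apply: measurable_funB => //; apply: measurable_funM.
have H0 y z : (0 <= H y z)%R by rewrite mulr_ge0.
have mfz : measurable_fun setT (fun p : R * R => f p.2 * (H p.1 p.2)%:E).
  apply: emeasurable_funM; first exact: measurableT_comp.
  exact/measurable_EFinP.
have fH0 y z : 0 <= f z * (H y z)%:E by rewrite mule_ge0 ?lee_fin.
transitivity (\int[mu]_y ((`|a|^-1)%:E * \int[mu]_z (f z * (H y z)%:E))).
  rewrite ge0_integral_normal; last 2 first.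
  - exact: (@measurable_fun_fubini_tonelli_G _ _ _ _ _ N
     (fun p : R * R => f (a * p.1 + b * p.2)%R)).
  - by move=> y; exact: integral_ge0.
  apply: eq_integral => y _.
  rewrite ge0_integral_normal//; last first.
    by apply: measurableT_comp => //; exact: measurable_affine.
  have a'0 : `|a|%R != 0%R by rewrite normr_eq0.
  rewrite [X in _ = _ * X](@ge0_integral_affine R a (b * y)%R)//; last first.
    exact: (measurableT_comp mfz (measurable_pair1 _)).
  rewrite muleA -EFinM mulVf// mul1e -ge0_integralZr//; last 3 first.
  - apply: emeasurable_funM; last exact/measurable_EFinP.
    by apply: measurableT_comp => //; exact: measurable_affine.
  - by move=> x _; rewrite mule_ge0 ?lee_fin.
  - by rewrite lee_fin.
  apply: eq_integral => x _; rewrite -muleA -EFinM /H; congr (_ * (phi _ * _)%:E).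
  by rewrite addrK mulrC mulKf.
rewrite ge0_integralZl//; last 2 first.
- exact: (@measurable_fun_fubini_tonelli_F _ _ (measurableTypeR R) (measurableTypeR R) _ mu
    (fun p : R * R => f p.2 * (H p.1 p.2)%:E) mfz (fun p => fH0 p.1 p.2)).
- by move=> y _; exact: integral_ge0.
rewrite (@fubini_tonelli _ _ _ _ _ mu mu (fun p : R * R => f p.2 * (H p.1 p.2)%:E))//=.
transitivity (`|a|^-1%:E * \int[mu]_z ((`|a| / c)%:E * (f z * (phi (z / c))%:E))).
  congr (_ * _); apply: eq_integral => z _.
  rewrite ge0_integralZl//; last 2 first.
  - by apply/measurable_EFinP; exact: (measurableT_comp mH (measurable_pair2 _)).
  - by move=> y _; rewrite lee_fin.
  rewrite muleCA; congr (_ * _).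
  rewrite (@ge0_integral_affine R (a / c)%R (b * z / c ^+ 2)%R); last 3 first.
  - by rewrite mulf_neq0// invr_neq0// gt_eqF.
  - by apply/measurable_EFinP; exact: (measurableT_comp mH (measurable_pair2 _)).
  - by move=> y; rewrite lee_fin.
  rewrite normrM normfV (gtr0_norm c0); congr (_ * _).
  transitivity (\int[mu]_x ((phi (z / c))%:E * (phi x)%:E)).
    apply: eq_integral => t _; rewrite -EFinM /H !phiE; congr EFin.
    rewrite mulrACA [RHS]mulrACA -!expRD; congr (_ * expR _)%R.
    rewrite -opprD -[RHS]opprD -!mulrDl; congr (- (_ / 2))%R.
    by rewrite complete_square// gt_eqF.
  rewrite ge0_integralZl//; last 3 first.
  - exact: (measurableT_comp (@EFin_measurable _ _) mphi).
  - by move=> x _; rewrite lee_fin.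
  - by rewrite lee_fin.
  rewrite [X in _ * X = _](_ : _ = 1) ?mule1//.
  exact: (@integral_normal_pdf R 0%R 1%R).
have m1 : measurable_fun setT (fun z => f z * (phi (z / c))%:E).
  apply: emeasurable_funM => //; apply/measurable_EFinP.
  by apply: measurableT_comp => //; apply: measurable_funM.
have m10 z : 0 <= f z * (phi (z / c))%:E by rewrite mule_ge0 ?lee_fin.
rewrite ge0_integralZl//; last by rewrite lee_fin divr_ge0// ltW.
rewrite muleA -EFinM mulrA mulVf ?normr_eq0// mul1r.
rewrite (@ge0_integral_affine R c 0%R) ?gt_eqF// gtr0_norm// muleA -EFinM.
rewrite (mulVf (lt0r_neq0 c0)) mul1e (@ge0_integral_normal (fun x => f (c * x)%R)); last 2 first.
- by apply: measurableT_comp => //; apply: measurable_funM.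
- by move=> x; exact: f0.
by apply: eq_integral => x _; rewrite addr0 (mulrC c) mulfK ?gt_eqF.
Qed.

End gauss1.

(** * Image laws and Gaussian vectors *)

(** [distribution] expects a bundled measurable function; packing it from [mX] allows plain
    functions to be pushed forward. *)
Definition law d d' (T : measurableType d) (T' : measurableType d') (R : realType)
    (P : probability T R) (X : T -> T') (mX : measurable_fun setT X) :
    probability T' R :=
  distribution P (HB.pack_for {mfun T >-> T'} X (isMeasurableFun.Build _ _ _ _ X mX)).

Lemma ge0_integral_law d d' (T : measurableType d) (T' : measurableType d')
    (R : realType) (P : probability T R) (X : T -> T')
    (mX : measurable_fun setT X) (f : T' -> \bar R) :
  measurable_fun setT f -> (forall x, 0 <= f x)%E ->
  (\int[law P mX]_x f x = \int[P]_x f (X x))%E.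
Proof. by move=> mf f0; rewrite ge0_integral_distribution. Qed.

Section measurable_matrix.
Context (R : realType).

Lemma measurable_scalar_mx1 :
  measurable_fun setT (fun x : R => x%:M : borel_mx R 1 1).
Proof.
apply: measurable_mx => i j.
rewrite (ord1 i) (ord1 j); under eq_fun do rewrite mxE eqxx mulr1n.
exact: measurable_id.
Qed.

Context d (T : measurableType d).

Lemma measurable_col_mx m1 m2 n (f : T -> borel_mx R m1 n) (g : T -> borel_mx R m2 n) :
  measurable_fun setT f -> measurable_fun setT g ->
  measurable_fun setT (fun x => col_mx (f x) (g x) : borel_mx R (m1 + m2) n).
Proof.
move=> mf mg; apply: measurable_mx => i j; under eq_fun do rewrite mxE.
case: (fintype.split i) => k.
  exact: (measurableT_comp (measurable_mx_entry k j) mf).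
exact: (measurableT_comp (measurable_mx_entry k j) mg).
Qed.

Lemma measurable_row_mx m n1 n2 (f : T -> borel_mx R m n1) (g : T -> borel_mx R m n2) :
  measurable_fun setT f -> measurable_fun setT g ->
  measurable_fun setT (fun x => row_mx (f x) (g x) : borel_mx R m (n1 + n2)).
Proof.
move=> mf mg; apply: measurable_mx => i j; under eq_fun do rewrite mxE.
case: (fintype.split j) => k.
  exact: (measurableT_comp (measurable_mx_entry i k) mf).
exact: (measurableT_comp (measurable_mx_entry i k) mg).
Qed.

Lemma measurable_mulmx m n l (f : T -> borel_mx R m n) (g : T -> borel_mx R n l) :
  measurable_fun setT f -> measurable_fun setT g ->
  measurable_fun setT (fun x => (f x : 'M[R]_(m, n)) *m (g x : 'M[R]_(n, l)) : borel_mx R m l).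
Proof.
move=> mf mg; apply: measurable_mx => i j; under eq_fun do rewrite mxE.
apply: measurable_sum => k; apply: measurable_funM.
  exact: (measurableT_comp (measurable_mx_entry i k) mf).
exact: (measurableT_comp (measurable_mx_entry k j) mg).
Qed.

Lemma measurable_addmx m n (f g : T -> borel_mx R m n) :
  measurable_fun setT f -> measurable_fun setT g ->
  measurable_fun setT (fun x => (f x : 'M[R]_(m, n)) + (g x : 'M[R]_(m, n)) : borel_mx R m n).
Proof.
move=> mf mg; apply: measurable_mx => i j; under eq_fun do rewrite mxE.
apply: measurable_funD.
  exact: (measurableT_comp (measurable_mx_entry i j) mf).
exact: (measurableT_comp (measurable_mx_entry i j) mg).
Qed.

Lemma measurable_scalemx m n (a : R) (f : T -> borel_mx R m n) :
  measurable_fun setT f ->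
  measurable_fun setT (fun x => a *: (f x : 'M[R]_(m, n)) : borel_mx R m n).
Proof.
move=> mf; apply: measurable_mx => i j; under eq_fun do rewrite mxE.
apply: measurable_funM => //.
exact: (measurableT_comp (measurable_mx_entry i j) mf).
Qed.

End measurable_matrix.

Section gauss.
Context (R : realType).
Local Notation N := (@normal_prob R 0 1).

Lemma measurable_col_cons n :
  measurable_fun setT (fun p : R * borel_mx R n 1 =>
    col_mx (p.1%:M : 'M[R]_1) p.2 : borel_mx R n.+1 1).
Proof.
have h : measurable_fun setT (fun p : R * borel_mx R n 1 => p.1%:M : borel_mx R 1 1).
  exact: (measurableT_comp (@measurable_scalar_mx1 R) measurable_fst).
exact: (measurable_col_mx h measurable_snd).
Qed.

(** The standard Gaussian law of [R^n]. The recursion on coordinates makes every integral unfold by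
    Tonelli, so that properties of vectors follow from those of [normal_prob] by induction. *)
Fixpoint gauss (n : nat) : probability (borel_mx R n 1) R :=
  if n is n'.+1 then law (N \x gauss n')%E (@measurable_col_cons n')
  else \d_(0 : borel_mx R 0 1).

Lemma integral_gaussS n (f : 'cV[R]_n.+1 -> \bar R) :
  measurable_fun (setT : set (borel_mx R n.+1 1)) f -> (forall x, 0 <= f x)%E ->
  (\int[gauss n.+1]_x f x =
   \int[N]_x \int[gauss n]_v f (col_mx (x%:M : 'M[R]_1) v))%E.
Proof.
move=> mf f0; rewrite ge0_integral_law//.
rewrite (@fubini_tonelli1 _ _ _ _ _ N (gauss n)
  (fun p : R * borel_mx R n 1 => f (col_mx (p.1%:M : 'M[R]_1) p.2)))//.
exact: (measurableT_comp mf (@measurable_col_cons n)).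
Qed.

End gauss.

Section curried_tonelli.
Local Open Scope ereal_scope.
Context d1 d2 (T1 : measurableType d1) (T2 : measurableType d2) (R : realType).
Variables (m1 : {sigma_finite_measure set T1 -> \bar R})
          (m2 : {sigma_finite_measure set T2 -> \bar R}).
Variable g : T1 -> T2 -> \bar R.
Hypotheses (mg : measurable_fun setT (fun p : T1 * T2 => g p.1 p.2))
           (g0 : forall x y, 0 <= g x y).

Lemma measurable_integral_curry :
  measurable_fun setT (fun x => \int[m2]_y g x y).
Proof.
exact: (@measurable_fun_fubini_tonelli_F _ _ _ _ _ m2
  (fun p : T1 * T2 => g p.1 p.2) mg (fun p => g0 p.1 p.2)).
Qed.

Lemma tonelli_curry :
  \int[m1]_x \int[m2]_y g x y = \int[m2]_y \int[m1]_x g x y.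
Proof.
exact: (@fubini_tonelli _ _ _ _ _ m1 m2
  (fun p : T1 * T2 => g p.1 p.2) mg (fun p => g0 p.1 p.2)).
Qed.

End curried_tonelli.

Lemma integral_prob_cst d (T : measurableType d) (R : realType)
  (P : probability T R) (r : \bar R) : (\int[P]_x r = r)%E.
Proof. by rewrite integral_cst// [X in (_ * X)%E](@probability_setT _ _ _ P) mule1. Qed.

Section gauss_theory.
Context (R : realType).
Local Notation N := (@normal_prob R 0 1).
Local Notation cons x v := (col_mx (x%:M : 'M[R]_1) v).
Local Notation V n := (borel_mx R n 1).

Lemma col_consE n (u : 'cV[R]_n.+1) :
  exists u0 (u' : 'cV[R]_n), u = cons u0 u'.
Proof.
exists (usubmx (u : 'cV[R]_(1 + n)) ord0 ord0), (dsubmx (u : 'cV[R]_(1 + n))).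
by rewrite -mx11_scalar vsubmxK.
Qed.

Lemma sum_col_cons (S : nmodType) n (x : R) (v : 'cV[R]_n) (F : 'I_n.+1 -> R -> S) :
  \sum_i F i (cons x v i ord0) =
  F ord0 x + \sum_i F (lift ord0 i) (v i ord0).
Proof.
rewrite big_ord_recl; congr (F _ _ + _).
  rewrite (_ : ord0 = lshift n (ord0 : 'I_1)); last exact/val_inj.
  by rewrite col_mxEu mxE eqxx.
apply: eq_bigr => i _; congr (F _ _).
rewrite (_ : lift ord0 i = rshift 1 i); last exact/val_inj.
by rewrite col_mxEd.
Qed.

Lemma col_cons0 n (x : R) (v : 'cV[R]_n) : cons x v ord0 ord0 = x.
Proof.
rewrite (_ : ord0 = lshift n (ord0 : 'I_1)); last exact/val_inj.
by rewrite col_mxEu mxE eqxx.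
Qed.

Lemma col_consS n (x : R) (v : 'cV[R]_n) i : cons x v (lift ord0 i) ord0 = v i ord0.
Proof.
rewrite (_ : lift ord0 i = rshift 1 i); last exact/val_inj.
by rewrite col_mxEd.
Qed.

Lemma scale_cons n (a x : R) (v : 'cV[R]_n) :
  a *: (cons x v : 'cV[R]_n.+1) = cons (a * x) (a *: v).
Proof. by rewrite -scale_scalar_mx; exact: (@scale_col_mx R 1 n 1 a x%:M v). Qed.

Lemma add_cons n (x y : R) (u v : 'cV[R]_n) :
  (cons x u : 'cV[R]_n.+1) + cons y v = cons (x + y) (u + v).
Proof.
have -> : (x + y)%:M = x%:M + y%:M :> 'M[R]_1 by rewrite raddfD.
exact: (@add_col_mx R 1 n 1 x%:M u y%:M v). Qed.

Lemma measurable_cons d (T : measurableType d) n (f : T -> R) (g : T -> V n) :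
  measurable_fun setT f -> measurable_fun setT g ->
  measurable_fun setT (fun x => cons (f x) (g x) : V n.+1).
Proof.
move=> mf mg; apply: (@measurable_col_mx R _ _ 1 n 1 (fun x => (f x)%:M) g) => //.
exact: (measurableT_comp (@measurable_scalar_mx1 R) mf).
Qed.

(** Coordinate by coordinate: Tonelli brings the two tails together for the induction hypothesis,
    then the two first coordinates together for [normal_stable]. *)
Lemma gauss_stable n (a b : R) (f : 'cV[R]_n -> \bar R) :
  measurable_fun (setT : set (V n)) f -> (forall x, 0 <= f x)%E ->
  (\int[gauss R n]_x \int[gauss R n]_y f (a *: x + b *: y)%R =
   \int[gauss R n]_x f (Num.sqrt (a ^+ 2 + b ^+ 2) *: x)%R)%E.
Proof.
elim: n f => [|n IH] f mf f0.
  have f00 (x : 'cV[R]_0) : f x = f 0 by rewrite (flatmx0 x).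
  under eq_integral => x _ do under eq_integral => y _ do rewrite f00.
  under [RHS]eq_integral => x _ do rewrite f00.
  by rewrite !integral_prob_cst.
set c := Num.sqrt _.
have mfl d (T : measurableType d) (g h : T -> R) (u v : T -> V n) :
    measurable_fun setT g -> measurable_fun setT h ->
    measurable_fun setT u -> measurable_fun setT v ->
  measurable_fun setT (fun x => f (cons (a * g x + b * h x) (a *: (u x : 'M[R]_(n, 1)) + b *: (v x : 'M[R]_(n, 1))))).
  move=> mg mh mu mv; apply: (measurableT_comp mf); apply: measurable_cons.
    by apply: measurable_funD; apply: measurable_funM.
  by apply: measurable_addmx; apply: measurable_scalemx.
pose F x y u v := f (cons (a * x + b * y)%R (a *: u + b *: v)%R).
have F0 x y u v : (0 <= F x y u v)%E by exact: f0.
transitivity (\int[N]_x \int[gauss R n]_u \int[N]_y \int[gauss R n]_v F x y u v)%E.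
  rewrite integral_gaussS; last 2 first.
  - apply: measurable_integral_curry => //.
    apply: (measurableT_comp mf); apply: measurable_addmx; apply: measurable_scalemx => //.
  - by move=> x; exact: integral_ge0.
  apply: eq_integral => x _; apply: eq_integral => u _.
  rewrite integral_gaussS//; last first.
    apply: (measurableT_comp mf); apply: measurable_addmx => //.
    by apply: measurable_scalemx.
  apply: eq_integral => y _; apply: eq_integral => v _.
  rewrite /F; congr f.
  by rewrite !scale_cons add_cons.
transitivity (\int[N]_x \int[N]_y \int[gauss R n]_u \int[gauss R n]_v F x y u v)%E.
  apply: eq_integral => x _; rewrite tonelli_curry//; last first.
    by move=> *; exact: integral_ge0.
  apply: (@measurable_integral_curry _ _ (V n * R)%type (V n) R (gauss R n)
    (fun p v => F x p.2 p.1 v)) => //.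
  by apply: mfl => //; do 2 apply: measurableT_comp => //.
transitivity (\int[N]_x \int[N]_y \int[gauss R n]_u
   f (cons (a * x + b * y)%R (c *: u)%R))%E.
  apply: eq_integral => x _; apply: eq_integral => y _.
  apply: (IH (fun v => f (cons (a * x + b * y) v))) => //.
  by apply: (measurableT_comp mf); apply: measurable_cons.
transitivity (\int[gauss R n]_u \int[N]_x \int[N]_y
   f (cons (a * x + b * y)%R (c *: u)%R))%E.
  have mh d (T : measurableType d) (g h : T -> R) (u : T -> V n) :
      measurable_fun setT g -> measurable_fun setT h -> measurable_fun setT u ->
    measurable_fun setT (fun p => f (cons (a * g p + b * h p)%R (c *: (u p : 'M[R]_(n, 1)))%R)).
    move=> mg mh mu; apply: (measurableT_comp mf); apply: measurable_cons.
      by apply: measurable_funD; apply: measurable_funM.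
    exact: measurable_scalemx.
  transitivity (\int[N]_x \int[gauss R n]_u \int[N]_y
     f (cons (a * x + b * y)%R (c *: u)%R))%E.
    apply: eq_integral => x _; rewrite tonelli_curry//.
    exact: mh.
  rewrite tonelli_curry//; last by move=> *; exact: integral_ge0.
  apply: (@measurable_integral_curry _ _ (measurableTypeR R * V n)%type (measurableTypeR R) R N
    (fun p y => f (cons (a * p.1 + b * y)%R (c *: (p.2 : 'M[R]_(n, 1)))%R))) => //.
  by apply: mh => //; apply: measurableT_comp.
transitivity (\int[gauss R n]_u \int[N]_x
   f (cons (c * x)%R (c *: u)%R))%E.
  apply: eq_integral => u _.
  apply: (@normal_stable R a b (fun x => f (cons x (c *: u)%R))) => //.
  by apply: (measurableT_comp mf); apply: measurable_cons.
rewrite tonelli_curry//; last first.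
  apply: (measurableT_comp mf); apply: measurable_cons; first exact: measurable_funM.
  exact: measurable_scalemx.
rewrite integral_gaussS//; last first.
  by apply: (measurableT_comp mf); apply: measurable_scalemx.
apply: eq_integral => x _; apply: eq_integral => u _; congr f.
by rewrite scale_cons.
Qed.

End gauss_theory.

(** * Translations of Gaussian vectors *)

Section gauss_shift.
Context (R : realType).
Local Notation N := (@normal_prob R 0 1).
Local Notation cons x v := (col_mx (x%:M : 'M[R]_1) v).
Local Notation V n := (borel_mx R n 1).

Definition dot n (u v : 'cV[R]_n) : R := \sum_i u i ord0 * v i ord0.

Lemma dot_cons n (x y : R) (u v : 'cV[R]_n) :
  dot (cons x u : 'cV[R]_n.+1) (cons y v) = x * y + dot u v.
Proof.
rewrite /dot (sum_col_cons x u (fun i z => z * cons y v i ord0)) col_cons0.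
by congr (_ + _); apply: eq_bigr => i _; rewrite col_consS.
Qed.

Lemma dotZl n a (u v : 'cV[R]_n) : dot (a *: u) v = a * dot u v.
Proof. by rewrite /dot mulr_sumr; apply: eq_bigr => i _; rewrite mxE mulrA. Qed.

Lemma dotC n (u v : 'cV[R]_n) : dot u v = dot v u.
Proof. by apply: eq_bigr => i _; rewrite mulrC. Qed.

Lemma dot_ge0 n (u : 'cV[R]_n) : 0 <= dot u u.
Proof. by apply: sumr_ge0 => i _; rewrite -expr2 sqr_ge0. Qed.

Lemma dot_mx0 (u v : 'cV[R]_0) : dot u v = 0.
Proof. by rewrite /dot big_ord0. Qed.

Lemma measurable_dot d (T : measurableType d) n (u : 'cV[R]_n) (g : T -> V n) :
  measurable_fun setT g -> measurable_fun setT (fun x => dot u (g x)).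
Proof.
move=> mg; apply: measurable_sum => i; apply: measurable_funM => //.
exact: (measurableT_comp (measurable_mx_entry i ord0) mg).
Qed.

(** Cameron-Martin formula. The exponent of the density is additive over coordinates, hence the
    induction from [normal_shift]. *)
Lemma gauss_shift n (u : 'cV[R]_n) (f : 'cV[R]_n -> \bar R) :
  measurable_fun (setT : set (V n)) f -> (forall x, 0 <= f x)%E ->
  (\int[gauss R n]_x f (x + u)%R =
   \int[gauss R n]_x (f x * (expR (dot u x - dot u u / 2))%:E))%E.
Proof.
elim: n u f => [|n IH] u f mf f0.
  apply: eq_integral => x _.
  by rewrite (flatmx0 u) addr0 !dot_mx0 mul0r subr0 expR0 mule1.
have [u0 [u' ->]] := col_consE u.
have mE m (w : 'cV[R]_m) d (T : measurableType d) (g : T -> V m) : measurable_fun setT g ->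
    measurable_fun setT (fun x => (expR (dot w (g x) - dot w w / 2))%:E).
  move=> mg; apply/measurable_EFinP; apply: measurableT_comp => //.
  by apply: measurable_funB => //; exact: measurable_dot.
have mfc d (T : measurableType d) (g : T -> R) (h : T -> V n) :
    measurable_fun setT g -> measurable_fun setT h ->
    measurable_fun setT (fun x => f (cons (g x) (h x))).
  by move=> mg mh; apply: (measurableT_comp mf); apply: measurable_cons.
rewrite integral_gaussS//; last first.
  by apply: (measurableT_comp mf); apply: measurable_addmx.
rewrite integral_gaussS; last 2 first.
- by apply: emeasurable_funM => //; exact: mE.
- by move=> x; rewrite mule_ge0 ?lee_fin ?expR_ge0.
pose G y := (\int[gauss R n]_v (f (cons y v) * (expR (dot u' v - dot u' u' / 2))%:E))%E.
have G0 y : (0 <= G y)%E.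
  by apply: integral_ge0 => v _; rewrite mule_ge0 ?lee_fin ?expR_ge0.
transitivity (\int[N]_x G (x + u0)%R)%E.
  apply: eq_integral => x _; rewrite /G -(IH u' (fun v => f (cons (x + u0) v)))//; last exact: mfc.
  by apply: eq_integral => v _; rewrite add_cons.
have mG : measurable_fun setT G.
  apply: measurable_integral_curry; last first.
    by move=> y v; rewrite mule_ge0 ?lee_fin ?expR_ge0.
  by apply: emeasurable_funM; [exact: mfc|exact: mE].
rewrite normal_shift//; apply: eq_integral => x _.
rewrite -ge0_integralZr//; last 2 first.
- by apply: emeasurable_funM; [exact: mfc|exact: mE].
- by move=> v _; rewrite mule_ge0 ?lee_fin ?expR_ge0.
apply: eq_integral => v _; rewrite -muleA -EFinM -expRD !dot_cons.
by congr (_ * (expR _)%:E)%E; field.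
Qed.

(** The Cameron-Martin density has integral 1; its constant factor is moved to the other side. *)
Lemma integral_expR_dot n (u : 'cV[R]_n) :
  (\int[gauss R n]_x (expR (dot u x))%:E = (expR (dot u u / 2))%:E)%E.
Proof.
have := @gauss_shift n u (cst 1%E) (measurable_cst _) (fun=> @lee01 R).
rewrite integral_prob_cst => /esym h.
transitivity (\int[gauss R n]_x ((expR (dot u u / 2))%:E * (1 * (expR (dot u x - dot u u / 2))%:E)))%E.
  apply: eq_integral => x _; rewrite mul1e -EFinM -expRD; congr (expR _)%:E; ring.
rewrite ge0_integralZl//.
- by rewrite h mule1.
- rewrite /=; under eq_fun do rewrite mul1e.
  apply/measurable_EFinP; apply: measurableT_comp => //.
  by apply: measurable_funB => //; exact: measurable_dot.
Qed.

(* Cauchy--Schwarz for the density [L] of the shifted law, in the linearized form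
   [1_B (L - 1) <= 1_B la / 2 + (L - 1) ^ 2 / (2 la)]. *)
Lemma gauss_shift_le n (w : 'cV[R]_n) (B : set 'cV[R]_n) (la : R) : 0 < la ->
  measurable (B : set (V n)) ->
  (gauss R n [set x | B (x + w)%R] <=
   (1 + la / 2)%:E * gauss R n B + ((expR (dot w w) - 1) / (2 * la))%:E)%E.
Proof.
move=> la0 mB.
pose L (x : 'cV[R]_n) := expR (dot w x - dot w w / 2).
have mL : measurable_fun (setT : set (V n)) L.
  by apply: measurableT_comp => //; apply: measurable_funB => //; exact: measurable_dot.
have L0 x : 0 <= L x by exact: expR_ge0.
have mBw : measurable ([set x | B (x + w)%R] : set (V n)).
  rewrite -[X in measurable X]setTI.
  by apply: (measurable_addmx (f := id) (g := cst w)).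
have mI : measurable_fun (setT : set (V n)) (\1_B : V n -> R) by exact: measurable_indic.
have mq : measurable_fun (setT : set (V n)) (fun x => ((L x - 1) ^+ 2)%:E).
  by apply/measurable_EFinP; apply: measurable_funX; apply: measurable_funB.
have EL : (\int[gauss R n]_x (L x)%:E = 1)%E.
  rewrite -[RHS](@integral_prob_cst _ _ _ (gauss R n) 1%E).
  rewrite (@gauss_shift n w (cst 1%E))//.
  by apply: eq_integral => x _; rewrite mul1e.
have EL2 : (\int[gauss R n]_x (L x ^+ 2)%:E = (expR (dot w w))%:E)%E.
  transitivity (\int[gauss R n]_x ((expR (- dot w w))%:E * (expR (dot (2 *: w) x))%:E))%E.
    apply: eq_integral => x _; rewrite -EFinM expr2 -!expRD dotZl.
    by congr (expR _)%:E; field.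
  rewrite ge0_integralZl//.
  - rewrite integral_expR_dot -EFinM -expRD; congr (expR _)%:E.
    by rewrite dotZl dotC dotZl; field.
  - by apply/measurable_EFinP; apply: measurableT_comp => //; exact: measurable_dot.
(* Chi-square divergence of the translated law. To stay with nonnegative integrands it is read off
   [(L - 1)^2 + 2 L = L^2 + 1]; the infinite values are excluded by this very equation. *)
have EQ : (\int[gauss R n]_x ((L x - 1) ^+ 2)%:E = (expR (dot w w) - 1)%:E)%E.
  have : (\int[gauss R n]_x (((L x - 1) ^+ 2)%:E + 2%:E * (L x)%:E) =
         \int[gauss R n]_x ((L x ^+ 2)%:E + 1))%E.
    by apply: eq_integral => x _; rewrite -EFinM -!EFinD; congr EFin; ring.
  rewrite ge0_integralD//; last 3 first.
  - by move=> x _; rewrite lee_fin sqr_ge0.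
  - by move=> x _; rewrite mule_ge0 ?lee_fin.
  - by apply/measurable_EFinP; apply: measurable_funM.
  rewrite ge0_integralZl//; last 2 first.
  - exact/measurable_EFinP.
  - by move=> x _; rewrite lee_fin.
  rewrite ge0_integralD//; last 2 first.
  - by move=> x _; rewrite lee_fin sqr_ge0.
  - by apply/measurable_EFinP; apply: measurable_funX.
  rewrite EL EL2 integral_prob_cst mule1.
  case: (integral _ _ _) => [r|//|//]; rewrite -!EFinD => -[h]; congr EFin.
  by lra.
have -> : (gauss R n [set x | B (x + w)%R] =
    \int[gauss R n]_x (\1_[set x | B (x + w)%R] x)%:E)%E.
  by rewrite integral_indic// setIT.
have -> : (\int[gauss R n]_x (\1_[set x | B (x + w)%R] x)%:E =
    \int[gauss R n]_x ((\1_B x)%:E * (L x)%:E))%E.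
  by rewrite -(@gauss_shift n w (fun x => (\1_B x)%:E))//; exact/measurable_EFinP.
apply: (@le_trans _ _ (\int[gauss R n]_x ((1 + la / 2)%:E * (\1_B x)%:E +
    ((2 * la)^-1)%:E * ((L x - 1) ^+ 2)%:E))%E).
  apply: ge0_le_integral => //.
  - by move=> x _; rewrite mule_ge0 ?lee_fin.
  - by apply: emeasurable_funM; exact/measurable_EFinP.
  - apply: emeasurable_funD; apply: emeasurable_funM => //; exact/measurable_EFinP.
  move=> x _; rewrite -!EFinM -EFinD lee_fin indicE.
  have q0 : 0 <= (2 * la)^-1 * (L x - 1) ^+ 2.
    by rewrite mulr_ge0 ?sqr_ge0// invr_ge0 mulr_ge0 ?ltW.
  case: (x \in B); last by rewrite mul0r mulr0 add0r.
  rewrite mul1r mulr1 -subr_ge0.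
  have -> : 1 + la / 2 + (2 * la)^-1 * (L x - 1) ^+ 2 - L x =
     (2 * la)^-1 * (la - (L x - 1)) ^+ 2 by field; rewrite gt_eqF.
  by rewrite mulr_ge0 ?sqr_ge0// invr_ge0 mulr_ge0 ?ltW.
rewrite ge0_integralD//; last 4 first.
- by move=> x _; rewrite mule_ge0 ?lee_fin// addr_ge0// divr_ge0// ltW.
- by apply: emeasurable_funM => //; exact/measurable_EFinP.
- by move=> x _; rewrite mule_ge0 ?lee_fin ?sqr_ge0// invr_ge0 mulr_ge0 ?ltW.
- exact: emeasurable_funM.
rewrite !ge0_integralZl//; last 4 first.
- by move=> x _; rewrite lee_fin sqr_ge0.
- by rewrite lee_fin invr_ge0 mulr_ge0 ?ltW.
- exact/measurable_EFinP.
- by rewrite lee_fin addr_ge0// divr_ge0// ltW.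
rewrite EQ integral_indic// setIT -EFinM (mulrC (_^-1)).
by [].
Qed.

End gauss_shift.

(** * Concentration of p-norms *)

Lemma ge0_markov d (T : measurableType d) (R : realType)
    (mu : {measure set T -> \bar R}) (f : T -> R) (a : R) :
  measurable_fun setT f -> (forall x, 0 <= f x) -> 0 < a ->
  (mu [set x | (a <= f x)%R] <= a^-1%:E * \int[mu]_x (f x)%:E)%E.
Proof.
move=> mf f0 a0.
have mA : measurable [set x | a <= f x].
  rewrite -[X in measurable X]setTI.
  exact: (measurable_fun_ler (measurable_cst a) mf).
rewrite -[mu _]mul1e -(mulVf (lt0r_neq0 a0)) EFinM -muleA.
rewrite lee_wpmul2l ?lee_fin ?invr_ge0 ?(ltW a0)//.
rewrite -[X in mu X]setIT -integral_indic// -ge0_integralZl//; last 2 first.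
- exact/measurable_EFinP.
- by rewrite lee_fin ltW.
apply: ge0_le_integral => //.
- by move=> x _; rewrite mule_ge0 ?lee_fin// ltW.
- by apply: emeasurable_funM => //; exact/measurable_EFinP.
- exact/measurable_EFinP.
move=> x _; rewrite -EFinM lee_fin indicE.
by have [|_] := boolP (x \in [set x | a <= f x]); rewrite ?inE/= ?mulr1 ?mulr0.
Qed.

Section gauss_sums.
Context (R : realType).
Local Notation N := (@normal_prob R 0 1).
Local Notation cons x v := (col_mx (x%:M : 'M[R]_1) v).
Local Notation V n := (borel_mx R n 1).
Variable g : R -> R.
Hypotheses (mg : measurable_fun setT g) (g0 : forall x, 0 <= g x).

Definition csum n (x : 'cV[R]_n) : R := \sum_i g (x i ord0).

Lemma csum_cons n x (v : 'cV[R]_n) : csum (cons x v : 'cV[R]_n.+1) = g x + csum v.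
Proof. exact: (sum_col_cons x v (fun _ => g)). Qed.

Lemma csum0 (x : 'cV[R]_0) : csum x = 0.
Proof. by rewrite /csum big_ord0. Qed.

Lemma csum_ge0 n (x : 'cV[R]_n) : 0 <= csum x.
Proof. exact: sumr_ge0. Qed.

Lemma measurable_csum n : measurable_fun (setT : set (V n)) (@csum n).
Proof.
apply: measurable_sum => i.
by apply: measurableT_comp => //; exact: (measurable_mx_entry i ord0).
Qed.

Let mgc n : measurable_fun setT (fun p : R * V n => g p.1 + csum p.2).
Proof.
apply: measurable_funD; first exact: measurableT_comp.
exact: (measurableT_comp (@measurable_csum n)).
Qed.

Lemma integral_csum n m1 : (\int[N]_x (g x)%:E = m1%:E)%E ->
  (\int[gauss R n]_x (csum x)%:E = (n%:R * m1)%:E)%E.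
Proof.
move=> E1; elim: n => [|n IH].
  by under eq_integral do rewrite csum0; rewrite integral_prob_cst mul0r.
rewrite integral_gaussS; last 2 first.
- by apply/measurable_EFinP; exact: measurable_csum.
- by move=> x; rewrite lee_fin csum_ge0.
transitivity (\int[N]_x ((g x)%:E + (n%:R * m1)%:E))%E.
  apply: eq_integral => x _; under eq_integral do rewrite csum_cons EFinD.
  rewrite ge0_integralD//; last 3 first.
  - by move=> v _; rewrite lee_fin.
  - by move=> v _; rewrite lee_fin csum_ge0.
  - by apply/measurable_EFinP; exact: measurable_csum.
  by rewrite integral_prob_cst IH.
have m0 : 0 <= m1.
  by rewrite -lee_fin -E1; apply: integral_ge0 => z _; rewrite lee_fin.
rewrite ge0_integralD//; last 3 first.
- by move=> v _; rewrite lee_fin.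
- exact/measurable_EFinP.
- by move=> v _; rewrite lee_fin mulr_ge0.
by rewrite integral_prob_cst E1 -EFinD -natr1; congr EFin; ring.
Qed.

Lemma integral_csum_sqr n m1 m2 : (\int[N]_x (g x)%:E = m1%:E)%E ->
  (\int[N]_x (g x ^+ 2)%:E = m2%:E)%E ->
  (\int[gauss R n]_x (csum x ^+ 2)%:E =
    (n%:R * m2 + (n%:R ^+ 2 - n%:R) * m1 ^+ 2)%:E)%E.
Proof.
move=> E1 E2.
have m10 : 0 <= m1.
  by rewrite -lee_fin -E1; apply: integral_ge0 => z _; rewrite lee_fin.
elim: n => [|n IH].
  under eq_integral do rewrite csum0; rewrite integral_prob_cst.
  by congr EFin; ring.
rewrite integral_gaussS; last 2 first.
- by apply/measurable_EFinP; apply: measurable_funX; exact: measurable_csum.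
- by move=> x; rewrite lee_fin sqr_ge0.
set K := n%:R * m2 + (n%:R ^+ 2 - n%:R) * m1 ^+ 2 in IH *.
have K0 : 0 <= K.
  by rewrite -lee_fin -IH; apply: integral_ge0 => z _; rewrite lee_fin sqr_ge0.
transitivity (\int[N]_x ((g x ^+ 2)%:E + ((n%:R * m1 * 2)%:E * (g x)%:E + K%:E)))%E.
  apply: eq_integral => x _.
  transitivity (\int[gauss R n]_v ((g x ^+ 2)%:E + ((2 * g x)%:E * (csum v)%:E + (csum v ^+ 2)%:E)))%E.
    apply: eq_integral => v _; rewrite csum_cons -EFinM -!EFinD.
    by congr EFin; ring.
  have h1 : measurable_fun setT (fun v : V n => (csum v)%:E).
    by apply/measurable_EFinP; exact: measurable_csum.
  have h2 : measurable_fun setT (fun v : V n => (csum v ^+ 2)%:E).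
    by apply/measurable_EFinP; apply: measurable_funX; exact: measurable_csum.
  rewrite ge0_integralD//; last 3 first.
  - by move=> v _; rewrite lee_fin sqr_ge0.
  - by move=> v _; rewrite adde_ge0 ?mule_ge0 ?lee_fin ?mulr_ge0 ?csum_ge0.
  - by apply: emeasurable_funD => //; exact: emeasurable_funM.
  rewrite ge0_integralD//; last 3 first.
  - by move=> v _; rewrite mule_ge0 ?lee_fin ?csum_ge0 ?mulr_ge0.
  - exact: emeasurable_funM.
  - by move=> v _; rewrite lee_fin sqr_ge0.
  rewrite ge0_integralZl//; last 2 first.
  - by move=> v _; rewrite lee_fin csum_ge0.
  - by rewrite lee_fin mulr_ge0.
  rewrite integral_prob_cst IH (integral_csum _ E1) -!EFinM -!EFinD.
  by congr EFin; ring.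
rewrite ge0_integralD//; last 4 first.
- by move=> v _; rewrite lee_fin sqr_ge0.
- by apply/measurable_EFinP; exact: measurable_funX.
- by move=> v _; rewrite adde_ge0// ?mule_ge0 ?lee_fin// !mulr_ge0.
- by apply: emeasurable_funD => //; apply: emeasurable_funM => //; exact/measurable_EFinP.
rewrite ge0_integralD//; last 2 first.
- by move=> v _; rewrite mule_ge0 ?lee_fin// !mulr_ge0.
- by apply: emeasurable_funM => //; exact/measurable_EFinP.
rewrite ge0_integralZl//; last 3 first.
- exact/measurable_EFinP.
- by move=> v _; rewrite lee_fin.
- by rewrite lee_fin !mulr_ge0.
rewrite integral_prob_cst E1 E2 -!EFinM -!EFinD /K -natr1; congr EFin; ring.
Qed.

(** The Laplace transform of a sum of independent terms is the product of theirs; an upper bound on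
    each factor is enough. *)
Lemma integral_expR_csum n la e : 0 <= la ->
  (\int[N]_x (expR (- (la * g x)))%:E <= (expR e)%:E)%E ->
  (\int[gauss R n]_x (expR (- (la * csum x)))%:E <= (expR (n%:R * e))%:E)%E.
Proof.
move=> la0 E; elim: n => [|n IH].
  under eq_integral do rewrite csum0; rewrite integral_prob_cst mulr0 oppr0 expR0.
  by rewrite mul0r expR0.
have mc m : measurable_fun setT (fun v : V m => (expR (- (la * csum v)))%:E).
  apply/measurable_EFinP; apply: measurableT_comp => //; apply: measurableT_comp => //.
  by apply: measurable_funM => //; exact: measurable_csum.
rewrite integral_gaussS//; last exact: mc.
apply: (@le_trans _ _ (\int[N]_x ((expR (- (la * g x)))%:E * (expR (n%:R * e))%:E))%E).
  apply: ge0_le_integral => //.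
  - by move=> x _; apply: integral_ge0 => v _.
  - apply: measurable_integral_curry => //.
    apply/measurable_EFinP; apply: measurableT_comp => //; apply: measurableT_comp => //.
    apply: measurable_funM => //; under eq_fun do rewrite csum_cons.
    exact: mgc.
  - apply: emeasurable_funM => //; apply/measurable_EFinP; apply: measurableT_comp => //.
    by apply: measurableT_comp => //; apply: measurable_funM.
  move=> x _; under eq_integral do rewrite csum_cons mulrDr opprD expRD EFinM.
  by rewrite ge0_integralZl// lee_wpmul2l.
rewrite ge0_integralZr//; last first.
  apply/measurable_EFinP; apply: measurableT_comp => //.
  by apply: measurableT_comp => //; apply: measurable_funM.
by rewrite -natr1 mulrDl mul1r addrC expRD EFinM lee_wpmul2r.
Qed.

(** Chebyshev's inequality, with the variance [n (m2 - m1^2)] bounded by [n m2]. A polynomial bound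
    is enough because only the residual of the planted word must be bounded from above; and for
    [p > 2] the variable [|x|^p] has no exponential moment. *)
Lemma gauss_upper_tail n m1 m2 eta : (0 < n)%N -> 0 < m1 -> 0 < eta ->
  (\int[N]_x (g x)%:E = m1%:E)%E -> (\int[N]_x (g x ^+ 2)%:E = m2%:E)%E ->
  (gauss R n [set x | (n%:R * m1 * (1 + eta) <= csum x)%R] <=
    (m2 / (n%:R * m1 ^+ 2 * eta ^+ 2))%:E)%E.
Proof.
move=> n0 m10 eta0 E1 E2.
pose a := n%:R * m1; have a0 : 0 < a by rewrite mulr_gt0// ltr0n.
have mq : measurable_fun (setT : set (V n)) (fun x => (csum x - a) ^+ 2).
  by apply: measurable_funX; apply: measurable_funB => //; exact: measurable_csum.
have EV : (\int[gauss R n]_x ((csum x - a) ^+ 2)%:E = (n%:R * (m2 - m1 ^+ 2))%:E)%E.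
  have : (\int[gauss R n]_x (((csum x - a) ^+ 2)%:E + (2 * a)%:E * (csum x)%:E) =
         \int[gauss R n]_x ((csum x ^+ 2)%:E + (a ^+ 2)%:E))%E.
    by apply: eq_integral => x _; rewrite -EFinM -!EFinD; congr EFin; ring.
  have h1 : measurable_fun setT (fun v : V n => (csum v)%:E).
    by apply/measurable_EFinP; exact: measurable_csum.
  rewrite ge0_integralD//; last 4 first.
  - by move=> x _; rewrite lee_fin sqr_ge0.
  - exact/measurable_EFinP.
  - by move=> x _; rewrite mule_ge0 ?lee_fin ?csum_ge0// mulr_ge0// ltW.
  - exact: emeasurable_funM.
  rewrite ge0_integralZl//; last 2 first.
  - by move=> x _; rewrite lee_fin csum_ge0.
  - by rewrite lee_fin mulr_ge0// ltW.
  rewrite ge0_integralD//; last 3 first.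
  - by move=> x _; rewrite lee_fin sqr_ge0.
  - by apply/measurable_EFinP; apply: measurable_funX; exact: measurable_csum.
  - by move=> x _; rewrite lee_fin sqr_ge0.
  rewrite integral_prob_cst (integral_csum_sqr _ E1 E2) (integral_csum _ E1).
  case: (integral _ _ _) => [r|//|//]; rewrite -!EFinM -!EFinD => -[h]; congr EFin.
  rewrite -/a in h.
  have -> : r = n%:R * m2 + (n%:R ^+ 2 - n%:R) * m1 ^+ 2 + a ^+ 2 - 2 * a * a by lra.
  by rewrite /a; ring.
have h0 : 0 < (a * eta) ^+ 2 by rewrite exprn_gt0// mulr_gt0.
apply: (@le_trans _ _ (gauss R n [set x | (a * eta) ^+ 2 <= (csum x - a) ^+ 2])).
  apply: le_measure; rewrite ?inE.
  - rewrite -[X in measurable X]setTI; apply: measurable_fun_ler => //.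
    exact: measurable_csum.
  - by rewrite -[X in measurable X]setTI; exact: measurable_fun_ler.
  move=> x /=; rewrite -/a => h; rewrite ler_sqr ?nnegrE; first by lra.
    by rewrite mulr_ge0// ltW.
  by rewrite subr_ge0 (le_trans _ h)// ler_peMr// ?ltW// ltrDl.
apply: (le_trans (ge0_markov _ mq _ h0)) => [x|]; first exact: sqr_ge0.
rewrite EV -EFinM lee_fin.
have n0' : 0 < n%:R :> R by rewrite ltr0n.
have -> : m2 / (n%:R * m1 ^+ 2 * eta ^+ 2) = ((a * eta) ^+ 2)^-1 * (n%:R * m2).
  by rewrite /a; field; rewrite !gt_eqF.
by rewrite ler_pM2l ?invr_gt0// ler_pM2l// gerBl sqr_ge0.
Qed.

(* Exponentially small, unlike the Chebyshev bound above, to afford a union bound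
   over all the words. *)
Lemma gauss_lower_tail n m1 m2 eta : 0 < m1 -> 0 < eta ->
  (\int[N]_x (g x)%:E = m1%:E)%E -> (\int[N]_x (g x ^+ 2)%:E = m2%:E)%E -> 0 < m2 ->
  (gauss R n [set x | (csum x <= n%:R * m1 * (1 - eta))%R] <=
    (expR (- (n%:R * m1 ^+ 2 * eta ^+ 2 / (4 * m2))))%:E)%E.
Proof.
move=> m10 eta0 E1 E2 m20.
(* Minimizer of the Chernoff exponent [n (la^2 m2 - la m1 eta)]. *)
pose la := m1 * eta / (2 * m2).
have la0 : 0 < la by rewrite divr_gt0 ?mulr_gt0.
pose e := - (la * m1) + la ^+ 2 * m2.
have H : (\int[N]_x (expR (- (la * g x)))%:E <= (expR e)%:E)%E.
  have mE : measurable_fun setT (fun x => (expR (- (la * g x)))%:E).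
    apply/measurable_EFinP; apply: measurableT_comp => //.
    by apply: measurableT_comp => //; apply: measurable_funM.
  have : (\int[N]_x ((expR (- (la * g x)))%:E + la%:E * (g x)%:E) <=
          \int[N]_x (1 + (la ^+ 2)%:E * (g x ^+ 2)%:E))%E.
    apply: ge0_le_integral => //.
    - by move=> x _; rewrite adde_ge0// ?mule_ge0 ?lee_fin// ltW.
    - by apply: emeasurable_funD => //; apply: emeasurable_funM => //; exact/measurable_EFinP.
    - apply: emeasurable_funD => //; apply: emeasurable_funM => //.
      by apply/measurable_EFinP; exact: measurable_funX.
    move=> x _; rewrite -!EFinM -!EFinD lee_fin -exprMn.
    set y := la * g x; have y0 : 0 <= y by rewrite mulr_ge0// ltW.
    (* The inequality [exp(- y) <= 1 - y + y^2] for [y >= 0] is proved after multiplication by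
       [1 + y], because [(1 - y + y^2) (1 + y) = 1 + y^3]. The sign of [g] thus makes two moments
       suffice for an exponential lower tail. *)
    have h1 : expR (- y) * (1 + y) <= 1.
      by rewrite expRN mulrC ler_pdivrMr ?expR_gt0// mul1r expR_ge1Dx.
    have y1 : 0 < 1 + y by lra.
    rewrite -(ler_pM2r y1) mulrDl (le_trans (lerD h1 (lexx _)))//.
    have : 0 <= y ^+ 3 by rewrite exprn_ge0.
    by nra.
  rewrite ge0_integralD//; last 2 first.
  - by move=> x _; rewrite mule_ge0 ?lee_fin// ltW.
  - by apply: emeasurable_funM => //; exact/measurable_EFinP.
  rewrite ge0_integralZl//; last 3 first.
  - exact/measurable_EFinP.
  - by move=> x _; rewrite lee_fin.
  - by rewrite lee_fin ltW.
  rewrite ge0_integralD//; last 2 first.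
  - by move=> x _; rewrite mule_ge0 ?lee_fin ?sqr_ge0.
  - by apply: emeasurable_funM => //; apply/measurable_EFinP; exact: measurable_funX.
  rewrite ge0_integralZl//; last 3 first.
  - by apply/measurable_EFinP; exact: measurable_funX.
  - by move=> x _; rewrite lee_fin sqr_ge0.
  - by rewrite lee_fin sqr_ge0.
  rewrite integral_prob_cst E1 E2.
  case: (integral _ _ _) => [r|//|_]; last by rewrite leNye.
  rewrite -!EFinM -!EFinD !lee_fin => h.
  by rewrite (le_trans _ (expR_ge1Dx _))// /e; lra.
have mE : measurable_fun (setT : set (V n)) (fun x => expR (- (la * csum x))).
  apply: measurableT_comp => //; apply: measurableT_comp => //.
  by apply: measurable_funM => //; exact: measurable_csum.
pose t := n%:R * m1 * (1 - eta).
apply: (@le_trans _ _ (gauss R n [set x | expR (- (la * t)) <= expR (- (la * csum x))])).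
  apply: le_measure; rewrite ?inE.
  - rewrite -[X in measurable X]setTI; apply: measurable_fun_ler => //.
    exact: measurable_csum.
  - by rewrite -[X in measurable X]setTI; exact: measurable_fun_ler.
  by move=> x /= h; rewrite ler_expR lerN2 ler_pM2l.
apply: (le_trans (ge0_markov _ mE _ (expR_gt0 _))) => [x|]; first exact: expR_ge0.
apply: (@le_trans _ _ ((expR (- (la * t)))^-1%:E * (expR (n%:R * e))%:E)%E).
  by rewrite lee_wpmul2l ?lee_fin ?invr_ge0 ?expR_ge0// integral_expR_csum// ltW.
rewrite -expRN opprK -EFinM -expRD lee_fin ler_expR /e /t /la.
rewrite le_eqVlt; apply/orP; left; apply/eqP; field.
by rewrite gt_eqF.
Qed.

End gauss_sums.

(** * Moments of Gaussian variables *)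

Section moments.
Context (R : realType).
Local Notation N := (@normal_prob R 0 1).
Local Notation V n := (borel_mx R n 1).

Lemma integral_expR_normal (u : R) :
  (\int[N]_x (expR (u * x))%:E = (expR (u ^+ 2 / 2))%:E)%E.
Proof.
have := @normal_shift R u (cst 1%E) (measurable_cst _) (fun _ => @lee01 R).
rewrite integral_prob_cst => /esym h.
transitivity (\int[N]_x ((expR (u ^+ 2 / 2))%:E * (1 * (expR (u * x - u ^+ 2 / 2))%:E)))%E.
  apply: eq_integral => x _; rewrite mul1e -EFinM -expRD; congr (expR _)%:E; ring.
rewrite ge0_integralZl//.
- by rewrite h mule1.
- rewrite /=; under eq_fun do rewrite mul1e.
  apply/measurable_EFinP; apply: measurableT_comp => //.
  by apply: measurable_funB => //; exact: measurable_funM.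
Qed.

Lemma expR_abs_le (x : R) : expR `|x| <= expR x + expR (- x).
Proof. by case: (ger0P x) => _; rewrite ?lerDl ?lerDr expR_ge0. Qed.

(** Finite since [|x| <= p exp(|x| / p)], hence [|x|^p <= p^p exp |x|]. Positive since otherwise
    [x = 0] almost surely, and the mean of [exp x] would be [1] instead of [exp(1/2)]. *)
Lemma normal_moment (p : R) : 0 < p ->
  exists2 c : R, 0 < c & (\int[N]_x (`|x| `^ p)%:E = c%:E)%E.
Proof.
move=> p0.
have mp : measurable_fun setT (fun x : R => `|x| `^ p).
  by apply: (measurableT_comp (measurable_powR p)).
have le x : `|x| `^ p <= p `^ p * (expR x + expR (- x)).
  apply: (@le_trans _ _ (p `^ p * expR `|x|)); last first.
    by rewrite ler_wpM2l ?powR_ge0// expR_abs_le.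
  have h : `|x| <= p * expR (`|x| / p).
    rewrite -ler_pdivrMl// mulrC (le_trans _ (expR_ge1Dx _))//.
    by rewrite lerDr.
  apply: (le_trans (ge0_ler_powR (ltW p0) _ _ h)); rewrite ?nnegrE//.
    by rewrite mulr_ge0 ?expR_ge0// ltW.
  rewrite powRM ?expR_ge0 ?(ltW p0)//.
  by rewrite -expRM divfK// gt_eqF.
have mE u : measurable_fun setT (fun x : R => (expR (u * x))%:E).
  by apply/measurable_EFinP; apply: measurableT_comp => //; exact: measurable_funM.
have fin : (\int[N]_x (`|x| `^ p)%:E < +oo)%E.
  apply: (@le_lt_trans _ _ (\int[N]_x ((p `^ p)%:E * ((expR (1 * x))%:E + (expR (-1 * x))%:E)))%E).
    apply: ge0_le_integral => //.
    - exact/measurable_EFinP.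
    - by apply: emeasurable_funM => //; apply: emeasurable_funD; exact: mE.
    by move=> x _; rewrite -EFinD -EFinM lee_fin mul1r mulN1r.
  rewrite ge0_integralZl//; last 3 first.
  - by apply: emeasurable_funD; exact: mE.
  - by move=> x _; rewrite adde_ge0 ?lee_fin ?expR_ge0.
  - by rewrite lee_fin powR_ge0.
  rewrite ge0_integralD//; last 2 first.
  - exact: mE.
  - exact: mE.
  by rewrite !integral_expR_normal -EFinD -EFinM ltry.
have ge0 : (0 <= \int[N]_x (`|x| `^ p)%:E)%E.
  by apply: integral_ge0 => x _; rewrite lee_fin powR_ge0.
exists (fine (\int[N]_x (`|x| `^ p)%:E)%E); last first.
  by rewrite fineK// ge0_fin_numE.
rewrite fine_gt0// fin andbT lt_neqAle ge0 andbT.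
apply/eqP => /esym I0.
have : ae_eq N setT (fun x : R => (`|x| `^ p)%:E) (cst 0%E).
  apply/(ae_eq_integral_abs N measurableT); first exact/measurable_EFinP.
  rewrite -[RHS]I0; apply: eq_integral => x _.
  by rewrite gee0_abs// lee_fin powR_ge0.
move=> ae0.
have : (\int[N]_x (expR (1 * x))%:E = \int[N]_x (cst 1 x))%E.
  apply: ae_eq_integral => //; first exact: mE.
  move: ae0; apply: filterS => x /= /(_ I) [] /powR_eq0_eq0 /eqP.
  by rewrite normr_eq0 => /eqP -> _; rewrite mulr0 expR0.
rewrite integral_expR_normal integral_prob_cst => -[] h.
have := expR_gt1 (1 ^+ 2 / 2 : R).
by rewrite h ltxx expr1n divr_gt0.
Qed.

(** A crude bound on the second moment of a standard normal variable, read off its Laplace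
    transform: [y^2 <= 4 exp |y| <= 4 (exp y + exp(- y))], whose mean is [8 exp(1/2)]. *)
Definition linear_const : R := 8 * expR 2^-1.

Lemma integral_dot_sqr n (u : 'cV[R]_n) :
  (\int[gauss R n]_x (dot u x ^+ 2)%:E <= (linear_const * dot u u)%:E)%E.
Proof.
have [u0|u0] := eqVneq (dot u u) 0.
  rewrite u0 mulr0.
  have ui i : u i ord0 = 0.
    move/eqP: u0; rewrite /dot psumr_eq0 => [|j _]; last by rewrite -expr2 sqr_ge0.
    by move=> /allP /(_ i (mem_index_enum i)); rewrite -expr2 sqrf_eq0 => /eqP.
  rewrite (@eq_integral _ _ _ _ _ (cst 0%E)) ?integral0// => x _.
  by rewrite /dot big1 ?expr0n// => i _; rewrite ui mul0r.
have duu : 0 < dot u u by rewrite lt_neqAle eq_sym u0 dot_ge0.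
pose s := Num.sqrt (dot u u).
have s0 : 0 < s by rewrite sqrtr_gt0.
have s2 : s ^+ 2 = dot u u by rewrite sqr_sqrtr// dot_ge0.
have [w dw uw] : exists2 w, dot w w = 1 & u = s *: w.
  exists (s^-1 *: u); last by rewrite scalerA divff ?gt_eqF// scale1r.
  by rewrite dotZl dotC dotZl -s2; field; rewrite gt_eqF.
have mE (v : 'cV[R]_n) : measurable_fun (setT : set (V n)) (fun x => (expR (dot v x))%:E).
  by apply/measurable_EFinP; apply: measurableT_comp => //; exact: measurable_dot.
apply: (@le_trans _ _ (\int[gauss R n]_x ((4 * s ^+ 2)%:E * ((expR (dot w x))%:E + (expR (dot (- w) x))%:E)))%E).
  apply: ge0_le_integral => //.
  - by move=> x _; rewrite lee_fin sqr_ge0.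
  - by apply/measurable_EFinP; apply: measurable_funX; exact: measurable_dot.
  - by apply: emeasurable_funM => //; apply: emeasurable_funD; exact: mE.
  move=> x _; rewrite -EFinD -EFinM lee_fin.
  rewrite {1}uw dotZl exprMn -scaleN1r dotZl mulN1r [leLHS]mulrC [leRHS]mulrAC ler_wpM2r ?sqr_ge0//.
  set y := dot w x.
  apply: (@le_trans _ _ (4 * expR `|y|)); last by rewrite ler_wpM2l// expR_abs_le.
  have h := expR_ge1Dx (`|y| / 2).
  have -> : expR `|y| = expR (`|y| / 2) ^+ 2 by rewrite expr2 -expRD; congr expR; field.
  rewrite -real_normK ?num_real//.
  have : 0 <= `|y| by []. move: `|y| (expR (`|y| / 2)) h => a b h a0.
  by nra.
rewrite ge0_integralZl//; last 3 first.
- by apply: emeasurable_funD; exact: mE.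
- by move=> x _; rewrite adde_ge0 ?lee_fin ?expR_ge0.
- by rewrite lee_fin mulr_ge0 ?sqr_ge0.
rewrite ge0_integralD//.
have dNw : dot (- w) (- w) = 1.
  by rewrite -scaleN1r dotZl dotC dotZl dw mulr1 mulN1r opprK.
rewrite !integral_expR_dot dw dNw -EFinD -EFinM lee_fin s2 /linear_const mul1r.
by rewrite le_eqVlt; apply/orP; left; apply/eqP; ring.
Qed.

End moments.

(** * Projections and Gaussian matrices *)

(** Orthogonal projection [B^T (B B^T)^-1 B] for a basis [B] of the row space; its trace is the rank
    of [S]. The Gram matrix is invertible since [v B B^T = 0] implies [|v B|^2 = 0]. *)
Lemma row_space_projection (R : realFieldType) m n (S : 'M[R]_(m, n)) :
  exists P : 'M[R]_n, [/\ S *m P = S, P^T = P, P *m P = P & \tr P <= m%:R].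
Proof.
have [B fB SB] : exists2 B : 'M[R]_(\rank S, n), row_free B & (S <= B)%MS.
  by exists (row_base S); [exact: row_base_free|rewrite eq_row_base].
have uB : B *m B^T \in unitmx.
  rewrite -row_free_unit; apply: inj_row_free => v vBB.
  have /matrixP vB0 : v *m B = 0.
    apply/matrixP => i j; rewrite (ord1 i) [RHS]mxE.
    have : \sum_k (v *m B) ord0 k ^+ 2 = 0.
      transitivity (((v *m B) *m (v *m B)^T) ord0 ord0).
        by rewrite [RHS]mxE; apply: eq_bigr => k _; rewrite [X in _ = _ * X]mxE expr2.
      by rewrite trmx_mul mulmxA -(mulmxA v) vBB mul0mx mxE.
    move/eqP; rewrite psumr_eq0 => [|k _]; last exact: sqr_ge0.
    by move=> /allP /(_ j (mem_index_enum j)); rewrite sqrf_eq0 => /eqP.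
  have /row_freeP[D BD] := fB.
  have {}vB0 : v *m B = 0 by apply/matrixP.
  by rewrite -[v]mulmx1 -BD mulmxA vB0 mul0mx.
pose P := B^T *m invmx (B *m B^T) *m B.
have BP : B *m P = B by rewrite /P !mulmxA mulmxV// mul1mx.
exists P; split.
- have /submxP[D SD] := SB; rewrite {1}SD [RHS]SD.
  by rewrite -[LHS]mulmxA BP.
- by rewrite /P !trmx_mul trmxK trmx_inv trmx_mul trmxK mulmxA.
- have -> : P *m P = B^T *m invmx (B *m B^T) *m (B *m P) by rewrite !mulmxA.
  by rewrite BP.
- by rewrite /P mxtrace_mulC mulmxA mulmxV// mxtrace1 ler_nat rank_leq_row.
Qed.

Section gauss_matrix.
Context (R : realType).
Local Notation N := (@normal_prob R 0 1).
Local Notation V n := (borel_mx R n 1).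

(** The squared norms of the rows of [P] add up to [tr (P P^T) = tr P]: the visible part of a
    Gaussian signal is governed by [m], whatever [n]. *)
Lemma integral_dot_proj m n (P : 'M[R]_n) : P^T = P -> P *m P = P -> \tr P <= m%:R ->
  (\int[gauss R n]_x (dot (P *m x) (P *m x))%:E <= (linear_const R * m%:R)%:E)%E.
Proof.
move=> PT PP trP.
pose u t := (row t P)^T.
have E (x : 'cV[R]_n) t : (P *m x) t ord0 = dot (u t) x.
  by rewrite mxE; apply: eq_bigr => s _; rewrite !mxE.
under eq_integral do rewrite /dot -sumEFin.
rewrite ge0_integral_sum//; last 2 first.
- move=> t; apply/measurable_EFinP.
  under eq_fun do rewrite E.
  by apply: measurable_funM; exact: measurable_dot.
- by move=> t x _; rewrite lee_fin -expr2 sqr_ge0.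
apply: (@le_trans _ _ (\sum_t (linear_const R * dot (u t) (u t))%:E)%E).
  apply: lee_sum => t _; apply: le_trans (integral_dot_sqr (u t)).
  by under eq_integral do rewrite E -expr2.
rewrite sumEFin lee_fin -mulr_sumr ler_wpM2l ?mulr_ge0 ?expR_ge0//.
apply: le_trans trP; rewrite -PP -{2}PT le_eqVlt; apply/orP; left; apply/eqP.
by apply: eq_bigr => t _; rewrite mxE; apply: eq_bigr => s _; rewrite !mxE.
Qed.

Lemma measurable_row_cons n D :
  measurable_fun setT (fun p : V n * borel_mx R n D =>
    row_mx p.1 p.2 : borel_mx R n D.+1).
Proof. exact: (@measurable_row_mx R _ _ n 1 D fst snd). Qed.

Fixpoint gaussmx (n D : nat) : probability (borel_mx R n D) R :=
  if D is D'.+1 then law (gauss R n \x gaussmx n D')%E (@measurable_row_cons n D')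
  else \d_(0 : borel_mx R n 0).

Lemma integral_gaussmxS n D (f : 'M[R]_(n, D.+1) -> \bar R) :
  measurable_fun (setT : set (borel_mx R n D.+1)) f -> (forall x, 0 <= f x)%E ->
  (\int[gaussmx n D.+1]_W f W =
   \int[gauss R n]_v \int[gaussmx n D]_W f (row_mx (v : 'cV[R]_n) W))%E.
Proof.
move=> mf f0; rewrite ge0_integral_law//.
rewrite (@fubini_tonelli1 _ _ _ _ _ (gauss R n) (gaussmx n D)
  (fun p : V n * borel_mx R n D => f (row_mx (p.1 : 'cV[R]_n) p.2)))//.
exact: (measurableT_comp mf (@measurable_row_cons n D)).
Qed.

(** Columns are merged one at a time by [gauss_stable]. Applied to a unit vector, a Gaussian matrix
    thus gives a standard Gaussian vector. *)
Lemma gaussmx_mulmx n D (c : 'cV[R]_D) (f : 'cV[R]_n -> \bar R) :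
  measurable_fun (setT : set (V n)) f -> (forall x, 0 <= f x)%E ->
  (\int[gaussmx n D]_W f (W *m c) =
   \int[gauss R n]_x f (Num.sqrt (dot c c) *: x)%R)%E.
Proof.
elim: D c f => [|D IH] c f mf f0.
  rewrite (flatmx0 c); under eq_integral do rewrite mulmx0.
  rewrite dot_mx0 sqrtr0; under [RHS]eq_integral do rewrite scale0r.
  by rewrite !integral_prob_cst.
have [c0 [c' ->]] := col_consE c.
have mW d (T : measurableType d) m l (A : T -> borel_mx R n m) (b : 'M[R]_(m, l)) :
    measurable_fun setT A ->
    measurable_fun setT (fun x => (A x : 'M[R]_(n, m)) *m b : borel_mx R n l).
  by move=> mA; apply: (measurable_mulmx mA (measurable_cst (b : borel_mx R m l))).
rewrite integral_gaussmxS//; last exact: (measurableT_comp mf (mW _ _ _ _ _ _ (@measurable_id _ _ _))).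
transitivity (\int[gauss R n]_v \int[gaussmx n D]_W f (c0 *: v + W *m c')%R)%E.
  apply: eq_integral => v _; apply: eq_integral => W _; congr f.
  transitivity (v *m c0%:M + W *m c'); last by rewrite mul_mx_scalar.
  exact: (@mul_row_col R n 1 D 1 v W c0%:M c').
transitivity (\int[gauss R n]_v \int[gauss R n]_x f (c0 *: v + Num.sqrt (dot c' c') *: x)%R)%E.
  apply: eq_integral => v _.
  apply: (IH c' (fun y => f (c0 *: v + y)%R)) => //.
  by apply: (measurableT_comp mf); apply: measurable_addmx.
rewrite gauss_stable// dot_cons sqr_sqrtr ?dot_ge0//.
Qed.

Lemma gauss_affine_law n D (a : R) (c : 'cV[R]_D) (f : 'cV[R]_n -> \bar R) :
  measurable_fun (setT : set (V n)) f -> (forall x, 0 <= f x)%E ->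
  (\int[gaussmx n D]_W \int[gauss R n]_g f (a *: g + W *m c)%R =
   \int[gauss R n]_x f (Num.sqrt (a ^+ 2 + dot c c) *: x)%R)%E.
Proof.
move=> mf f0; rewrite tonelli_curry//; last first.
  apply: (measurableT_comp mf); apply: measurable_addmx.
    by apply: measurable_scalemx.
  by apply: (measurable_mulmx _ (measurable_cst (c : borel_mx R D 1))).
transitivity (\int[gauss R n]_g \int[gauss R n]_x f (a *: g + Num.sqrt (dot c c) *: x)%R)%E.
  apply: eq_integral => g _.
  apply: (@gaussmx_mulmx n D c (fun y => f (a *: g + y)%R)) => //.
  by apply: (measurableT_comp mf); apply: measurable_addmx.
by rewrite gauss_stable// sqr_sqrtr ?dot_ge0.
Qed.

End gauss_matrix.

(** * Agreement of words *)

Section agreement.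
Context (k s : nat).
Implicit Types I J : {ffun 'I_k -> 'I_s}.
Local Open Scope nat_scope.

Definition agree I J : nat := #|[set j | I j == J j]%SET|.

(** The words for which decoding to [J] is acceptable; the factors 3 and 4 avoid a division. *)
Definition agree_ball J : {set {ffun 'I_k -> 'I_s}} :=
  [set I | 3 * k <= 4 * agree I J]%SET.

Lemma agreeE I J : agree I J = \sum_j (I j == J j : nat).
Proof. by rewrite /agree -sum1_card big_mkcond /=; apply: eq_bigr => j _; rewrite inE; case: eqP. Qed.

(** The sum factorizes over positions: each contributes [s] for the letter of [J] and [1] for each
    of the [s - 1] others. *)
Lemma sum_expn_agree J : 0 < s ->
  \sum_I s ^ agree I J = (2 * s).-1 ^ k.
Proof.
move=> s0.
transitivity (\sum_(I : {ffun 'I_k -> 'I_s}) \prod_j (if I j == J j then s else 1)).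
  apply: eq_bigr => I _; rewrite agreeE expn_sum.
  by apply: eq_bigr => j _; case: eqP.
rewrite -(bigA_distr_bigA (fun j a => if a == J j then s else 1)) /=.
rewrite -[in RHS](card_ord k) -prod_nat_const; apply: eq_bigr => j _.
rewrite (bigD1 (J j)) //= eqxx.
rewrite (eq_bigr (fun=> 1)); last by move=> a /negbTE ->.
rewrite sum1_card cardC1 card_ord; lia.
Qed.

(* Markov's inequality for [s ^ agree I J], and [(2 s - 1)^8 <= s^13]. *)
Lemma agree_ball_card J : 1 < s -> #|agree_ball J| ^ 8 <= (s ^ k) ^ 7.
Proof.
move=> s1; have s0 : 0 < s by lia.
(* [3 k / 4] rounded up: at most [agree I J] on the ball, while [8 a >= 6 k]. *)
set a := (3 * k + 3) %/ 4.
have h1 : #|agree_ball J| * s ^ a <= (2 * s).-1 ^ k.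
  rewrite -(sum_expn_agree J s0) -sum_nat_const.
  rewrite [leqRHS](bigID (fun I => I \in agree_ball J)) /=.
  apply: (leq_trans _ (leq_addr _ _)); apply: leq_sum => I; rewrite inE => h.
  by rewrite leq_pexp2l// /a; lia.
(* For [s >= 4], [2^8 <= 4^5 <= s^5]. The cases [s = 2] and [s = 3] are [3^8 <= 2^13] and
   [25^4 <= 3 * 27^4]. *)
have h2 : (2 * s).-1 ^ 8 <= s ^ 13.
  have [s4|s4] := leqP 4 s.
    apply: (@leq_trans ((2 * s) ^ 8)); first by rewrite leq_exp2r//; lia.
    rewrite expnMn (_ : 13 = 5 + 8)// expnD leq_mul2r; apply/orP; right.
    by apply: (@leq_trans (4 ^ 5)) => //; rewrite leq_exp2r.
  have /orP[/eqP->|/eqP->] : (s == 2) || (s == 3) by move: s4 s1; clear; lia.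
    by rewrite (expnM 3 4 2) (expnD 2 6 7).
  rewrite (expnM 5 2 4) (expnS 3 12) (expnM 3 3 4).
  have pow4 x y : x <= y -> x ^ 4 <= 3 * y ^ 4.
    by move=> xy; apply: (@leq_trans (y ^ 4)); rewrite ?leq_exp2r// leq_pmull.
  exact: (pow4 (5 ^ 2) (3 ^ 3) isT).
have h3 : #|agree_ball J| ^ 8 * s ^ (6 * k) <= (s ^ k) ^ 7 * s ^ (6 * k).
  apply: (@leq_trans ((#|agree_ball J| * s ^ a) ^ 8)).
    by rewrite expnMn -expnM leq_mul2l leq_pexp2l ?orbT// /a; lia.
  apply: (@leq_trans (((2 * s).-1 ^ k) ^ 8)); first by rewrite leq_exp2r.
  rewrite -!expnM -expnD (_ : k * 7 + 6 * k = 13 * k); last by lia.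
  rewrite (mulnC k) !expnM.
  by case: k => [|k'] //; rewrite leq_exp2r.
by move: h3; rewrite leq_pmul2r// expn_gt0 s0.
Qed.

(** Rotating all letters maps the ball to a disjoint set of the same size, since a word and its
    rotation never agree with [J] at the same position. This covers short codes, for which the
    exponent 7/8 does not yield one half (two words, for instance). *)
Lemma agree_ball_half J : 1 < s -> 0 < k -> 2 * #|agree_ball J| <= s ^ k.
Proof.
move=> s1 k0.
pose shift (I : {ffun 'I_k -> 'I_s}) : {ffun 'I_k -> 'I_s} :=
  [ffun j => ordS (I j)].
have shift_inj : injective shift.
  move=> I I' /ffunP h; apply/ffunP => j; have := h j; rewrite !ffunE.
  exact: ordS_inj.
have disj I : agree I J + agree (shift I) J <= k.
  rewrite !agreeE -big_split /= -[leqRHS](card_ord k) -sum1_card.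
  apply: leq_sum => j _; rewrite ffunE.
  case: eqP => [->|_]; last by case: eqP.
  case: eqP => // /(congr1 val) /=; have := ltn_ord (J j).
  have [e|ne] := eqVneq (J j).+1 s; first by rewrite e modnn; lia.
  by move=> jl; rewrite modn_small; lia.
rewrite mul2n -addnn -{2}(card_imset _ shift_inj).
have d0 : fintype.disjoint (mem (agree_ball J)) (mem (imset shift (mem (agree_ball J)))).
  apply/pred0P => I /=; apply/negbTE/negP => /andP[]; rewrite inE => h1.
  by move=> /imsetP[I']; rewrite inE => h2 E; have := disj I'; rewrite -E; lia.
rewrite -cardsUI (disjoint_setI0 d0) cards0 addn0.
by rewrite -[X in _ <= X ^ _](card_ord s) -[X in _ <= _ ^ X](card_ord k) -card_ffun max_card.
Qed.

End agreement.

Lemma convex_powR_real (R : realType) (p t c d : R) : 1 <= p -> 0 <= t <= 1 ->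
  0 <= c -> 0 <= d ->
  (t * c + (1 - t) * d) `^ p <= t * c `^ p + (1 - t) * d `^ p.
Proof.
move=> p1 /andP[t0 t1] c0 d0.
have h := @convex_powR R p p1 (Itv01 t0 t1) c d.
have H (x : R) : 0 <= x -> x \in (`[0, +oo[%classic : set R).
  by move=> x0; rewrite inE /= in_itv /= andbT.
have {}h := h (H _ c0) (H _ d0).
exact: h.
Qed.

(** * The p-norm *)

Section lp_norm_theory.
Context (R : realType) (p : R).
Hypothesis p1 : 1 <= p.
Local Notation lpn := (lp_norm p).

Let p0 : 0 < p. Proof. exact: lt_le_trans p1. Qed.

Definition lp_sum n (y : 'cV[R]_n) : R := csum (fun z => `|z| `^ p) y.

Lemma lp_sum_ge0 n (y : 'cV[R]_n) : 0 <= lp_sum y.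
Proof. by apply: csum_ge0 => z; exact: powR_ge0. Qed.

Lemma lp_normE n (y : 'cV[R]_n) : lpn y = lp_sum y `^ p^-1.
Proof. by []. Qed.

Lemma lp_norm_ge0 n (y : 'cV[R]_n) : 0 <= lpn y.
Proof. exact: powR_ge0. Qed.

Lemma lp_norm_powR n (y : 'cV[R]_n) : lpn y `^ p = lp_sum y.
Proof. by rewrite lp_normE -powRrM mulVf ?gt_eqF// powRr1// lp_sum_ge0. Qed.

Lemma lp_norm_le n m (x : 'cV[R]_n) (y : 'cV[R]_m) :
  lp_sum x <= lp_sum y -> lpn x <= lpn y.
Proof.
by move=> h; rewrite !lp_normE ge0_ler_powR ?invr_ge0 ?nnegrE ?lp_sum_ge0 ?(ltW p0).
Qed.

Lemma lp_norm0 n : lpn (0 : 'cV[R]_n) = 0.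
Proof.
rewrite lp_normE /lp_sum /csum big1 => [|i _].
  by rewrite powR0// invr_neq0// gt_eqF.
by rewrite mxE normr0 powR0// gt_eqF.
Qed.

Lemma lp_norm_entry n (y : 'cV[R]_n) i : `|y i ord0| <= lpn y.
Proof.
have -> : `|y i ord0| = (`|y i ord0| `^ p) `^ p^-1.
  by rewrite -powRrM mulfV ?gt_eqF// powRr1.
rewrite lp_normE ge0_ler_powR ?invr_ge0 ?nnegrE ?lp_sum_ge0 ?powR_ge0 ?(ltW p0)//.
by rewrite /lp_sum /csum (bigD1 i)//= lerDl sumr_ge0// => j _; exact: powR_ge0.
Qed.

Lemma lp_norm_le0 n (y : 'cV[R]_n) : lpn y <= 0 -> y = 0.
Proof.
move=> h; apply/matrixP => i j; rewrite (ord1 j) mxE; apply/eqP.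
by rewrite -normr_le0 (le_trans (lp_norm_entry y i)).
Qed.

Lemma lp_sum_col_mx m n (y : 'cV[R]_m) (z : 'cV[R]_n) :
  lp_sum (col_mx y z) = lp_sum y + lp_sum z.
Proof.
rewrite /lp_sum /csum big_split_ord /=.
by congr (_ + _); apply: eq_bigr => i _; rewrite ?col_mxEu ?col_mxEd.
Qed.

Lemma lp_norm_col_mxd m n (y : 'cV[R]_m) (z : 'cV[R]_n) :
  lpn z <= lpn (col_mx y z).
Proof. by apply: lp_norm_le; rewrite lp_sum_col_mx lerDr lp_sum_ge0. Qed.

Lemma lp_norm_col_mx0 m n (z : 'cV[R]_n) :
  lpn (col_mx (0 : 'cV[R]_m) z) = lpn z.
Proof.
rewrite !lp_normE lp_sum_col_mx [X in X + _](_ : _ = 0) ?add0r//.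
by rewrite /lp_sum /csum big1// => i _; rewrite mxE normr0 powR0// gt_eqF.
Qed.

(** The factor [n] in place of [n^(1/p)] is harmless: the lemma is applied to a decoding error of
    order [1 / M], with [M] at will. *)
Lemma lp_norm_le_entry n (y : 'cV[R]_n) be : 0 <= be ->
  (forall i, `|y i ord0| <= be) -> lpn y <= n%:R * be.
Proof.
move=> be0 h; case: n y h => [|n] y h.
  by rewrite (flatmx0 y) lp_norm0 mul0r.
have -> : n.+1%:R * be = ((n.+1%:R * be) `^ p) `^ p^-1.
  by rewrite -powRrM mulfV ?gt_eqF// powRr1// mulr_ge0.
rewrite lp_normE ge0_ler_powR ?invr_ge0 ?nnegrE ?lp_sum_ge0 ?powR_ge0 ?(ltW p0)//.
apply: (@le_trans _ _ (\sum_(i < n.+1) be `^ p)).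
  by apply: ler_sum => i _; rewrite ge0_ler_powR ?nnegrE ?(ltW p0).
rewrite sumr_const card_ord powRM// -[leLHS]mulr_natl ler_wpM2r ?powR_ge0//.
by rewrite -[leLHS]powRr1 ?ler0n// ler_powR// ler1n.
Qed.

Lemma lp_normZ n a (y : 'cV[R]_n) : lpn (a *: y) = `|a| * lpn y.
Proof.
rewrite !lp_normE.
have -> : lp_sum (a *: y) = `|a| `^ p * lp_sum y.
  rewrite /lp_sum /csum mulr_sumr; apply: eq_bigr => i _.
  by rewrite mxE normrM powRM.
by rewrite powRM ?powR_ge0 ?lp_sum_ge0// -powRrM mulfV ?gt_eqF// powRr1.
Qed.

Lemma lp_sumZ n a (y : 'cV[R]_n) : lp_sum (a *: y) = `|a| `^ p * lp_sum y.
Proof.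
rewrite /lp_sum /csum mulr_sumr; apply: eq_bigr => i _.
by rewrite mxE normrM powRM.
Qed.

(** Minkowski's inequality by homogeneity: [(x + y) / (a + b)] is the convex combination of [x / a]
    and [y / b], both of p-sum 1, with weights [a / (a + b)] and [b / (a + b)]. *)
Let lp_sumD n (x y : 'cV[R]_n) a b : 0 < a -> 0 < b ->
  lp_sum x = a `^ p -> lp_sum y = b `^ p -> lp_sum (x + y) <= (a + b) `^ p.
Proof.
move=> a0 b0 xa yb; have ab0 : 0 < a + b by rewrite addr_gt0.
have E (z : 'cV[R]_n) c : 0 < c -> lp_sum z = c `^ p -> lp_sum (c^-1 *: z) = 1.
  move=> c0 zc; rewrite lp_sumZ zc -powRM ?(ltW c0)// gtr0_norm ?invr_gt0//.
  by rewrite mulVf ?gt_eqF// powR1.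
set t := a / (a + b).
have t01 : 0 <= t <= 1.
  by rewrite divr_ge0 ?(ltW a0) ?(ltW ab0)//= ler_pdivrMr// mul1r lerDl ltW.
have /andP[t0 t1] := t01; have t1' : 0 <= 1 - t by rewrite subr_ge0.
have tb : b / (a + b) = 1 - t by rewrite /t; field; rewrite gt_eqF.
have : t * lp_sum (a^-1 *: x) + (1 - t) * lp_sum (b^-1 *: y) = 1.
  by rewrite !E// !mulr1 addrC subrK.
move=> {}E; rewrite -[leRHS]mulr1 -{}E /lp_sum /csum !mulr_sumr -big_split mulr_sumr /=.
apply: ler_sum => i _; rewrite !mxE.
apply: (@le_trans _ _ ((a + b) `^ p * (t * `|a^-1 * x i ord0| + (1 - t) * `|b^-1 * y i ord0|) `^ p)).
  rewrite -powRM ?(ltW ab0)//; last by rewrite addr_ge0// mulr_ge0.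
  rewrite ge0_ler_powR ?nnegrE ?(ltW p0)//.
    by rewrite mulr_ge0 ?(ltW ab0)// addr_ge0// mulr_ge0.
  rewrite !normrM (gtr0_norm (x := a^-1)) ?invr_gt0// (gtr0_norm (x := b^-1)) ?invr_gt0// -tb /t.
  have -> : (a + b) * (a / (a + b) * (a^-1 * `|x i ord0|) + b / (a + b) * (b^-1 * `|y i ord0|))
      = `|x i ord0| + `|y i ord0| by field; rewrite !gt_eqF.
  exact: ler_normD.
by rewrite ler_wpM2l ?powR_ge0// convex_powR_real.
Qed.

Lemma lp_normD n (x y : 'cV[R]_n) : lpn (x + y) <= lpn x + lpn y.
Proof.
have [x0|x0] := eqVneq (lpn x) 0.
  have xE : x = 0 by apply: lp_norm_le0; rewrite x0.
  by rewrite xE add0r lp_norm0 add0r.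
have [y0|y0] := eqVneq (lpn y) 0.
  have yE : y = 0 by apply: lp_norm_le0; rewrite y0.
  by rewrite yE addr0 lp_norm0 addr0.
have xgt0 : 0 < lpn x by rewrite lt_neqAle eq_sym x0 lp_norm_ge0.
have ygt0 : 0 < lpn y by rewrite lt_neqAle eq_sym y0 lp_norm_ge0.
have h := lp_sumD xgt0 ygt0 (esym (lp_norm_powR x)) (esym (lp_norm_powR y)).
have s0 : 0 <= lpn x + lpn y by rewrite addr_ge0 ?lp_norm_ge0.
rewrite [leLHS]lp_normE; move: (lp_sum_ge0 (x + y)) h s0.
move: (lp_sum (x + y)) (lpn x + lpn y) => u v u0 uv v0.
have -> : v = (v `^ p) `^ p^-1 by rewrite -powRrM mulfV ?gt_eqF// powRr1.
by rewrite ge0_ler_powR ?invr_ge0 ?nnegrE ?powR_ge0 ?(ltW p0).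
Qed.

End lp_norm_theory.

(** * Averaging over the sketch and exact recovery *)

Section averaging.
Context d1 d2 (T1 : measurableType d1) (T2 : measurableType d2) (R : realType).
Variables (P : probability T1 R) (Q : probability T2 R).

Lemma measurable_slice1 (G : set (T1 * T2)) x :
  measurable G -> measurable [set y | G (x, y)].
Proof.
move=> mG; rewrite -[X in measurable X]setTI.
exact: (measurable_pair1 x measurableT mG).
Qed.

Lemma measurable_slice2 (G : set (T1 * T2)) y :
  measurable G -> measurable [set x | G (x, y)].
Proof.
move=> mG; rewrite -[X in measurable X]setTI.
exact: (measurable_pair2 y measurableT mG).
Qed.

Let ind (G : set (T1 * T2)) x y : \bar R := (\1_G (x, y))%:E.

Let ind0 (G : set (T1 * T2)) x y : (0 <= ind G x y)%E.
Proof. by rewrite lee_fin. Qed.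

Let mind (G : set (T1 * T2)) : measurable G ->
  measurable_fun setT (fun p : T1 * T2 => ind G p.1 p.2).
Proof.
move=> mG; apply/measurable_EFinP.
rewrite (_ : (fun _ => _) = (\1_G : T1 * T2 -> R)); first exact: measurable_indic.
by apply/funext => -[].
Qed.

Let slice1E (G : set (T1 * T2)) x : measurable G ->
  Q [set y | G (x, y)] = (\int[Q]_y ind G x y)%E.
Proof.
move=> mG; rewrite -[X in Q X]setIT -integral_indic//.
exact: measurable_slice1.
Qed.

Let slice2E (G : set (T1 * T2)) y : measurable G ->
  P [set x | G (x, y)] = (\int[P]_x ind G x y)%E.
Proof.
move=> mG; rewrite -[X in P X]setIT -integral_indic//.
exact: measurable_slice2.
Qed.

Lemma measurable_measure_slice1 (G : set (T1 * T2)) : measurable G ->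
  measurable_fun setT (fun x => Q [set y | G (x, y)]).
Proof.
move=> mG; rewrite (_ : (fun _ => _) = fun x => (\int[Q]_y ind G x y)%E); last first.
  by apply/funext => x; rewrite slice1E.
exact: (measurable_integral_curry Q (mind mG) (@ind0 G)).
Qed.

Lemma measurable_measure_slice2 (G : set (T1 * T2)) : measurable G ->
  measurable_fun setT (fun y => P [set x | G (x, y)]).
Proof.
move=> mG; rewrite (_ : (fun _ => _) = fun y => (\int[P]_x ind G x y)%E); last first.
  by apply/funext => y; rewrite slice2E.
exact: (@measurable_integral_curry _ _ _ _ _ P (fun y x => ind G x y)
  (measurableT_comp (mind mG) (@measurable_swap _ _ T2 T1)) (fun y x => ind0 G x y)).
Qed.

Lemma integral_slice_swap (G : set (T1 * T2)) : measurable G ->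
  (\int[P]_x Q [set y | G (x, y)] = \int[Q]_y P [set x | G (x, y)])%E.
Proof.
move=> mG; under eq_integral do rewrite slice1E//.
under [RHS]eq_integral do rewrite slice2E//.
exact: (tonelli_curry P Q (mind mG) (@ind0 G)).
Qed.

End averaging.

(** Averaging over the sketch and the input, exchanged by Tonelli, yields one sketch that is good
    for the average input. The gap [q' < q] lets mere monotonicity of the integral refute a failure
    of all sketches. *)
Lemma exists_good_sketch d1 d2 (T1 : measurableType d1) (T2 : measurableType d2)
    (R : realType) (P : probability T1 R) (Q : probability T2 R)
    (I : finType) (G : I -> set (T1 * T2)) (q q' : R) :
  (0 < #|I|)%N -> 0 <= q -> q' < q ->
  (forall i, measurable (G i)) ->
  (forall i w, (q%:E <= P [set S | G i (S, w)])%E) ->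
  exists S, ((#|I|%:R * q')%:E < \sum_i Q [set w | G i (S, w)])%E.
Proof.
move=> I0 q0 qq mG hG; apply: contrapT => /forallNP H.
have {}H S : (\sum_i Q [set w | G i (S, w)] <= (#|I|%:R * q')%:E)%E.
  by rewrite leNgt; apply/negP; exact: H.
have mQ i := measurable_measure_slice1 Q (mG i).
have : (\int[P]_S (\sum_i Q [set w | G i (S, w)]) <= (#|I|%:R * q')%:E)%E.
  rewrite -[leRHS](integral_prob_cst P); apply: ge0_le_integral => //.
  - by move=> S _; apply: sume_ge0.
  - exact: emeasurable_sum.
rewrite ge0_integral_sum//; apply/negP; rewrite -ltNge.
apply: (@lt_le_trans _ _ (\sum_(i : I) q%:E)%E).
  by rewrite sumEFin lte_fin sumr_const -[ltRHS]mulr_natl ltr_pM2l// ltr0n.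
apply: lee_sum => i _; rewrite integral_slice_swap//.
rewrite -[leLHS](integral_prob_cst Q); apply: ge0_le_integral => //.
exact: measurable_measure_slice2.
Qed.

Lemma sparse_opt_le (R : realType) (p : R) n d k (A : 'M[R]_(n, d)) (b : 'cV[R]_n) x :
  sparse R d k x -> sparse_opt p k A b <= lp_norm p (A *m x - b).
Proof.
move=> sx; apply: ge_inf; last by exists x.
by exists 0 => _ [y _ <-]; exact: powR_ge0.
Qed.

Lemma sketch_succeeds_le (R : realType) (p : R) n d k m eps
    (E : 'M[R]_(m, d) -> 'cV[R]_m -> 'cV[R]_d -> R) (S : 'M[R]_(m, n)) A b x0 :
  0 <= eps -> sketch_succeeds p k eps E S A b -> sparse R d k x0 ->
  forall x, argmin (sparse R d k) (E (S *m A) (S *m b)) x ->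
  lp_norm p (A *m x - b) <= (1 + eps) * lp_norm p (A *m x0 - b).
Proof.
move=> e0 [_ h] sx0 x /h /le_trans; apply.
by rewrite ler_wpM2l ?addr_ge0// sparse_opt_le.
Qed.

Lemma measurable_const_mulmx (R : realType) d (T : measurableType d) m n l
    (A : 'M[R]_(m, n)) (f : T -> borel_mx R n l) :
  measurable_fun setT f ->
  measurable_fun setT (fun x => A *m (f x : 'M[R]_(n, l)) : borel_mx R m l).
Proof. exact: (measurable_mulmx (measurable_cst (A : borel_mx R m n))). Qed.

(* With fewer than [r = min(n, k)] rows, [S] annihilates some [v <> 0] among the
   first [r] coordinates.  The optimum being [0], a success event of Gaussian
   measure above 1/2 is disjoint from its translate by [t v], although both
   measures agree in the limit [t -> 0]. *)
Lemma exact_recovery_bound (R : realType) (p q : R) n d k m (eps : R)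
    (P : probability (borel_mx R m n) R)
    (E : 'M[R]_(m, d) -> 'cV[R]_m -> 'cV[R]_d -> R) :
  1 <= p -> 2^-1 < q -> 0 <= eps -> (k <= d)%N ->
  oblivious_sketch p k eps q P E -> (minn n k <= m)%N.
Proof.
move=> p1 hq e0 kd [G [mG hG hP]]; rewrite leqNgt; apply/negP => mr.
set r := minn n k in mr *.
have rn : (r <= n)%N by rewrite geq_minl.
have rk : (r <= k)%N by rewrite geq_minr.
have rd : (r <= d)%N by rewrite (leq_trans rk).
pose A : 'M[R]_(n, d) := pid_mx r.
pose b (g : 'cV[R]_r) : 'cV[R]_n := pid_mx r *m g.
pose h (z : borel_mx R m n * borel_mx R r 1) :
    borel_mx R m n * (borel_mx R n d * borel_mx R n 1) := (z.1, (A, b z.2)).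
have mh : measurable_fun setT h.
  apply: measurable_fun_pair => //; apply: measurable_fun_pair => //.
  exact: measurable_const_mulmx.
have mG' : measurable (h @^-1` G).
  by rewrite -[X in measurable X]setTI; exact: mh.
have q0 : 0 <= q by rewrite (le_trans _ (ltW hq))// invr_ge0.
have qq : (2^-1 + q) / 2 < q by lra.
have I1 : (0 < #|'I_1|)%N by rewrite card_ord.
have [S] := @exists_good_sketch _ _ _ _ R P (gauss R r) 'I_1 (fun=> h @^-1` G)
  q ((2^-1 + q) / 2) I1 q0 qq (fun=> mG') (fun _ w => hP A (b w)).
rewrite card_ord mul1r big_ord1 => hS.
set B : set 'cV[R]_r := [set w | (h @^-1` G) (S, w)] in hS.
have mB : measurable (B : set (borel_mx R r 1)) by exact: measurable_slice1.
have [v v0 Sv] : exists2 v : 'cV[R]_r, v != 0 & S *m (pid_mx r *m v) = 0.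
  pose M := (S *m (pid_mx r : 'M[R]_(n, r)))^T.
  have kM : kermx M != 0.
    rewrite kermx_eq0 -row_leq_rank -ltnNge.
    exact: leq_ltn_trans (rank_leq_col M) mr.
  exists (nz_row (kermx M))^T; first by rewrite -trmx0 (inj_eq trmx_inj) nz_row_eq0.
  rewrite mulmxA -[X in X *m _]trmxK -trmx_mul.
  by rewrite (sub_kermxP (nz_row_sub _)) trmx0.
(* Inputs that differ by a multiple of the annihilated direction have the same sketch, hence the
   same minimizers, and a single [x] would solve two distinct systems exactly. *)
have disj t g : t != 0 -> B g -> B (g + t *: v) -> False.
  move=> t0 Bg Bgv.
  have := hG _ _ _ Bg; have := hG _ _ _ Bgv => /= s2 s1.
  have Sb : S *m b (g + t *: v) = S *m b g.
    by rewrite /b mulmxDr -scalemxAr mulmxDr -[X in _ + X]scalemxAr Sv scaler0 addr0.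
  have rec g' : sketch_succeeds p k eps E S A (b g') -> forall x,
      argmin (sparse R d k) (E (S *m A) (S *m b g')) x -> A *m x = b g'.
    move=> sg x ax; apply/eqP; rewrite -subr_eq0; apply/eqP.
    apply: (lp_norm_le0 p1).
    pose x0 : 'cV[R]_d := pid_mx r *m g'.
    have -> : 0 = (1 + eps) * lp_norm p (A *m x0 - b g').
      rewrite mulmxA mul_pid_mx minnn (minn_idPr rd) subrr.
      by rewrite lp_norm0// mulr0.
    apply: (sketch_succeeds_le e0 sg) => //.
    rewrite /sparse /= /l0_norm (leq_trans _ rk)//.
    apply: (@leq_trans #|[seq widen_ord rd j | j : 'I_r]|); last first.
      by rewrite (leq_trans (leq_image_card _ _))// card_ord.
    apply: subset_leq_card; apply/fintype.subsetP => i; rewrite inE => xi.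
    have ir : (i < r)%N.
      rewrite ltnNge; apply: contra xi => ri; rewrite mxE big1// => j _.
      by rewrite mxE ltnNge ri andbF mul0r.
    by apply/codomP; exists (Ordinal ir); apply: val_inj.
  have [x ax] : argmin (sparse R d k) (E (S *m A) (S *m b g)) !=set0 by exact: s1.1.
  have E1 := rec _ s1 _ ax.
  have E2 : A *m x = b (g + t *: v) by apply: rec => //; rewrite Sb.
  have bv : (pid_mx r : 'M[R]_(n, r)) *m v = 0.
    apply: (scalerI t0); rewrite scaler0 scalemxAr.
    by apply: (addrI (b g)); rewrite addr0 -mulmxDr -/(b _) -E2 E1.
  move/eqP: v0; apply.
  have pid1 : (pid_mx r : 'M[R]_(r, n)) *m (pid_mx r : 'M[R]_(n, r)) = 1%:M.
    by rewrite mul_pid_mx minnn (minn_idPr rn) pid_mx_1.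
  by rewrite -[v]mul1mx -pid1 -mulmxA bv mulmx0.
pose ka := q - 2^-1; have ka0 : 0 < ka by rewrite subr_gt0.
have vv : 0 < dot v v.
  rewrite lt_neqAle dot_ge0 andbT; apply/eqP => /esym /eqP.
  rewrite psumr_eq0 => [/allP vi|i _]; last by rewrite -expr2 sqr_ge0.
  move/eqP: v0; apply; apply/matrixP => i j; rewrite (ord1 j) mxE.
  by have := vi i (mem_index_enum i); rewrite -expr2 sqrf_eq0 => /eqP.
have l0 : 0 < ln (1 + ka ^+ 2) by rewrite ln_gt0// ltrDl exprn_gt0.
(* This [t] makes [exp |t v|^2 - 1] equal to [ka^2]. With [la = ka], the translation bound reads
   [x <= (1 + ka / 2) y + ka / 2] for the measures [x] of [B] and [y] of [B'], against [x + y <= 1]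
   and [x > 1/2 + ka / 2]. *)
pose t := Num.sqrt (ln (1 + ka ^+ 2) / dot v v).
have t0 : 0 < t by rewrite sqrtr_gt0 divr_gt0.
have tvv : dot (t *: v) (t *: v) = ln (1 + ka ^+ 2).
  rewrite dotZl dotC dotZl mulrA -expr2 sqr_sqrtr ?divr_ge0 ?ltW//.
  by rewrite divfK// gt_eqF.
pose B' : set 'cV[R]_r := [set g | B (g - t *: v)].
have mB' : measurable (B' : set (borel_mx R r 1)).
  rewrite -[X in measurable X]setTI.
  by apply: (measurable_addmx (f := id) (g := cst (- (t *: v)))).
have := @gauss_shift_le R r (t *: v) B' ka ka0 mB'.
have -> : [set x | B' (x + t *: v)] = B.
  by apply/seteqP; split => g; rewrite /B' /= addrK.
have BB' : (gauss R r B + gauss R r B' <= 1)%E.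
  rewrite -measureU//; first exact: probability_le1 (measurableU _ _ mB mB').
  apply/seteqP; split => // g [Bg B'g].
  apply: (disj (- t) g); rewrite ?oppr_eq0 ?gt_eqF//.
  by rewrite scaleNr.
rewrite tvv lnK ?posrE ?addr_gt0// ?exprn_gt0//.
have fB := fin_num_measure (gauss R r) _ mB.
have fB' := fin_num_measure (gauss R r) _ mB'.
move: BB' hS; rewrite -(fineK fB) -(fineK fB').
move: (fine _) (fine _) => x y.
rewrite -EFinD -EFinM -EFinD !lee_fin lte_fin => xy xq.
have -> : (1 + ka ^+ 2 - 1) / (2 * ka) = ka / 2 by field; rewrite gt_eqF.
move=> h2; have qka : q = ka + 2^-1 by rewrite /ka subrK.
rewrite qka in xq; nra.
Qed.

(** * The hard instance *)

Section layout.
Context (R : realType) (d k l s : nat).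
Hypotheses (s0 : (0 < s)%N) (l0 : (0 < l)%N) (lk : (l <= k)%N)
  (hd : (s * l + (k - l) <= d)%N).
Implicit Types I J : {ffun 'I_l -> 'I_s}.

(* The columns below [s * l] form [l] blocks of size [s]; the next [k - l]
   columns are blocks of size one, and the remaining columns, whose block number
   is at least [k], vanish. *)
Definition block (i : nat) : nat := if (i < s * l)%N then (i %/ s)%N else (i - s * l + l)%N.

Lemma block_col_subproof (j : 'I_l) (a : 'I_s) : (j * s + a < d)%N.
Proof.
apply: leq_trans hd; rewrite ltn_addr// (@leq_trans (j.+1 * s))//.
  by rewrite mulSn addnC ltn_add2r.
by rewrite mulnC leq_mul2l ltn_ord orbT.
Qed.

Definition block_col (j : 'I_l) (a : 'I_s) : 'I_d := Ordinal (block_col_subproof j a).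

Lemma block_col_lt j a : (block_col j a < s * l)%N.
Proof.
apply: (@leq_trans (j.+1 * s)); last by rewrite mulnC leq_mul2l ltn_ord orbT.
by rewrite /= mulSn addnC ltn_add2r.
Qed.

Lemma block_colK j a : (block_col j a %/ s)%N = j.
Proof. by rewrite /= divnMDl// divn_small// addn0. Qed.

Lemma block_col_mod j a : (block_col j a %% s)%N = a.
Proof. by rewrite /= modnMDl modn_small. Qed.

Lemma block_col_eq j a j' a' :
  (block_col j a == block_col j' a') = (j == j') && (a == a').
Proof.
apply/eqP/andP => [h|[/eqP-> /eqP->]//]; split; apply/eqP/val_inj => /=.
  by rewrite -(block_colK j a) h block_colK.
by rewrite -(block_col_mod j a) h block_col_mod.
Qed.

(** A unit vector, so that [W *m word_vec I] is standard Gaussian for a Gaussian [W]. *)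
Definition word_vec I : 'cV[R]_d :=
  (Num.sqrt l%:R)^-1 *: \sum_j delta_mx (block_col j (I j)) ord0.

(** Keeps the columns of the letters only, on the scale of [word_vec]: the 0/1 vector that selects
    the letters of [I] is mapped to [word_vec I]. The padding columns carry no signal and matter
    only for [pin_mx]. *)
Definition col_mask : 'M[R]_d :=
  diag_mx (\row_i (if (i < s * l)%N then (Num.sqrt l%:R)^-1 else 0)).

Lemma col_maskE (x : 'cV[R]_d) i : (col_mask *m x) i ord0 =
  if (i < s * l)%N then (Num.sqrt l%:R)^-1 * x i ord0 else 0.
Proof. by rewrite mul_diag_mx !mxE; case: ifP => _; rewrite ?mul0r. Qed.

Lemma word_vecE I i : word_vec I i ord0 =
  (Num.sqrt l%:R)^-1 * \sum_j (i == block_col j (I j))%:R.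
Proof.
rewrite mxE summxE; congr (_ * _); apply: eq_bigr => j _.
by rewrite mxE eqxx andbT.
Qed.

Lemma dot_word_vec I J : dot (word_vec I) (word_vec J) = (agree I J)%:R / l%:R.
Proof.
have pick c (F : 'I_d -> R) : \sum_i (i == c)%:R * F i = F c.
  rewrite (bigD1 c)//= eqxx mul1r big1 ?addr0// => i /negbTE ->.
  by rewrite mul0r.
have sq : (Num.sqrt l%:R)^-1 ^+ 2 = l%:R^-1 :> R.
  by rewrite exprVn sqr_sqrtr ?ler0n.
rewrite /dot; under eq_bigr do rewrite !word_vecE mulrACA -expr2 sq.
rewrite -mulr_sumr mulrC; congr (_ / _); rewrite agreeE natr_sum.
under [LHS]eq_bigr do rewrite mulr_suml.
rewrite exchange_big /=; apply: eq_bigr => j _; rewrite pick.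
rewrite (bigD1 j)//= block_col_eq eqxx /= big1 ?addr0// => j' /negbTE.
by rewrite block_col_eq eq_sym => ->.
Qed.

Lemma dot_residual I J (h : R) :
  dot (h *: word_vec I - word_vec J) (h *: word_vec I - word_vec J) =
  h ^+ 2 + 1 - 2 * h * ((agree I J)%:R / l%:R).
Proof.
have dotB n (u v : 'cV[R]_n) : dot (h *: u - v) (h *: u - v) =
    h ^+ 2 * dot u u + dot v v - 2 * h * dot u v.
  rewrite /dot !mulr_sumr -big_split -sumrB /=.
  by apply: eq_bigr => i _; rewrite !mxE; ring.
have one K : dot (word_vec K) (word_vec K) = 1.
  rewrite dot_word_vec /agree (_ : finset _ = finset.setT) ?cardsT ?card_ord ?divff//.
    by rewrite pnatr_eq0 -lt0n.
  by apply/finset.setP => j; rewrite !inE eqxx.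
by rewrite dotB !one dot_word_vec mulr1.
Qed.

(** Against the right-hand side [const_mx M], row [j] charges [M] times the deviation from 1 of the
    sum of [x] over block [j]. *)
Definition pin_mx (M : R) : 'M[R]_(k, d) := \matrix_(j, i) (if block i == j then M else 0).

Lemma pin_mxE M (x : 'cV[R]_d) j :
  (pin_mx M *m x) j ord0 = M * \sum_(i < d | block i == j) x i ord0.
Proof.
rewrite mxE mulr_sumr [RHS]big_mkcond; apply: eq_bigr => i _; rewrite mxE.
by case: ifP => _; rewrite ?mul0r.
Qed.

(* One nonzero per block exhausts the sparsity budget. *)
Lemma decode_block (x : 'cV[R]_d) (be : R) : sparse R d k x -> be < 1 ->
  (forall j : 'I_k, `|\sum_(i < d | block i == j) x i ord0 - 1| <= be) ->
  exists J, forall i, `|(col_mask *m x - word_vec J) i ord0| <= be.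
Proof.
rewrite /sparse /= /l0_norm => sx be1 H.
have be0 : 0 <= be.
  by apply: (le_trans _ (H (Ordinal (leq_trans l0 lk)))).
(* A block sum within [be < 1] of 1 cannot be zero. *)
have ex (j : 'I_k) : exists i : 'I_d, (block i == j) && (x i ord0 != 0).
  apply/existsP; apply: contraT; rewrite negb_exists => /forallP h.
  have := H j; rewrite big1 => [|i bi].
    by rewrite sub0r normrN1 leNgt be1.
  by have := h i; rewrite bi /= negbK => /eqP.
pose sel j := xchoose (ex j).
have selb j : block (sel j) = j by have /andP[/eqP ->] := xchooseP (ex j).
have selx j : x (sel j) ord0 != 0 by have /andP[] := xchooseP (ex j).
have sel_inj : injective sel by move=> j j' e; apply: val_inj; rewrite /= -selb e selb.
have supp i : x i ord0 != 0 -> exists j, i = sel j.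
  move=> xi; have sub : codom sel \subset [pred i | x i ord0 != 0].
    by apply/fintype.subsetP => _ /codomP[j ->]; rewrite inE.
  have : codom sel =i [pred i | x i ord0 != 0].
    by apply/subset_cardP => //; apply/eqP; rewrite eqn_leq subset_leq_card// card_codom// card_ord.
  by move=> /(_ i); rewrite [RHS]inE xi => /codomP.
have sumE (j : 'I_k) : \sum_(i < d | block i == j) x i ord0 = x (sel j) ord0.
  rewrite (bigD1 (sel j)) /=; last by rewrite selb.
  rewrite big1 ?addr0// => i /andP[/eqP bi ij]; apply/eqP; apply: contraNT ij => xi.
  have [j' ij'] := supp _ xi; rewrite ij'; apply/eqP; congr sel.
  by apply: val_inj; rewrite /= -bi ij' selb.
pose w := widen_ord lk.
exists [ffun j : 'I_l => Ordinal (ltn_pmod (sel (w j)) s0)] => i.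
rewrite mxE [X in _ + X]mxE col_maskE [X in _ - X]word_vecE.
have sel_lt (j : 'I_l) : (sel (w j) < s * l)%N.
  rewrite ltnNge; apply/negP => h; have := selb (w j).
  by rewrite /block ltnNge h /=; have := ltn_ord j; lia.
have colE (j : 'I_l) : block_col j (Ordinal (ltn_pmod (sel (w j)) s0)) = sel (w j).
  apply: val_inj => /=; have := selb (w j); rewrite /block sel_lt /= => e.
  by rewrite [RHS](divn_eq _ s) e.
under eq_bigr do rewrite ffunE colE.
have [il|il] := ifPn; last first.
  rewrite big1 ?mulr0 ?subr0 ?normr0// => j _.
  by case: eqP => // e; move: il; rewrite e sel_lt.
have ill : (i %/ s < l)%N by rewrite ltn_divLR// mulnC.
pose j0 : 'I_l := Ordinal ill.
have -> : \sum_(j < l) (i == sel (w j))%:R = (i == sel (w j0))%:R :> R.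
  rewrite (bigD1 j0)//= big1 ?addr0// => j jj0.
  case: eqP => // e; exfalso; move/negP: jj0; apply; apply/eqP/val_inj => /=.
  by have := selb (w j); rewrite -e /block il.
rewrite -mulrBr normrM.
have c1 : `|(Num.sqrt l%:R)^-1| <= 1 :> R.
  rewrite ger0_norm ?invr_ge0 ?sqrtr_ge0// invf_le1 ?sqrtr_gt0 ?ltr0n//.
  by rewrite -[leLHS]sqrtr1 ler_wsqrtr// ler1n.
have xb : `|x i ord0 - (i == sel (w j0))%:R| <= be.
  have [e|ne] := eqVneq i (sel (w j0)).
    by rewrite e -sumE; exact: H.
  have [->|xi] := eqVneq (x i ord0) 0; first by rewrite subrr normr0.
  have [j ij] := supp _ xi; exfalso; move/negP: ne; apply; rewrite ij.
  apply/eqP; congr sel; apply: val_inj => /=.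
  by have := selb j; rewrite -ij /block il.
by rewrite -[leRHS]mul1r ler_pM.
Qed.

End layout.

(** * Encoding words and decoding approximate solutions *)

Section decoding.
Context (R : realType) (p : R) (n d k l s : nat).
Hypotheses (p1 : 1 <= p) (s0 : (0 < s)%N) (l0 : (0 < l)%N) (lk : (l <= k)%N)
  (hd : (s * l + (k - l) <= d)%N).
Implicit Types I J : {ffun 'I_l -> 'I_s}.
Local Notation word_vec := (word_vec R hd).
Local Notation col_mask := (col_mask R d l s).
Local Notation pin_mx := (pin_mx d k l s).

(** The 0/1 vector selecting the letters of [I] and the only column of each padding block. It
    satisfies the pinning rows exactly, so it competes with a residual that does not involve [M]. *)
Lemma encode_word I : exists x : 'cV[R]_d,
  [/\ sparse R d k x, forall M, pin_mx M *m x = const_mx M & col_mask *m x = word_vec I].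
Proof.
have /choice[sel selP] (j : 'I_k) : exists i : 'I_d, block l s i = j /\
    forall j' : 'I_l, j' = j :> nat -> i = block_col hd j' (I j').
  have [jl|jl] := ltnP j l.
    pose j0 : 'I_l := Ordinal jl; exists (block_col hd j0 (I j0)); split.
      by rewrite /block block_col_lt block_colK.
    by move=> j' e; have -> : j' = j0 by exact: val_inj.
  have id : (s * l + (j - l) < d)%N.
    by apply: leq_trans hd; rewrite ltn_add2l ltn_sub2r// (leq_ltn_trans jl).
  exists (Ordinal id); split => [|j' e].
    by rewrite /block /= ltnNge leq_addr /= addKn subnK.
  by have := ltn_ord j'; rewrite e ltnNge jl.
have selb j : block l s (sel j) = j by exact: (selP j).1.
have selc (j : 'I_l) : sel (widen_ord lk j) = block_col hd j (I j) by exact: (selP _).2.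
exists (\sum_j delta_mx (sel j) ord0).
have xE i : (\sum_j delta_mx (sel j) ord0 : 'cV[R]_d) i ord0 = \sum_j (i == sel j)%:R.
  by rewrite summxE; apply: eq_bigr => j _; rewrite mxE eqxx andbT.
have pick (i : 'I_d) (j0 : 'I_k) : block l s i = j0 ->
    \sum_j (i == sel j)%:R = (i == sel j0)%:R :> R.
  move=> bi; rewrite (bigD1 j0)//= big1 ?addr0// => j jj0.
  case: eqP => // e; exfalso; move/negP: jj0; apply; apply/eqP/val_inj => /=.
  by rewrite -bi e selb.
split.
- rewrite /sparse /= /l0_norm -[leqRHS]card_ord.
  apply: leq_trans (leq_image_card sel _); apply: subset_leq_card.
  apply/fintype.subsetP => i; rewrite inE xE => xi.
  apply/negP => ni; move/negP: xi; apply; rewrite big1// => j _.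
  by case: eqP => // e; exfalso; apply: ni; rewrite e; apply/codomP; exists j.
- move=> M; apply/matrixP => j j'; rewrite (ord1 j') pin_mxE mxE.
  rewrite (bigD1 (sel j)) /= ?selb// xE (pick _ j)// eqxx big1 ?addr0 ?mulr1//.
  by move=> i /andP[/eqP bi ij]; rewrite xE (pick _ j)// (negbTE ij).
- apply/matrixP => i j'; rewrite (ord1 j') col_maskE word_vecE xE.
  have [il|il] := ifPn; last first.
    rewrite big1 ?mulr0// => j _; case: eqP => // e.
    by move: il; rewrite e block_col_lt.
  have ill : (i %/ s < l)%N by rewrite ltn_divLR// mulnC.
  pose j0 : 'I_l := Ordinal ill.
  rewrite (pick i (widen_ord lk j0)); last by rewrite /block il.
  congr (_ * _); rewrite (bigD1 j0)//= selc big1 ?addr0// => j jj0.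
  case: eqP => // e; exfalso; move/negP: jj0; apply; apply/eqP/val_inj => /=.
  by rewrite {1}e block_colK.
Qed.

Definition hard_mx M (W : 'M[R]_(n, d)) : 'M[R]_(k + n, d) :=
  col_mx (pin_mx M) (W *m col_mask).

Definition hard_vec M tau h (W : 'M[R]_(n, d)) (g : 'cV[R]_n) I : 'cV[R]_(k + n) :=
  col_mx (const_mx M) (tau *: g + h *: (W *m word_vec I)).

(** Lower part of [b - A x] at the encoding of the word [J]. The coefficients of [W] are gathered
    into one vector, whose norm gives the variance through [dot_residual]. *)
Definition residual tau h (W : 'M[R]_(n, d)) (g : 'cV[R]_n) I J : 'cV[R]_n :=
  tau *: g + W *m (h *: word_vec I - word_vec J).

Lemma hard_residual M tau h W g I x :
  hard_mx M W *m x - hard_vec M tau h W g I =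
  col_mx (pin_mx M *m x - const_mx M)
    (W *m (col_mask *m x) - (tau *: g + h *: (W *m word_vec I))).
Proof. by rewrite mul_col_mx -mulmxA opp_col_mx add_col_mx. Qed.

Variables (M tau h e U K : R) (W : 'M[R]_(n, d)) (g : 'cV[R]_n).
Variable I : {ffun 'I_l -> 'I_s}.
Hypotheses (e0 : 0 <= e <= 1) (U0 : 0 < U) (M0 : 2 * U < M) (K0 : 0 <= K).
Hypothesis MK : n%:R * (K * (2 * U / M)) <= e / 20 * U.
Hypothesis WK : forall t, \sum_i `|W t i| <= K.
Hypothesis resU : lp_norm p (residual tau h W g I I) <= U.

Variable x : 'cV[R]_d.
Hypothesis sx : sparse R d k x.
Hypothesis xle : forall x0, sparse R d k x0 ->
  lp_norm p (hard_mx M W *m x - hard_vec M tau h W g I) <=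
  (1 + e) * lp_norm p (hard_mx M W *m x0 - hard_vec M tau h W g I).

Let xU : lp_norm p (hard_mx M W *m x - hard_vec M tau h W g I) <= (1 + e) * U.
Proof.
have [x0 [sx0 px0 mx0]] := encode_word I.
apply: (le_trans (xle sx0)); rewrite ler_wpM2l//; first by case/andP: e0; lra.
rewrite hard_residual px0 (subrr (const_mx M)) (lp_norm_col_mx0 p1) mx0.
have -> : W *m word_vec I - (tau *: g + h *: (W *m word_vec I)) =
    -1 *: residual tau h W g I I.
  rewrite /residual mulmxBr -(scalemxAr h W); move: (W *m word_vec I) (tau *: g) => a b.
  by rewrite scaleN1r addrA opprB.
by rewrite lp_normZ// normrN1 mul1r.
Qed.

(** Comparison with the planted word bounds the whole residual by [(1 + e) U <= 2 U], and each
    pinning row contributes an entry [M |sum - 1|] to it. *)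
Lemma hard_decode : exists J, forall i, `|(col_mask *m x - word_vec J) i ord0| <= 2 * U / M.
Proof.
have Mp : 0 < M by move: M0 U0; lra.
apply: (decode_block s0 l0 lk hd sx); first by rewrite ltr_pdivrMr ?mul1r.
move=> j; rewrite ler_pdivlMr//.
apply: (@le_trans _ _ ((1 + e) * U)); last first.
  by rewrite ler_wpM2r ?(ltW U0)//; case/andP: e0; lra.
apply: le_trans xU.
apply: le_trans (lp_norm_entry p1 _ (lshift n j)).
rewrite hard_residual col_mxEu.
have -> : (pin_mx M *m x - const_mx M) j ord0 =
    M * (\sum_(i < d | block l s i == j) x i ord0 - 1).
  by rewrite mxE pin_mxE mulrBr mulr1; congr (_ + _); rewrite !mxE.
by rewrite normrM gtr0_norm// mulrC.
Qed.

(** Replacing [x] by the encoding of [J] changes the residual by [W] times a vector with entries at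
    most [2 U / M], of norm at most [e U / 20] by [MK]; the result is too small for a word outside
    the ball. [J] is an argument because the same one must serve every word compatible with [x]. *)
Lemma hard_decode_agree J :
  (forall i, `|(col_mask *m x - word_vec J) i ord0| <= 2 * U / M) ->
  (forall J, I \notin agree_ball J ->
    (1 + e) * (1 + e / 20) * U < lp_norm p (residual tau h W g I J)) ->
  I \in agree_ball J.
Proof.
have Mp : 0 < M by move: M0 U0; lra.
have be0 : 0 <= 2 * U / M by rewrite divr_ge0 ?mulr_ge0 ?ltW.
move=> cl far; apply: contraT => /far; rewrite ltNge => /negP; case.
have -> : residual tau h W g I J = -1 *: (W *m (col_mask *m x) - (tau *: g + h *: (W *m word_vec I)))
    + W *m (col_mask *m x - word_vec J).
  rewrite /residual !mulmxBr -(scalemxAr h W (word_vec I)).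
  move: (W *m word_vec I) (tau *: g) (W *m (col_mask *m x)) (W *m word_vec J) => a b c v.
  by rewrite scaleN1r opprB [RHS]addrA subrK addrA.
apply: (le_trans (lp_normD p1 _ _)); rewrite lp_normZ// normrN1 mul1r.
apply: (@le_trans _ _ ((1 + e) * U + e / 20 * U)).
  apply: lerD.
    by apply: le_trans xU; rewrite hard_residual; exact: lp_norm_col_mxd.
  apply: le_trans MK; apply: lp_norm_le_entry => //; first by rewrite mulr_ge0.
  move=> t; rewrite mxE; apply: (le_trans (ler_norm_sum _ _ _)).
  apply: (@le_trans _ _ (\sum_i `|W t i| * (2 * U / M))).
    by apply: ler_sum => i _; rewrite normrM ler_wpM2l// cl.
  by rewrite -mulr_suml ler_wpM2r.
rewrite -mulrDl ler_wpM2r ?(ltW U0)//; case/andP: e0; nra.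
Qed.

End decoding.

(** * Testing Gaussian shifts *)

Section testing.
Context (R : realType).
Local Notation V n := (borel_mx R n 1).

(** A list-decoding analogue of Fano's inequality. After [gauss_shift_le] the sets are measured
    under one law, and the sum of their measures is the mean number of sets that contain [x], at
    most [L]. *)
Lemma gauss_testing n (T : finType) (w : T -> 'cV[R]_n) (B : T -> set 'cV[R]_n)
    (De la : R) (L : nat) :
  0 < la -> (forall I, measurable (B I : set (V n))) ->
  (forall I, dot (w I) (w I) <= De) ->
  (forall x, (#|[pred I | `[< B I x >]]| <= L)%N) ->
  (\sum_I gauss R n [set x | B I (x + w I)%R] <=
   ((1 + la / 2) * L%:R + #|T|%:R * ((expR De - 1) / (2 * la)))%:E)%E.
Proof.
move=> la0 mB hw hL.
apply: (@le_trans _ _ (\sum_I ((1 + la / 2)%:E * gauss R n (B I) +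
   ((expR De - 1) / (2 * la))%:E))%E).
  apply: lee_sum => I _; apply: (le_trans (gauss_shift_le (w I) la0 (mB I))).
  rewrite leeD2l// lee_fin ler_wpM2r ?invr_ge0 ?mulr_ge0 ?(ltW la0)//.
  by rewrite lerD2r ler_expR.
rewrite big_split /= sumEFin sumr_const -[_ *+ #|T|]mulr_natl [leRHS]EFinD.
rewrite -ge0_sume_distrr//.
rewrite leeD2r// EFinM lee_wpmul2l//; first by rewrite lee_fin addr_ge0// divr_ge0// ltW.
have mI I : measurable_fun (setT : set (V n)) (fun x => (\1_(B I) x : R)%:E).
  by apply/measurable_EFinP; exact: measurable_indic.
have -> : (\sum_I gauss R n (B I) = \int[gauss R n]_x (\sum_I (\1_(B I) x)%:E))%E.
  rewrite ge0_integral_sum//.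
  by apply: eq_bigr => I _; rewrite integral_indic// setIT.
rewrite -[leRHS](integral_prob_cst (gauss R n)); apply: ge0_le_integral => //.
- by move=> x _; apply: sume_ge0 => I _; rewrite lee_fin.
- exact: emeasurable_sum.
move=> x _; rewrite sumEFin lee_fin.
apply: le_trans (_ : #|[pred I | `[< B I x >]]|%:R <= _); last by rewrite ler_nat.
rewrite -sum1_card natr_sum [leRHS]big_mkcond /=; apply: ler_sum => I _.
rewrite indicE inE; case: ifP => [|/asboolP h]; first by case: (_ \in _).
by rewrite memNset.
Qed.

End testing.

Lemma product_measure_slice d1 d2 (T1 : measurableType d1) (T2 : measurableType d2)
    (R : realType) (P : probability T1 R) (Q : probability T2 R) (A : set (T1 * T2)) :
  measurable A -> ((P \x Q) A = \int[P]_x Q [set y | A (x, y)])%E.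
Proof.
move=> mA; rewrite -[A in LHS]setIT -[LHS]integral_indic//.
rewrite (@fubini_tonelli1 _ _ _ _ _ P Q (fun z => (\1_A z)%:E))//; last first.
  by apply/measurable_EFinP; exact: measurable_indic.
apply: eq_integral => x _; rewrite /fubini_F -[X in Q X]setIT -integral_indic//.
exact: measurable_slice1.
Qed.

(** Continuity from above along the events [f >= n + 1], whose intersection is empty. No explicit
    [K] is required, since [M] adapts to it. *)
Lemma tail_exists d (T : measurableType d) (R : realType) (P : probability T R)
    (f : T -> R) (de : R) : measurable_fun setT f -> 0 < de ->
  exists2 K, 0 < K & (P [set x | (K <= f x)%R] <= de%:E)%E.
Proof.
move=> mf de0.
pose F (n : nat) := [set x | n.+1%:R <= f x].
have mF n : measurable (F n).
  rewrite /F -[X in measurable X]setTI.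
  by apply: (measurable_fun_ler (f := cst n.+1%:R) (g := f)).
have cv : P (F n) @[n --> \oo] --> P (\bigcap_n F n).
  apply: nonincreasing_cvg_mu => //.
  - by rewrite ltey_eq fin_num_measure.
  - exact: bigcap_measurable.
  - move=> a b ab; apply/subsetPset => x /=; apply: le_trans.
    by rewrite ler_nat.
have F0 : \bigcap_n F n = set0.
  apply/seteqP; split => // x /= h.
  have := h (Num.truncn `|f x|) I; rewrite /F /= leNgt => /negP; apply.
  apply: le_lt_trans (ler_norm _) _; exact: truncnS_gt.
rewrite F0 measure0 in cv.
move/fine_cvgP : cv => [_ /cvgr_lt /(_ _ de0)].
case=> n _ /(_ n (leqnn n)) h; exists n.+1%:R; first by rewrite ltr0n.
by rewrite -[leLHS](fineK (fin_num_measure P _ (mF n))) lee_fin ltW.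
Qed.

(** * The law of the residuals *)

Section residual_law.
Context (R : realType) (n d k l s : nat) (s0 : (0 < s)%N)
  (hd : (s * l + (k - l) <= d)%N).
Implicit Types I J : {ffun 'I_l -> 'I_s}.
Local Notation V n := (borel_mx R n 1).
Local Notation residual := (residual (R := R) hd).

(** Common standard deviation of the entries of the residual: [tau^2] from the noise and the rest,
    by [dot_residual], from the Gaussian matrix. *)
Definition residual_std (tau h : R) I J : R :=
  Num.sqrt (tau ^+ 2 + (h ^+ 2 + 1 - 2 * h * ((agree I J)%:R / l%:R))).

Lemma measurable_residual tau h I J :
  measurable_fun setT (fun w : borel_mx R n d * V n =>
    residual tau h w.1 w.2 I J : V n).
Proof.
apply: measurable_addmx; first exact: measurable_scalemx.
exact: (measurable_mulmx measurable_fst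
  (measurable_cst (h *: word_vec R hd I - word_vec R hd J : borel_mx R d 1))).
Qed.

Lemma residual_law tau h I J (B : set 'cV[R]_n) : (0 < l)%N ->
  measurable (B : set (V n)) ->
  ((gaussmx R n d \x gauss R n) [set w | B (residual tau h w.1 w.2 I J)] =
   gauss R n [set x | B (residual_std tau h I J *: x)%R])%E.
Proof.
move=> l0 mB.
have mA : measurable [set w : borel_mx R n d * V n | B (residual tau h w.1 w.2 I J)].
  rewrite -[X in measurable X]setTI.
  exact: (measurable_residual tau h I J).
rewrite product_measure_slice//.
have mI : measurable_fun (setT : set (V n)) (fun x => (\1_B x : R)%:E).
  by apply/measurable_EFinP; exact: measurable_indic.
have I0 x : (0 <= (\1_B x : R)%:E)%E by rewrite lee_fin.
have law := @gauss_affine_law R n d tau (h *: word_vec R hd I - word_vec R hd J)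
  (fun x => (\1_B x)%:E) mI I0.
rewrite dot_residual// in law.
have mC : measurable ([set x | B (residual_std tau h I J *: x)%R] : set (V n)).
  have ms : measurable_fun (setT : set (V n))
      (fun x : V n => residual_std tau h I J *: (x : 'M[R]_(n, 1)) : V n).
    exact: measurable_scalemx.
  by rewrite -[X in measurable X]setTI; exact: ms.
transitivity (\int[gaussmx R n d]_W \int[gauss R n]_g
  (\1_B (tau *: g + W *m (h *: word_vec R hd I - word_vec R hd J))%R)%:E)%E.
  apply: eq_integral => W _; rewrite -[X in gauss R n X]setIT -integral_indic//.
  exact: (measurable_slice1 W mA).
by rewrite law -[X in gauss R n X]setIT -integral_indic.
Qed.

Variables (p m1 m2 : R).
Hypotheses (p1 : 1 <= p) (m10 : 0 < m1) (m20 : 0 < m2).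
Hypothesis E1 : (\int[normal_prob 0 1]_x (`|x| `^ p)%:E = m1%:E)%E.
Hypothesis E2 : (\int[normal_prob 0 1]_x ((`|x| `^ p) ^+ 2)%:E = m2%:E)%E.

Let mp : measurable_fun setT (fun x : R => `|x| `^ p).
Proof. exact: (measurableT_comp (measurable_powR p)). Qed.

Let pos (x : R) : 0 <= `|x| `^ p :> R. Proof. exact: powR_ge0. Qed.

Lemma measurable_lp_sum : measurable_fun (setT : set (V n)) (lp_sum p (n := n)).
Proof. exact: (measurable_csum mp (n := n)). Qed.

Lemma measurable_lp_ge a : measurable ([set x | a <= lp_sum p x] : set (V n)).
Proof.
rewrite -[X in measurable X]setTI.
exact: (measurable_fun_ler (measurable_cst a) measurable_lp_sum).
Qed.

Lemma measurable_lp_le a : measurable ([set x | lp_sum p x <= a] : set (V n)).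
Proof.
rewrite -[X in measurable X]setTI.
exact: (measurable_fun_ler measurable_lp_sum (measurable_cst a)).
Qed.

Lemma residual_upper_tail tau h I J eta : (0 < n)%N -> (0 < l)%N ->
  0 < eta -> 0 < residual_std tau h I J ->
  ((gaussmx R n d \x gauss R n) [set w |
      (residual_std tau h I J `^ p * (n%:R * m1 * (1 + eta)) <=
       lp_sum p (residual tau h w.1 w.2 I J))%R] <=
   (m2 / (n%:R * m1 ^+ 2 * eta ^+ 2))%:E)%E.
Proof.
move=> n0 l0 eta0; set sg := residual_std tau h I J => sg0.
rewrite (residual_law tau h I J (B := [set x | sg `^ p * (n%:R * m1 * (1 + eta)) <= lp_sum p x]))//; last exact: measurable_lp_ge.
apply: le_trans (gauss_upper_tail mp pos n0 m10 eta0 E1 E2).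
rewrite le_eqVlt; apply/orP; left; apply/eqP; congr (gauss R n _).
by apply/seteqP; split => x /=; rewrite -/sg lp_sumZ// gtr0_norm// ler_pM2l ?powR_gt0.
Qed.

Lemma residual_lower_tail tau h I J eta : (0 < l)%N ->
  0 < eta -> 0 < residual_std tau h I J ->
  ((gaussmx R n d \x gauss R n) [set w |
      (lp_sum p (residual tau h w.1 w.2 I J) <=
       residual_std tau h I J `^ p * (n%:R * m1 * (1 - eta)))%R] <=
   (expR (- (n%:R * m1 ^+ 2 * eta ^+ 2 / (4 * m2))))%:E)%E.
Proof.
move=> l0 eta0; set sg := residual_std tau h I J => sg0.
rewrite (residual_law tau h I J (B := [set x | lp_sum p x <= sg `^ p * (n%:R * m1 * (1 - eta))]))//; last exact: measurable_lp_le.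
apply: le_trans (gauss_lower_tail mp pos n m10 eta0 E1 E2 m20).
rewrite le_eqVlt; apply/orP; left; apply/eqP; congr (gauss R n _).
by apply/seteqP; split => x /=; rewrite -/sg lp_sumZ// gtr0_norm// ler_pM2l ?powR_gt0.
Qed.

End residual_law.

(** * Numerical separation of near and far words *)

Section numeric.
Context (R : realType).
Implicit Types (e h r p : R).

(* Losing a quarter of the agreement costs [h / 2] in variance, and [h = 16 e] beats
   the factor [(1 + e)^2] because the variance at full agreement stays bounded. *)
Lemma separation_std e h r : 0 < e < 1 -> h = Num.min 1 (16 * e) -> r <= 3 / 4 ->
  ((1 + e) * (1 + e / 3)) ^+ 2 * (4^-1 ^+ 2 + (h ^+ 2 + 1 - 2 * h * 1)) <=
  4^-1 ^+ 2 + (h ^+ 2 + 1 - 2 * h * r).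
Proof.
move=> /andP[e0 e1] hE r34.
have h1 : h <= 1 by rewrite hE ge_min lexx.
have h0 : 0 < h by rewrite hE lt_min ltr01 mulr_gt0.
set D := 4^-1 ^+ 2 + (h ^+ 2 + 1 - 2 * h * 1).
have D0 : 0 <= D.
  have -> : D = 4^-1 ^+ 2 + (1 - h) ^+ 2 by rewrite /D; ring.
  by rewrite addr_ge0 ?sqr_ge0.
(* If [h = 1] then [D = 1/16] and [7 / 16 <= 1/2]. If [h = 16 e] then [D <= 17/16] and
   [7 * 17 / 16 <= 8]. This is what the constants [16] and [4^-1] are tuned for. *)
have hD : 7 * e * D <= h / 2.
  rewrite /D hE; have [e16|e16] := leP 1 (16 * e); first by nra.
  by nra.
have c7 : ((1 + e) * (1 + e / 3)) ^+ 2 <= 1 + 7 * e by nra.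
apply: (@le_trans _ _ ((1 + 7 * e) * D)); first by rewrite ler_wpM2r.
have -> : 4^-1 ^+ 2 + (h ^+ 2 + 1 - 2 * h * r) = D + 2 * h * (1 - r).
  by rewrite /D; ring.
by nra.
Qed.

(** The concentration error on p-sums is the ratio [x = (1 + e / 20) / (1 - e / 20) >= 1]; taking
    the root of order [p >= 1] can only reduce it, uniformly in [p]. The gap [1 + e / 3] absorbs it,
    since [(1 + e / 20)^2 <= (1 - e / 20) (1 + e / 3)]. *)
Lemma separation_norm p e sI sJ Z : 1 <= p -> 0 < e < 1 -> 0 < sI -> 0 < Z ->
  (1 + e) * (1 + e / 3) * sI <= sJ ->
  (1 + e) * (1 + e / 20) * (sI * (Z * (1 + e / 20)) `^ p^-1) <=
  sJ * (Z * (1 - e / 20)) `^ p^-1.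
Proof.
move=> p1 /andP[e0 e1] sI0 Z0 sIJ.
have p0 : 0 < p by exact: lt_le_trans p1.
have q0 : 0 < 1 - e / 20 by lra.
have q1 : 0 < 1 + e / 20 by lra.
set a := (Z * (1 - e / 20)) `^ p^-1.
have a0 : 0 <= a by exact: powR_ge0.
set x := (1 + e / 20) / (1 - e / 20).
have x1 : 1 <= x by rewrite ler_pdivlMr// mul1r; lra.
have ax : (Z * (1 + e / 20)) `^ p^-1 <= a * x.
  have -> : Z * (1 + e / 20) = (Z * (1 - e / 20)) * x.
    by rewrite /x -mulrA; congr (Z * _); rewrite mulrCA mulfV ?mulr1// gt_eqF.
  have x0 : 0 <= x by exact: le_trans x1.
  rewrite powRM//; last by rewrite mulr_ge0 ?ltW.
  rewrite -/a; apply: ler_wpM2l => //.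
  by rewrite -[leRHS]powRr1// ler_powR// invf_le1.
apply: (@le_trans _ _ ((1 + e) * (1 + e / 20) * (sI * (a * x)))).
  by rewrite ler_wpM2l ?mulr_ge0//; [lra|lra|rewrite ler_wpM2l ?(ltW sI0)].
apply: (@le_trans _ _ ((1 + e) * (1 + e / 3) * sI * a)); last by rewrite ler_wpM2r.
have -> : (1 + e) * (1 + e / 20) * (sI * (a * x)) =
    (1 + e) * sI * a * ((1 + e / 20) ^+ 2 / (1 - e / 20)).
  by rewrite /x; clearbody a; move: (1 - e / 20)^-1 => y; ring.
have -> : (1 + e) * (1 + e / 3) * sI * a = (1 + e) * sI * a * (1 + e / 3) by ring.
rewrite ler_wpM2l ?mulr_ge0 ?(ltW sI0)//; first by lra.
by rewrite ler_pdivrMr//; nra.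
Qed.

End numeric.

(** * List decoding and rare events *)

(** All the words counted here share the sketched data, hence a minimizer [x] and its decoded word
    [J0], and so lie in the ball of [J0]. The noise [g] may differ from word to word: only its
    sketch together with the signal is common. *)
Lemma decoder_list (R : realType) (p : R) n d k l s m L
    (E : 'M[R]_(m, d) -> 'cV[R]_m -> 'cV[R]_d -> R) (S : 'M[R]_(m, k + n))
    (hd : (s * l + (k - l) <= d)%N) (M tau h e U K : R) (W : 'M[R]_(n, d))
    (y : 'cV[R]_m) :
  1 <= p -> (0 < s)%N -> (0 < l)%N -> (l <= k)%N ->
  0 <= e <= 1 -> 0 < U -> 2 * U < M -> 0 <= K ->
  n%:R * (K * (2 * U / M)) <= e / 20 * U ->
  (forall t, \sum_i `|W t i| <= K) ->
  (forall J : {ffun 'I_l -> 'I_s}, (#|agree_ball J| <= L)%N) ->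
  (#|[pred I | `[< exists g,
      [/\ (S *m hard_vec hd M tau h W g I = y)%R,
          sketch_succeeds p k e E S (hard_mx k l s M W) (hard_vec hd M tau h W g I),
          (lp_norm p (residual hd tau h W g I I) <= U)%R &
          forall J, I \notin agree_ball J ->
            ((1 + e) * (1 + e / 20) * U < lp_norm p (residual hd tau h W g I J))%R] >]]|
    <= L)%N.
Proof.
move=> p1 s0 l0 lk e01 U0 UM K0 MK WK hL.
set F := [pred I | _].
have [[I FI]|F0] := pselect (exists I, F I); last first.
  rewrite eq_card0// => I; apply/negbTE/negP => FI; apply: F0; exists I.
  by move: FI; rewrite unfold_in.
have e0 : 0 <= e by case/andP: e01.
move: (FI) => /asboolP[g [Sy succ resU far]].
have [x ax] : argmin (sparse R d k) (E (S *m hard_mx k l s M W) y) !=set0.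
  by rewrite -Sy; exact: succ.1.
have [sx _] := ax.
have xle I' g' : S *m hard_vec hd M tau h W g' I' = y ->
    sketch_succeeds p k e E S (hard_mx k l s M W) (hard_vec hd M tau h W g' I') ->
    forall x0, sparse R d k x0 ->
    lp_norm p (hard_mx k l s M W *m x - hard_vec hd M tau h W g' I') <=
    (1 + e) * lp_norm p (hard_mx k l s M W *m x0 - hard_vec hd M tau h W g' I').
  move=> Sy' succ' x0 sx0; apply: (sketch_succeeds_le e0 succ' sx0).
  by rewrite Sy'.
have [J0 hJ0] := hard_decode p1 s0 l0 lk e01 U0 UM resU sx (xle _ _ Sy succ).
apply: leq_trans (hL J0); apply: subset_leq_card; apply/fintype.subsetP => I'.
rewrite unfold_in => /asboolP[g' [Sy' succ' resU' far']].
exact: (hard_decode_agree p1 s0 lk e01 U0 UM K0 MK WK resU' (xle _ _ Sy' succ') hJ0 far').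
Qed.

Lemma measure_bigsetU_le d (T : measurableType d) (R : realType)
    (mu : {measure set T -> \bar R}) (I : Type) (r : seq I) (Pr : pred I) (F : I -> set T) :
  (forall i, measurable (F i)) ->
  (mu (\big[setU/set0]_(i <- r | Pr i) F i) <= \sum_(i <- r | Pr i) mu (F i))%E.
Proof.
move=> mF; elim: r => [|i r IH]; first by rewrite !big_nil measure0.
rewrite !big_cons; case: ifP => // _.
apply: (le_trans (measureU2 mu (mF i) _)); first exact: bigsetU_measurable.
by rewrite leeD2l.
Qed.

Lemma agree_refl l s (I : {ffun 'I_l -> 'I_s}) : agree I I = l.
Proof. by rewrite agreeE (eq_bigr (fun=> 1%N)) ?sum1_card ?card_ord// => j _; rewrite eqxx. Qed.

Section hard_events.
Context (R : realType) (n d k l s : nat) (s0 : (0 < s)%N) (l0 : (0 < l)%N) (n0 : (0 < n)%N)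
  (hd : (s * l + (k - l) <= d)%N).
Variables (p m1 m2 : R).
Hypotheses (p1 : 1 <= p) (m10 : 0 < m1) (m20 : 0 < m2).
Hypothesis E1 : (\int[normal_prob 0 1]_x (`|x| `^ p)%:E = m1%:E)%E.
Hypothesis E2 : (\int[normal_prob 0 1]_x ((`|x| `^ p) ^+ 2)%:E = m2%:E)%E.
Variables (tau h eta de : R) (K : R).
Hypotheses (tau0 : 0 < tau) (eta0 : 0 < eta) (de0 : 0 < de).
Hypothesis C1 : m2 / (n%:R * m1 ^+ 2 * eta ^+ 2) <= de.
Hypothesis C2 : (s ^ l)%:R * expR (- (n%:R * m1 ^+ 2 * eta ^+ 2 / (4 * m2))) <= de.
Variables (m : nat) (Pi : 'M[R]_n).
Hypotheses (m0 : (0 < m)%N) (PiT : Pi^T = Pi) (PiPi : Pi *m Pi = Pi) (trPi : \tr Pi <= m%:R).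
Local Notation V n := (borel_mx R n 1).
Local Notation Om := (borel_mx R n d * V n)%type.
Local Notation Q := (gaussmx R n d \x gauss R n)%E.
Implicit Types I J : {ffun 'I_l -> 'I_s}.

Definition mx_abs_sum (W : 'M[R]_(n, d)) : R := \sum_t \sum_i `|W t i|.

Hypothesis hK : (Q [set w | (K <= mx_abs_sum w.1)%R] <= de%:E)%E.

(** Threshold for Markov's inequality: [linear_const R * m] bounds the mean of the squared norm of
    the projected signal. *)
Definition proj_bound : R := linear_const R * m%:R / de.

(** Four events of probability at most [de] each: planted residual too large ([C1]), residual of
    some far word too small ([C2], a union bound over at most [s^l] words), matrix too large ([hK]),
    visible signal too long (Markov). *)
Definition bad_event I : set Om :=
  [set w | residual_std tau h I I `^ p * (n%:R * m1 * (1 + eta)) <=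
           lp_sum p (residual hd tau h w.1 w.2 I I)] `|`
  \big[setU/set0]_(J : {ffun 'I_l -> 'I_s} | I \notin agree_ball J)
    [set w | lp_sum p (residual hd tau h w.1 w.2 I J) <=
             residual_std tau h I J `^ p * (n%:R * m1 * (1 - eta))] `|`
  [set w | K <= mx_abs_sum w.1] `|`
  [set w | proj_bound <= dot (Pi *m (w.1 *m word_vec R hd I)) (Pi *m (w.1 *m word_vec R hd I))].

Lemma residual_std_gt0 I J : 0 < residual_std tau h I J.
Proof.
rewrite sqrtr_gt0 ltr_pwDl ?exprn_gt0// -(dot_residual s0 l0 hd); exact: dot_ge0.
Qed.

Let mu_res I J : measurable_fun setT (fun w : Om => lp_sum p (residual hd tau h w.1 w.2 I J)).
Proof.
exact: (measurableT_comp (@measurable_lp_sum R n p) (@measurable_residual R n d k l s hd tau h I J)).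
Qed.

Let mE1 I : measurable [set w : Om | residual_std tau h I I `^ p * (n%:R * m1 * (1 + eta)) <=
           lp_sum p (residual hd tau h w.1 w.2 I I)].
Proof.
rewrite -[X in measurable X]setTI; exact: (measurable_fun_ler (measurable_cst _) (mu_res I I)).
Qed.

Let mE2 I J : measurable [set w : Om | lp_sum p (residual hd tau h w.1 w.2 I J) <=
             residual_std tau h I J `^ p * (n%:R * m1 * (1 - eta))].
Proof.
rewrite -[X in measurable X]setTI; exact: (measurable_fun_ler (mu_res I J) (measurable_cst _)).
Qed.

Lemma measurable_mx_abs_sum : measurable_fun (setT : set (borel_mx R n d)) mx_abs_sum.
Proof.
apply: measurable_sum => t; apply: measurable_sum => i.
by apply: measurableT_comp => //; exact: (measurable_mx_entry t i).
Qed.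

Let mE3 : measurable [set w : Om | K <= mx_abs_sum w.1].
Proof.
rewrite -[X in measurable X]setTI.
exact: (measurable_fun_ler (measurable_cst _) (measurableT_comp measurable_mx_abs_sum measurable_fst)).
Qed.

Let projsq I (W : 'M[R]_(n, d)) : R :=
  dot (Pi *m (W *m word_vec R hd I)) (Pi *m (W *m word_vec R hd I)).

Let measurable_dotself : measurable_fun (setT : set (V n)) (fun x : V n => dot (x : 'cV[R]_n) (x : 'cV[R]_n)).
Proof.
by apply: measurable_sum => t; apply: measurable_funM; exact: (measurable_mx_entry t ord0).
Qed.

Let mprojsq I : measurable_fun (setT : set (borel_mx R n d)) (projsq I).
Proof.
have h1 : measurable_fun setT (fun W : borel_mx R n d => Pi *m ((W : 'M[R]_(n, d)) *m word_vec R hd I) : V n).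
  apply: measurable_const_mulmx.
  exact: (measurable_mulmx (@measurable_id _ _ _) (measurable_cst (word_vec R hd I : borel_mx R d 1))).
exact: (measurableT_comp measurable_dotself h1).
Qed.

Let mE4 I : measurable [set w : Om | proj_bound <= projsq I w.1].
Proof.
rewrite -[X in measurable X]setTI.
exact: (measurable_fun_ler (measurable_cst _) (measurableT_comp (mprojsq I) measurable_fst)).
Qed.

Lemma measurable_bad_event I : measurable (bad_event I).
Proof.
apply: measurableU; last exact: mE4.
apply: measurableU; last exact: mE3.
apply: measurableU; first exact: mE1.
by apply: bigsetU_measurable => J _; exact: mE2.
Qed.

Let le2 I : (Q (\big[setU/set0]_(J : {ffun 'I_l -> 'I_s} | I \notin agree_ball J)
    [set w : Om | (lp_sum p (residual hd tau h w.1 w.2 I J) <=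
             residual_std tau h I J `^ p * (n%:R * m1 * (1 - eta)))%R]) <= de%:E)%E.
Proof.
apply: le_trans (measure_bigsetU_le _ _ _ (mE2 I)) _.
apply: (@le_trans _ _ (\sum_(J : {ffun 'I_l -> 'I_s} | I \notin agree_ball J)
   (expR (- (n%:R * m1 ^+ 2 * eta ^+ 2 / (4 * m2))))%:E)%E).
  apply: lee_sum => J _.
  exact: (residual_lower_tail n s0 hd m10 m20 E1 E2 l0 eta0 (residual_std_gt0 I J)).
rewrite sumEFin lee_fin; apply: le_trans C2.
rewrite sumr_const -[leLHS]mulr_natl ler_wpM2r ?expR_ge0// ler_nat.
by rewrite (leq_trans (max_card _))// card_ffun !card_ord.
Qed.

Let le4 I : (Q [set w : Om | (proj_bound <= projsq I w.1)%R] <= de%:E)%E.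
Proof.
have pb0 : 0 < proj_bound.
  by rewrite divr_gt0// mulr_gt0 ?ltr0n// mulr_gt0 ?expR_gt0.
have mp : measurable_fun setT (fun w : Om => projsq I w.1).
  exact: (measurableT_comp (mprojsq I) measurable_fst).
have p0 W : 0 <= projsq I W by exact: dot_ge0.
apply: (le_trans (ge0_markov Q mp (fun w => p0 w.1) pb0)).
(* [g] integrates out, and [W *m word_vec I] is standard Gaussian as [word_vec I] is a unit
   vector. *)
have -> : (\int[Q]_w (projsq I w.1)%:E = \int[gauss R n]_x (dot (Pi *m x) (Pi *m x))%:E)%E.
  rewrite (@fubini_tonelli1 _ _ _ _ _ (gaussmx R n d) (gauss R n) (fun w => (projsq I w.1)%:E))//; last 2 first.
  - exact/measurable_EFinP.
  - by move=> w; rewrite lee_fin.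
  transitivity (\int[gaussmx R n d]_W (projsq I W)%:E)%E.
    by apply: eq_integral => W _; rewrite /fubini_F /= integral_prob_cst.
  rewrite (@gaussmx_mulmx R n d (word_vec R hd I) (fun v => (dot (Pi *m v) (Pi *m v))%:E)); last 2 first.
  - apply/measurable_EFinP; apply: (measurableT_comp measurable_dotself).
    exact: measurable_const_mulmx.
  - by move=> x; rewrite lee_fin dot_ge0.
  rewrite dot_word_vec// agree_refl divff ?pnatr_eq0 -?lt0n// sqrtr1.
  by under eq_integral do rewrite scale1r.
apply: (@le_trans _ _ (proj_bound^-1%:E * (linear_const R * m%:R)%:E)%E).
  by rewrite lee_wpmul2l ?lee_fin ?invr_ge0 ?(ltW pb0)// integral_dot_proj.
rewrite -EFinM lee_fin /proj_bound invf_div mulrVK//.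
by rewrite unitfE mulf_neq0 ?pnatr_eq0 -?lt0n// mulf_neq0// gt_eqF ?expR_gt0.
Qed.

Lemma bad_event_le I : (Q (bad_event I) <= (4 * de)%:E)%E.
Proof.
have -> : 4 * de = de + de + de + de by ring.
rewrite !EFinD /bad_event.
apply: le_trans (measureU2 Q _ _) _; [|exact: mE4|].
  apply: measurableU; last exact: mE3.
  apply: measurableU; first exact: mE1.
  by apply: bigsetU_measurable => J _; exact: mE2.
apply: leeD; last exact: le4.
apply: le_trans (measureU2 Q _ _) _; [|exact: mE3|].
  apply: measurableU; first exact: mE1.
  by apply: bigsetU_measurable => J _; exact: mE2.
apply: leeD; last exact: hK.
apply: le_trans (measureU2 Q _ _) _; [exact: mE1|by apply: bigsetU_measurable => J _; exact: mE2|].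
apply: leeD; last exact: le2.
apply: (le_trans (residual_upper_tail s0 hd m10 E1 E2 n0 l0 eta0 (residual_std_gt0 I I))).
by rewrite lee_fin.
Qed.

End hard_events.

(** * The bound for the hard instance *)

Lemma powR_mulK (R : realType) (p a z : R) : 0 < p -> 0 <= a -> 0 <= z ->
  (a `^ p * z) `^ p^-1 = a * z `^ p^-1.
Proof. by move=> p0 a0 z0; rewrite powRM ?powR_ge0// -powRrM mulfV ?gt_eqF// powRr1. Qed.

Section hard_bound.
Context (R : realType) (n d k l s m L : nat).
Variables (p q q' m1 m2 e la de : R).
Variables (P : probability (borel_mx R m (k + n)) R)
  (E : 'M[R]_(m, d) -> 'cV[R]_m -> 'cV[R]_d -> R).
Hypotheses (p1 : 1 <= p) (m10 : 0 < m1) (m20 : 0 < m2).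
Hypothesis E1 : (\int[normal_prob 0 1]_x (`|x| `^ p)%:E = m1%:E)%E.
Hypothesis E2 : (\int[normal_prob 0 1]_x ((`|x| `^ p) ^+ 2)%:E = m2%:E)%E.
Hypotheses (s1 : (1 < s)%N) (l0 : (0 < l)%N) (lk : (l <= k)%N) (n0 : (0 < n)%N)
  (m0 : (0 < m)%N) (hd : (s * l + (k - l) <= d)%N).
Hypotheses (e01 : 0 < e < 1) (la0 : 0 < la) (de0 : 0 < de) (q0 : 0 <= q) (qq : q' < q).
Hypothesis C1 : m2 / (n%:R * m1 ^+ 2 * (e / 20) ^+ 2) <= de.
Hypothesis C2 : (s ^ l)%:R * expR (- (n%:R * m1 ^+ 2 * (e / 20) ^+ 2 / (4 * m2))) <= de.
Hypothesis hL : forall J : {ffun 'I_l -> 'I_s}, (#|agree_ball J| <= L)%N.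
Hypothesis obl : oblivious_sketch p k e q P E.
Local Notation V n := (borel_mx R n 1).
Local Notation Om := (borel_mx R n d * V n)%type.
Local Notation Q := (gaussmx R n d \x gauss R n)%E.
Local Notation T := {ffun 'I_l -> 'I_s}.

(** The planted residual has variance [tau^2 + (1 - h)^2] per entry, so an amplitude above 1 would
    make it grow again; hence the cap on [16 e]. *)
Let h : R := Num.min 1 (16 * e).
Let tau : R := 4^-1.
Let s0 : (0 < s)%N. Proof. exact: ltnW. Qed.
Let tau0 : 0 < tau. Proof. by rewrite invr_gt0. Qed.
Let e0 : 0 < e. Proof. by case/andP: e01. Qed.
Let e1 : e < 1. Proof. by case/andP: e01. Qed.

(** Largest squared length of the translation [(h / tau) Pi W word_vec I] off the bad event, from
    [h <= 16 e] and [tau = 4^-1]; it is of order [e^2 m]. *)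
Definition shift_bound : R := (16 * e / 4^-1) ^+ 2 * proj_bound de m.

Let hvec M (w : Om) (I : T) := hard_vec hd M tau h w.1 w.2 I.

Let measurable_hard M (I : T) :
  measurable_fun setT (fun z : borel_mx R m (k + n) * Om =>
    (z.1, (hard_mx k l s M z.2.1 : borel_mx R (k + n) d, hvec M z.2 I : borel_mx R (k + n) 1))).
Proof.
apply: measurable_fun_pair => //; apply: measurable_fun_pair.
  have h1 : measurable_fun setT (fun z : borel_mx R m (k + n) * Om =>
      (z.2.1 : 'M[R]_(n, d)) *m col_mask R d l s : borel_mx R n d).
    apply: (measurable_mulmx _ (measurable_cst (col_mask R d l s : borel_mx R d d))).
    exact: (measurableT_comp measurable_fst measurable_snd).
  exact: (measurable_col_mx (measurable_cst (pin_mx d k l s M : borel_mx R k d)) h1).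
have h2 : measurable_fun setT (fun z : borel_mx R m (k + n) * Om =>
    tau *: (z.2.2 : 'M[R]_(n, 1)) + h *: ((z.2.1 : 'M[R]_(n, d)) *m word_vec R hd I) : V n).
  apply: measurable_addmx; apply: measurable_scalemx.
    exact: (measurableT_comp measurable_snd measurable_snd).
  apply: (measurable_mulmx _ (measurable_cst (word_vec R hd I : borel_mx R d 1))).
  exact: (measurableT_comp measurable_fst measurable_snd).
exact: (measurable_col_mx (measurable_cst (const_mx M : borel_mx R k 1)) h2).
Qed.

Let sg1 : R := Num.sqrt (tau ^+ 2 + (h ^+ 2 + 1 - 2 * h * 1)).

Let sg_refl (I : T) : residual_std tau h I I = sg1.
Proof. by rewrite /residual_std agree_refl divff// pnatr_eq0 -lt0n. Qed.

Let sg1_gt0 : 0 < sg1.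
Proof.
have -> : sg1 = Num.sqrt (tau ^+ 2 + (1 - h) ^+ 2) by rewrite /sg1; congr Num.sqrt; ring.
by rewrite sqrtr_gt0 ltr_pwDl ?exprn_gt0// sqr_ge0.
Qed.

Let sg_far (I J : T) : I \notin agree_ball J ->
  (1 + e) * (1 + e / 3) * sg1 <= residual_std tau h I J.
Proof.
rewrite inE -ltnNge => hIJ.
have r34 : (agree I J)%:R / l%:R <= 3 / 4 :> R.
  rewrite ler_pdivrMr ?ltr0n// mulrAC ler_pdivlMr// -!natrM ler_nat mulnC.
  exact: ltnW.
have := separation_std e01 (erefl h) r34.
rewrite -[X in _ <= X -> _]sqr_sqrtr; last first.
  apply: addr_ge0; first exact: sqr_ge0.
  by rewrite -(dot_residual s0 l0 hd) dot_ge0.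
rewrite -[X in _ * X <= _ -> _]sqr_sqrtr; last first.
  have -> : 4^-1 ^+ 2 + (h ^+ 2 + 1 - 2 * h * 1) = 4^-1 ^+ 2 + (1 - h) ^+ 2 by ring.
  by apply: addr_ge0; exact: sqr_ge0.
rewrite -exprMn ler_sqr ?nnegrE ?sqrtr_ge0//.
by rewrite !mulr_ge0 ?sqrtr_ge0//; move: e0; lra.
Qed.

(** [Z] is the mean p-sum of a standard Gaussian vector, and [U] below is the value that the norm of
    the planted residual rarely exceeds. *)
Let Z : R := n%:R * m1.
Let Z0 : 0 < Z. Proof. by rewrite mulr_gt0// ltr0n. Qed.
Let U : R := sg1 * (Z * (1 + e / 20)) `^ p^-1.
Let U0 : 0 < U.
Proof. by rewrite mulr_gt0// powR_gt0// mulr_gt0//; move: e0; lra. Qed.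

Let p0 : 0 < p. Proof. exact: lt_le_trans p1. Qed.

Let good_resU (W : 'M[R]_(n, d)) g (I : T) :
  lp_sum p (residual hd tau h W g I I) < sg1 `^ p * (Z * (1 + e / 20)) ->
  lp_norm p (residual hd tau h W g I I) <= U.
Proof.
move=> lt; rewrite lp_normE.
have -> : U = (sg1 `^ p * (Z * (1 + e / 20))) `^ p^-1.
  rewrite powR_mulK ?(ltW sg1_gt0)//.
  by rewrite mulr_ge0 ?(ltW Z0)//; move: e0; lra.
rewrite ge0_ler_powR ?invr_ge0 ?nnegrE ?lp_sum_ge0 ?(ltW p0) ?(ltW lt)//.
by rewrite (le_trans (lp_sum_ge0 p _) (ltW lt)).
Qed.

Let good_far (W : 'M[R]_(n, d)) g (I J : T) : I \notin agree_ball J ->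
  residual_std tau h I J `^ p * (Z * (1 - e / 20)) < lp_sum p (residual hd tau h W g I J) ->
  (1 + e) * (1 + e / 20) * U < lp_norm p (residual hd tau h W g I J).
Proof.
move=> /sg_far far lt.
apply: (le_lt_trans (separation_norm p1 e01 sg1_gt0 Z0 far)).
have sJ0 : 0 <= residual_std tau h I J by exact: sqrtr_ge0.
have z0 : 0 <= Z * (1 - e / 20) by rewrite mulr_ge0 ?(ltW Z0)//; move: e1; lra.
have -> : residual_std tau h I J * (Z * (1 - e / 20)) `^ p^-1 =
    (residual_std tau h I J `^ p * (Z * (1 - e / 20))) `^ p^-1.
  by rewrite powR_mulK.
rewrite lp_normE gt0_ltr_powR ?invr_gt0 ?nnegrE ?lp_sum_ge0//.
by rewrite mulr_ge0 ?powR_ge0.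
Qed.

Section slice.
Variables (S : 'M[R]_(m, k + n)) (Pi : 'M[R]_n) (K M : R) (GS : T -> set Om).
Hypotheses (SPi : rsubmx S *m Pi = rsubmx S) (K0 : 0 <= K) (UM : 2 * U < M).
Hypothesis MK : n%:R * (K * (2 * U / M)) <= e / 20 * U.
Hypothesis mGS : forall I, measurable (GS I).
Hypothesis hGS : forall I w, GS I w ->
  sketch_succeeds p k e E S (hard_mx k l s M w.1) (hvec M w I).

Let good (I : T) : set Om :=
  GS I `\` bad_event hd p m1 tau h (e / 20) de K m Pi I.

Let mgood I : measurable (good I).
Proof. by apply: measurableD => //; exact: measurable_bad_event. Qed.

(* Under [S] the part of the signal orthogonal to the row space of [rsubmx S] is
   invisible, so the word may be encoded by the projected shift alone. *)
Lemma slice_bound (W : 'M[R]_(n, d)) :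
  (\sum_I gauss R n [set g | good I (W, g)] <=
   ((1 + la / 2) * L%:R + #|{: T}|%:R * ((expR shift_bound - 1) / (2 * la)))%:E)%E.
Proof.
pose v I := Pi *m (W *m word_vec R hd I).
(* The cut-off gives a length bound valid for every [I] at this fixed [W]. Where it acts, [(W, g)]
   is bad for all [g], so nothing is lost. *)
pose w I : 'cV[R]_n := if dot (v I) (v I) <= proj_bound de m then (h / tau) *: v I else 0.
pose B I : set 'cV[R]_n := [set x | good I (W, x - w I)].
have mB I : measurable (B I : set (V n)).
  have h1 : measurable_fun setT (fun x : V n => (x : 'M[R]_(n, 1)) + (- w I) : V n).
    exact: (measurable_addmx (@measurable_id _ _ _) (measurable_cst (- w I : borel_mx R n 1))).
  have h2 := measurable_slice1 (W : borel_mx R n d) (mgood I).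
  by rewrite -[X in measurable X]setTI; exact: (h1 measurableT _ h2).
have hw I : dot (w I) (w I) <= shift_bound.
  rewrite /w /shift_bound; case: ifPn => [le|_].
    rewrite dotZl dotC dotZl mulrA -expr2 ler_pM ?sqr_ge0 ?dot_ge0//.
    have h0 : 0 <= h by rewrite /h le_min ler01 mulr_ge0 ?(ltW e0).
    rewrite ler_sqr ?nnegrE ?divr_ge0 ?(ltW tau0)// ?mulr_ge0 ?(ltW e0)//.
    by rewrite ler_wpM2r ?invr_ge0 ?(ltW tau0)// /h ge_min lexx orbT.
  rewrite {1}/dot big1 => [|i _]; last by rewrite !mxE mul0r.
  rewrite mulr_ge0 ?sqr_ge0// /proj_bound divr_ge0 ?(ltW de0)//.
  by rewrite !mulr_ge0 ?expR_ge0.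
have hB x : (#|[pred I | `[< B I x >]]| <= L)%N.
  (* For [g = x - w I] the translation cancels the visible signal: [S b] equals this [y] whatever
     [I], and the words with [B I x] form a single decoder list. *)
  pose y := lsubmx S *m const_mx M + tau *: (rsubmx S *m x).
  have [[I0 BI0]|nB] := pselect (exists I, B I x); last first.
    rewrite eq_card0// => I; apply/negbTE/negP; rewrite unfold_in => /asboolP BI.
    by apply: nB; exists I.
  have WK t : \sum_i `|W t i| <= K.
    have [_ nb] := BI0; rewrite leNgt; apply/negP => lt; apply: nb.
    left; right => /=; apply: (le_trans (ltW lt)).
    rewrite /mx_abs_sum (bigD1 t)//= lerDl; apply: sumr_ge0 => t' _.
    by apply: sumr_ge0 => i _.
  have e01' : 0 <= e <= 1 by rewrite !ltW.
  apply: leq_trans (@decoder_list R p n d k l s m L E S hd M tau h e U K W y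
    p1 s0 l0 lk e01' U0 UM K0 MK WK hL).
  apply: subset_leq_card; apply/fintype.subsetP => I; rewrite !unfold_in => /asboolP BI.
  apply/asboolP; exists (x - w I).
  have [GI nb] := BI.
  have wE : w I = (h / tau) *: v I.
    rewrite /w ifT// leNgt; apply/negP => lt; apply: nb; right => /=.
    exact: ltW.
  split.
  - rewrite -[S]hsubmxK mul_row_col /y; congr (_ + _).
    rewrite wE mulmxDr -(scalemxAr tau) -(scalemxAr h) mulmxBr -scalemxAr.
    have -> : rsubmx S *m (W *m word_vec R hd I) = rsubmx S *m v I.
      by rewrite /v [in RHS]mulmxA SPi.
    by rewrite scalerBr scalerA (mulrC tau) divfK ?gt_eqF// subrK.
  - exact: (hGS GI).
  - apply: good_resU; rewrite ltNge; apply/negP => le; apply: nb.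
    by left; left; left; rewrite /= sg_refl.
  - move=> J nJ; apply: (good_far nJ); rewrite ltNge; apply/negP => le; apply: nb.
    left; left; right; rewrite (bigD1 J)//=; left.
    exact: le.
have := gauss_testing la0 mB hw hB.
rewrite (eq_bigr (fun I => gauss R n [set g | good I (W, g)]))// => I _.
by congr (gauss R n _); apply/seteqP; split => g; rewrite /B /= addrK.
Qed.

End slice.

(** Left: the success of the chosen sketch, averaged over words and inputs. Right: [slice_bound]
    integrated over [W], plus the probability [4 de] of the bad event for each word. *)
Lemma hard_bound :
  (s ^ l)%:R * q' <= (1 + la / 2) * L%:R
     + (s ^ l)%:R * ((expR shift_bound - 1) / (2 * la)) + 4 * de * (s ^ l)%:R.
Proof.
have [G [mG hG hP]] := obl.
have cT : #|{: T}| = (s ^ l)%N by rewrite card_ffun !card_ord.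
have [K K0 hK] := tail_exists Q
  (measurableT_comp (@measurable_mx_abs_sum R n d) measurable_fst) de0.
(* The terms [2 U + 1] ensure [2 U < M]; the last one brings the decoding error [2 n K U / M] down
   to [e U / 20]. *)
pose M := 2 * U + 1 + 40 * n%:R * K / e.
have nK0 : 0 <= 40 * n%:R * K / e by rewrite divr_ge0 ?(ltW e0)// !mulr_ge0// ltW.
have UM : 2 * U < M by rewrite /M; lra.
have Mp : 0 < M by move: U0 UM; lra.
have MK : n%:R * (K * (2 * U / M)) <= e / 20 * U.
  rewrite (_ : n%:R * (K * (2 * U / M)) = (2 * n%:R * K * U) / M); last by field; rewrite gt_eqF.
  rewrite ler_pdivrMr// (_ : e / 20 * U * M = (e * M / 20) * U); last by ring.
  rewrite ler_wpM2r ?(ltW U0)// ler_pdivlMr//.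
  have -> : e * M = e * (2 * U + 1) + 40 * n%:R * K.
    by rewrite /M mulrDr (mulrC e (_ / e)) divfK ?gt_eqF//.
  have : 0 <= e * (2 * U + 1) by rewrite mulr_ge0 ?(ltW e0)//; move: U0; lra.
  by lra.
pose Phi (I : T) (z : borel_mx R m (k + n) * Om) :
    borel_mx R m (k + n) * (borel_mx R (k + n) d * borel_mx R (k + n) 1) :=
  (z.1, (hard_mx k l s M z.2.1, hvec M z.2 I)).
have mPhi I : measurable_fun setT (Phi I) by exact: measurable_hard.
have mGI I : measurable (Phi I @^-1` G).
  by rewrite -[X in measurable X]setTI; exact: mPhi.
have T0 : (0 < #|{: T}|)%N by rewrite cT expn_gt0 s0.
have [S] := @exists_good_sketch _ _ _ _ R P Q {: T} (fun I => Phi I @^-1` G) q q'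
  T0 q0 qq mGI (fun I w => hP (hard_mx k l s M w.1) (hvec M w I)).
rewrite cT => hS.
pose GS I : set Om := [set w | (Phi I @^-1` G) (S, w)].
have mGS I : measurable (GS I) by exact: measurable_slice1.
have hGS I w : GS I w -> sketch_succeeds p k e E S (hard_mx k l s M w.1) (hvec M w I).
  exact: hG.
have [Pi [SPi PiT PiPi trPi]] := row_space_projection (rsubmx (S : 'M[R]_(m, k + n))).
pose bad I := bad_event hd p m1 tau h (e / 20) de K m Pi I.
have mbad I : measurable (bad I) by exact: measurable_bad_event.
have mgood I : measurable (GS I `\` bad I) by exact: measurableD.
have badle I : (Q (bad I) <= (4 * de)%:E)%E.
  have e20 : 0 < e / 20 by rewrite divr_gt0.
  exact: (bad_event_le s0 l0 n0 hd m10 m20 E1 E2 h tau0 e20 de0 C1 C2 m0 PiT PiPi trPi hK).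
have goodle : (\sum_I Q (GS I `\` bad I) <=
   ((1 + la / 2) * L%:R + #|{: T}|%:R * ((expR shift_bound - 1) / (2 * la)))%:E)%E.
  rewrite (eq_bigr (fun I => \int[gaussmx R n d]_W gauss R n [set g | (GS I `\` bad I) (W, g)])%E); last first.
    by move=> I _; rewrite product_measure_slice.
  rewrite -ge0_integral_sum//; last by move=> I; exact: measurable_measure_slice1.
  rewrite -[leRHS](integral_prob_cst (gaussmx R n d)); apply: ge0_le_integral => //.
  - by move=> W _; apply: sume_ge0.
  - by apply: emeasurable_sum => I; exact: measurable_measure_slice1.
  - by move=> W _; exact: (slice_bound SPi (ltW K0) UM MK mGS hGS).
have := lt_le_trans hS (_ : _ <= \sum_I (Q (GS I `\` bad I) + (4 * de)%:E))%E.
have sumle : (\sum_I Q (GS I) <= \sum_I (Q (GS I `\` bad I) + (4 * de)%:E))%E.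
  apply: lee_sum => I _; apply: (@le_trans _ _ (Q (GS I `\` bad I) + Q (bad I))%E).
    apply: le_trans (measureU2 Q (mgood I) (mbad I)).
    apply: le_measure; rewrite ?inE//; first exact: measurableU.
    by move=> w Gw; have [bw|nbw] := pselect (bad I w); [right|left].
  by rewrite leeD2l.
move=> /(_ sumle); rewrite big_split /= sumEFin sumr_const cT -(mulr_natr (4 * de)) => lt.
have := lt_le_trans lt (leeD2r _ goodle).
by rewrite -EFinD lte_fin cT => /ltW.
Qed.

End hard_bound.

(** * Choice of the parameters *)

(** [exp D - 1 <= D exp D <= th t exp(t / 2)], and [t exp(- t / 2) <= 2]. The bound is uniform in
    [t], so small codes need no separate treatment when [t] is a multiple of [ln (s^l)]. *)
Lemma expR_small (R : realType) (th t D : R) : 0 < th <= 2^-1 -> 0 <= t -> 0 <= D <= th * t ->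
  expR (- t) * (expR D - 1) <= 2 * th.
Proof.
move=> /andP[th0 th1] t0 /andP[D0 Dt].
have h1 : expR D - 1 <= D * expR D.
  have := expR_ge1Dx (- D); rewrite expRN => h.
  have : (1 - D) * expR D <= 1.
    by rewrite -ler_pdivlMr ?expR_gt0// mul1r.
  by rewrite mulrBl mul1r; lra.
have h2 : D * expR D <= th * t * expR (t / 2).
  rewrite ler_pM ?expR_ge0// ler_expR (le_trans Dt)// mulrC ler_wpM2l//.
have h3 : t / 2 <= expR (t / 2) by have := expR_ge1Dx (t / 2); lra.
have -> : expR (- t) = (expR (t / 2) * expR (t / 2))^-1.
  by rewrite -expRD -expRN; congr expR; field.
have y0 := expR_gt0 (t / 2); move: y0 h2 h3; set y := expR (t / 2) => y0 h2 h3.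
rewrite mulrC ler_pdivrMr ?mulr_gt0//; apply: (le_trans h1); apply: (le_trans h2).
rewrite [leRHS](_ : _ = th * (2 * y) * y); last by ring.
by rewrite ler_wpM2r ?(ltW y0)// ler_wpM2l ?(ltW th0)//; lra.
Qed.

Lemma natr_le_expR (R : realType) (L N : nat) (t : R) : (L ^ 8 <= N ^ 7)%N ->
  expR (8 * t) = N%:R -> L%:R <= N%:R * expR (- t).
Proof.
move=> LN ht; have t0 := expR_gt0 t; rewrite expRN ler_pdivlMr//.
rewrite -(@ler_pXn2r _ 8) ?nnegrE ?mulr_ge0 ?expR_ge0//.
rewrite exprMn -expRM_natl ht [in leRHS]exprS mulrC.
by rewrite ler_wpM2l// -!natrX ler_nat.
Qed.

Lemma ln2_ge (R : realType) : 2^-1 <= ln 2 :> R.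
Proof.
have h1 : -1 < - 2^-1 :> R by lra.
have := le_ln1Dx h1; rewrite (_ : 1 + - 2^-1 = 2^-1 :> R); last by field.
by rewrite lnV ?posrE// lerN2.
Qed.

Lemma sketch_lower_bound (R : realType) (q : R) : 2^-1 < q ->
  exists2 c : R, 0 < c & forall p : R, 1 <= p ->
  exists2 C : R, 0 < C & forall (n d k l s m : nat) (e : R)
    (P : probability (borel_mx R m (k + n)) R)
    (E : 'M[R]_(m, d) -> 'cV[R]_m -> 'cV[R]_d -> R),
    (1 < s)%N -> (0 < l)%N -> (l <= k)%N -> (0 < m)%N -> (s * l + (k - l) <= d)%N ->
    0 < e < 1 -> C * (l%:R * ln s%:R / e ^+ 2) <= n%:R ->
    oblivious_sketch p k e q P E ->
    c * (l%:R * ln s%:R / e ^+ 2) <= m%:R.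
Proof.
move=> hq; pose r := q - 2^-1; have r0 : 0 < r by rewrite subr_gt0.
pose de := r / 32; have de0 : 0 < de by rewrite divr_gt0.
pose th := Num.min 2^-1 (r ^+ 2 / 32).
have th0 : 0 < th by rewrite lt_min invr_gt0 ltr0n divr_gt0 ?exprn_gt0.
have th1 : th <= 2^-1 by rewrite ge_min lexx.
have thr : th <= r ^+ 2 / 32 by rewrite ge_min lexx orbT.
have lc0 : 0 < linear_const R by rewrite mulr_gt0// expR_gt0.
(* [64 = 16 / 4^-1] comes from the ratio [h / tau], the factor [8] from the eighth root in the list
   size; [de] and [linear_const] come from [proj_bound]. *)
exists (th * de / (8 * 64 ^+ 2 * linear_const R)).
  by rewrite divr_gt0 ?mulr_gt0 ?exprn_gt0.
move=> p p1; have p0 : 0 < p by exact: lt_le_trans p1.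
have [m1 m10 E1] := normal_moment p0.
have [m2 m20 E2'] := normal_moment (mulr_gt0 (ltr0n R 2 : 0 < 2) p0).
have E2 : (\int[normal_prob 0 1]_x ((`|x| `^ p) ^+ 2)%:E = m2%:E)%E.
  rewrite -E2'; apply: eq_integral => x _.
  by rewrite -powR_mulrn ?powR_ge0// -powRrM mulrC.
(* [40^2 = 4 * 20^2] collects the constants of the lower tail at [eta = e / 20]. In the last factor,
   [1] pays for the [s^l] words of the union bound and [2 / de] for reaching [de], as
   [ln (1 / de) <= 1 / de] and [l ln s >= 1/2]. *)
have C0 : 0 < 40 ^+ 2 * m2 / m1 ^+ 2 * (1 + 2 / de).
  by rewrite mulr_gt0 ?divr_gt0 ?mulr_gt0 ?exprn_gt0// addr_gt0// divr_gt0.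
exists (40 ^+ 2 * m2 / m1 ^+ 2 * (1 + 2 / de)) => //.
move=> n d k l s m e P E s1 l0 lk m0 hd e01 hn obl.
have e0 : 0 < e by case/andP: e01.
have e20 : 0 < e ^+ 2 by rewrite exprn_gt0.
pose la := l%:R * ln s%:R : R.
have lnE : expR la = (s ^ l)%:R.
  by rewrite /la expRM_natl lnK ?natrX// posrE ltr0n ltnW.
have la2 : 2^-1 <= la.
  rewrite (le_trans (ln2_ge R))// -[leLHS]mul1r ler_pM ?ler1n ?ln_ge0 ?ler1n//.
  by rewrite ler_ln ?posrE ?ltr0n ?ler_nat// ltnW.
rewrite -/la in hn *.
have n0 : (0 < n)%N.
  rewrite -(ltr0n R); apply: lt_le_trans hn; rewrite mulr_gt0// divr_gt0//; lra.
have hn' : 40 ^+ 2 * m2 * (1 + 2 / de) * la <= n%:R * m1 ^+ 2 * e ^+ 2.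
  rewrite -ler_pdivrMr// -ler_pdivrMr ?exprn_gt0//; apply: le_trans hn.
  rewrite le_eqVlt; apply/orP; left; apply/eqP; field.
  by rewrite !gt_eqF.
have D0 : 0 < n%:R * m1 ^+ 2 * e ^+ 2 by rewrite !mulr_gt0 ?exprn_gt0 ?ltr0n.
pose X := n%:R * m1 ^+ 2 * e ^+ 2.
have XE : n%:R * m1 ^+ 2 * (e / 20) ^+ 2 = X / 20 ^+ 2 by rewrite expr_div_n mulrA.
rewrite -/X in hn' D0.
have C1 : m2 / (n%:R * m1 ^+ 2 * (e / 20) ^+ 2) <= de.
  rewrite XE ler_pdivrMr ?divr_gt0// mulrA ler_pdivlMr//.
  rewrite -ler_pdivrMl//; apply: le_trans hn'.
  rewrite [leLHS](_ : _ = 40 ^+ 2 * m2 * (de^-1 / 4)); last by field; rewrite gt_eqF.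
  rewrite -[leRHS]mulrA ler_pM2l ?mulr_gt0//.
  by have := invr_gt0 de; rewrite de0; nra.
have C2 : (s ^ l)%:R * expR (- (n%:R * m1 ^+ 2 * (e / 20) ^+ 2 / (4 * m2))) <= de.
  rewrite XE -lnE -expRD -[leRHS]lnK ?posrE// ler_expR.
  have := ln_sublinear (_ : 0 < de^-1); rewrite invr_gt0 lnV ?posrE// => /(_ de0) h1.
  have h2 : (1 + 2 / de) * la <= X / 20 ^+ 2 / (4 * m2).
    rewrite [leRHS](_ : _ = X / (40 ^+ 2 * m2)); last by field; rewrite gt_eqF.
    by rewrite ler_pdivlMr ?mulr_gt0// mulrC mulrA.
  have : de^-1 <= 2 / de * la by have := invr_gt0 de; rewrite de0; nra.
  by move: h1 h2; rewrite mulrDl mul1r; lra.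
pose L := \max_(J : {ffun 'I_l -> 'I_s}) #|agree_ball J|.
have hL (J : {ffun 'I_l -> 'I_s}) : (#|agree_ball J| <= L)%N by exact: leq_bigmax.
have s0 := ltnW s1.
have T0 : (0 < #|{: {ffun 'I_l -> 'I_s}}|)%N by rewrite card_ffun !card_ord expn_gt0 s0.
have [J] := @bigop.eq_bigmax _ (fun J : {ffun 'I_l -> 'I_s} => #|agree_ball J|) T0; rewrite -/L => LJ.
have L0 : (0 < L)%N.
  by rewrite LJ; apply/card_gt0P; exists J; rewrite inE agree_refl leq_mul2r orbT.
have L2 : 2 * L%:R <= (s ^ l)%:R :> R.
  by rewrite -natrM ler_nat LJ; exact: agree_ball_half.
have L8 : L%:R <= (s ^ l)%:R * expR (- (la / 8)).
  apply: natr_le_expR; first by rewrite LJ; exact: agree_ball_card.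
  by rewrite mulrC divfK.
rewrite leNgt; apply/negP => hm.
have S0 : 0 <= shift_bound m e de.
  by rewrite mulr_ge0 ?sqr_ge0// divr_ge0 ?(ltW de0)// mulr_ge0 ?(ltW lc0).
have Sm : shift_bound m e de <= th * (la / 8).
  have -> : shift_bound m e de = m%:R * (8 * 64 ^+ 2 * linear_const R * e ^+ 2 / de) / 8.
    by rewrite /shift_bound /proj_bound; field; rewrite gt_eqF.
  rewrite (mulrA th) ler_pM2r ?invr_gt0 ?ltr0n// -ler_pdivlMr; last first.
    by rewrite divr_gt0 ?mulr_gt0 ?exprn_gt0.
  apply: (le_trans (ltW hm)); rewrite le_eqVlt; apply/orP; left; apply/eqP; field.
  by rewrite !gt_eqF.
have thb : 0 < th <= 2^-1 by rewrite th0 th1.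
have la8 : 0 <= la / 8 by lra.
have Sb : 0 <= shift_bound m e de <= th * (la / 8) by rewrite S0 Sm.
have small := expR_small thb la8 Sb.
have LR : 0 < L%:R :> R by rewrite ltr0n.
have NR : 0 < (s ^ l)%:R :> R by rewrite -lnE expR_gt0.
(* Budget in units of [s^l]: a success of [1/2 + r / 2] against [1/2] for the list, [r / 4] for the
   linearization (whence [ka]), [r / 16] for the translation and [r / 8] for the bad events; the
   last three add up to [7 r / 16]. *)
pose ka := r / 2 * ((s ^ l)%:R / L%:R).
have ka0 : 0 < ka by rewrite mulr_gt0// divr_gt0.
have q0 : 0 <= q by move: hq; lra.
have qq : q - r / 2 < q by lra.
have := hard_bound p1 m10 m20 E1 E2 s1 l0 lk n0 m0 hd e01 ka0 de0 q0 qq C1 C2 hL obl.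
move: S0 Sm small; set Dl := shift_bound m e de => S0 Sm small.
have -> : (1 + ka / 2) * L%:R = L%:R + r / 4 * (s ^ l)%:R.
  by rewrite /ka; field; rewrite gt_eqF.
have -> : (s ^ l)%:R * ((expR Dl - 1) / (2 * ka)) = L%:R * (expR Dl - 1) / r.
  by rewrite /ka; field; rewrite !gt_eqF.
have : L%:R * (expR Dl - 1) / r <= (s ^ l)%:R * (r / 16).
  rewrite ler_pdivrMr//.
  have eD : 0 <= expR Dl - 1 by have := expR_ge1Dx Dl; lra.
  apply: (le_trans (ler_wpM2r eD L8)); rewrite -mulrA -(mulrA _ (r / 16) r) ler_pM2l//.
  by apply: (le_trans small); move: thr; rewrite expr2; lra.
have -> : 4 * de = r / 8 by rewrite /de; field.
have -> : q = 2^-1 + r by rewrite /r addrC subrK.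
move: L2 NR; set NN := (s ^ l)%:R; set LL := L%:R * _ / r; move: (L%:R) => Lr.
have rN : 0 < NN -> 0 < r * NN by move=> ?; rewrite mulr_gt0.
by move=> L2 NR; have := rN NR; nra.
Qed.

(** If [d >= 2 k], take [k] blocks of size [s = floor(d / k)]; rounding at most doubles the
    logarithm, as [d / k < s + 1 <= s^2]. If [k < d < 2 k], take [d - k] blocks of size two and
    [2 k - d] of size one, since [k ln (d / k)] is then comparable to [d - k]. *)
Lemma sparse_parameters (R : realType) (k d : nat) : (0 < k)%N -> (k < d)%N ->
  exists l s : nat,
    [/\ (1 < s)%N, (0 < l)%N, (l <= k)%N, (s * l + (k - l) <= d)%N &
        k%:R * ln (d%:R / k%:R) <= 2 * (l%:R * ln s%:R) :> R /\
        l%:R * ln s%:R <= 2 * (k%:R * ln (d%:R / k%:R)) :> R].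
Proof.
move=> k0 kd; have d0 := ltn_trans k0 kd.
have kR : 0 < k%:R :> R by rewrite ltr0n.
have dR : 0 < d%:R :> R by rewrite ltr0n.
have dk0 : 0 < d%:R / k%:R :> R by rewrite divr_gt0.
have [d2k|dk2] := leqP (2 * k) d.
  exists k, (d %/ k)%N.
  have s1 : (1 < d %/ k)%N by rewrite leq_divRL.
  have sd := leq_divM d k.
  have sR : 0 < (d %/ k)%:R :> R by rewrite ltr0n ltnW.
  split => //; first by rewrite subnn addn0.
  have h1 : ln (d%:R / k%:R) <= 2 * ln (d %/ k)%:R :> R.
    rewrite (mulr_natl _ 2) -lnXn// ler_ln ?posrE ?exprn_gt0// ler_pdivrMr//.
    rewrite -natrX -natrM ler_nat.
    have := ltn_ceil d k0; move: s1; set s := (d %/ k)%N => s1 ds.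
    by apply: (leq_trans (ltnW ds)); rewrite leq_mul2r; apply/orP; right; nia.
  have h2 : ln (d %/ k)%:R <= ln (d%:R / k%:R) :> R.
    by rewrite ler_ln ?posrE// ler_pdivlMr// -natrM ler_nat.
  have h3 : 0 <= ln (d %/ k)%:R :> R by rewrite ln_ge0 // ler1n ltnW.
  split; rewrite [2 * _]mulrCA ler_pM2l//.
  by apply: (le_trans h2); rewrite ler_peMl ?(le_trans h3 h2)// ler1n.
(* Too few columns for [k] blocks of size two. *)
exists (d - k)%N, 2%N.
have kd' : (k <= d)%N by exact: ltnW.
have dkR : (d - k)%:R = d%:R - k%:R :> R by rewrite natrB.
have dkR0 : 0 < d%:R - k%:R :> R by rewrite subr_gt0 ltr_nat.
have dk2R : d%:R <= 2 * k%:R :> R by rewrite -natrM ler_nat ltnW.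
split => //; [by rewrite subn_gt0 | by lia | by lia |].
have l2 := ln2_ge R.
have l2' : ln 2 <= 1 :> R.
  by have := @le_ln1Dx R 1 (_ : -1 < 1); apply; lra.
rewrite dkR; split.
  have h : -1 < d%:R / k%:R - 1 :> R by lra.
  have := le_ln1Dx h; rewrite addrC subrK => h'.
  have : k%:R * ln (d%:R / k%:R) <= k%:R * (d%:R / k%:R - 1) :> R by rewrite ler_pM2l.
  have -> : k%:R * (d%:R / k%:R - 1) = d%:R - k%:R :> R by field; rewrite gt_eqF.
  nra.
(* Here [ln x >= 1 - 1 / x] at [x = d / k], together with [k / d >= 1/2]. *)
have h : -1 < k%:R / d%:R - 1 :> R by have := divr_gt0 kR dR; lra.
have := le_ln1Dx h; rewrite addrC subrK -invf_div lnV ?posrE// => h'.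
have h2 : k%:R * (1 - k%:R / d%:R) <= k%:R * ln (d%:R / k%:R) :> R.
  by rewrite ler_pM2l//; rewrite invf_div in h'; lra.
have h3 : (d%:R - k%:R) / 2 <= k%:R * (1 - k%:R / d%:R) :> R.
  have -> : k%:R * (1 - k%:R / d%:R) = (d%:R - k%:R) * (k%:R / d%:R) :> R.
    by field; rewrite gt_eqF.
  rewrite ler_pM2l// ler_pdivlMr// mulrC ler_pdivrMr//; lra.
nra.
Qed.

(** A lower bound on [n] is natural: with [m = n] the identity sketch is exact, so [m] cannot be
    forced above [n]. The constant [c] is uniform in [p]; only the threshold [C] depends on it,
    through the moments that govern the concentration of p-norms. *)
Theorem theorem2 (R : realType) (q : R) (hq : 2^-1 < q) :
  exists2 c : R, 0 < c &
  forall p : R, 1 <= p ->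
  exists2 C : R, 0 < C &
  forall (n d k m : nat) (eps : R)
    (P : probability (borel_mx R m n) R)
    (E : 'M[R]_(m, d) -> 'cV[R]_m -> 'cV[R]_d -> R),
    (0 < n)%N -> (0 < d)%N -> (0 < k)%N -> (k <= d)%N ->
    0 < eps < 1 ->
    C * (k%:R * ln (d%:R / k%:R) / eps ^+ 2) <= n%:R ->
    oblivious_sketch p k eps q P E ->
    c * (k%:R * ln (d%:R / k%:R) / eps ^+ 2) <= m%:R.
Proof.
have [c0 c00 hc] := sketch_lower_bound hq.
exists (Num.min 1 (c0 / 2)); first by rewrite lt_min ltr01 divr_gt0.
move=> p p1; have [C0 C00 hC] := hc p p1.
(* The factor 2 converts [X] into the quantity [Y] of the block parameters. The extra [X] pays for
   the [k] pinning rows, taken out of the [n] rows only when [k < X]. *)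
exists (2 * C0 + 1); first by rewrite addr_gt0 ?mulr_gt0.
move=> n d k m e P E n0 d0 k0 kd e01 hn obl.
have e0 : 0 < e by case/andP: e01.
have [kd'|dk] := ltnP k d; last first.
  have -> : d = k by apply/eqP; rewrite eqn_leq dk.
  by rewrite divff ?pnatr_eq0 -?lt0n// ln1 mulr0 mul0r mulr0.
have [l [s [s1 l0 lk hd [XY YX]]]] := sparse_parameters R k0 kd'.
have mnk := exact_recovery_bound p1 hq (ltW e0) kd obl.
move: hn; set X := k%:R * _ / _ => hn.
pose Y : R := l%:R * ln s%:R / e ^+ 2.
have e20 : 0 < e ^+ 2 by rewrite exprn_gt0.
have Y0 : 0 <= Y by rewrite divr_ge0 ?(ltW e20)// mulr_ge0// ln_ge0// ler1n ltnW.
have {}XY : X <= 2 * Y by rewrite /Y mulrA ler_pM2r ?invr_gt0.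
have {}YX : Y <= 2 * X by rewrite /X mulrA ler_pM2r ?invr_gt0.
have X0 : 0 <= X by lra.
have c1 : Num.min 1 (c0 / 2) * X <= X.
  by rewrite -[leRHS]mul1r ler_wpM2r// ge_min lexx.
have c2 : Num.min 1 (c0 / 2) * X <= c0 / 2 * X by rewrite ler_wpM2r// ge_min lexx orbT.
have CX : 0 <= C0 * X by rewrite mulr_ge0// ltW.
have hn1 : X <= n%:R by apply: le_trans hn; lra.
have [nk|kn] := leqP n k.
  move: mnk; rewrite (minn_idPl nk) => mn.
  by rewrite (le_trans c1)// (le_trans hn1)// ler_nat.
move: mnk; rewrite (minn_idPr (ltnW kn)) => km.
have [kX|Xk] := leP X k%:R; first by rewrite (le_trans c1)// (le_trans kX)// ler_nat.
have nE : n = (k + (n - k))%N by rewrite subnKC// ltnW.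
move: (n - k)%N nE hn P E obl => n' -> hn P E obl.
have hn' : C0 * Y <= n'%:R.
  apply: (@le_trans _ _ (2 * C0 * X)); first by rewrite [2 * C0]mulrC -mulrA ler_pM2l.
  by move: hn; rewrite natrD; lra.
have := hC _ _ _ _ _ _ _ _ _ s1 l0 lk (leq_trans k0 km) hd e01 hn' obl.
by apply: le_trans; apply: (le_trans c2); rewrite -mulrA ler_pM2l//; rewrite -/Y; lra.
Qed.
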